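(* Let $\mu,\nu\in\mathcal{P}(\mathbb{S})$ with $\mu\ll\nu$, and let $f\in\mathcal{O}$. Then $$|\mathbf{E}^\mu(f(X_t)|\mathscr{F}_t^Y)-\mathbf{E}^\nu(f(X_t)|\mathscr{F}_t^Y)|\xrightarrow{t\to\infty}0\quad\mathbf{P}^\mu\text{-a.s.}$$
   Context: Model. $\mathbb{S}$ is a compact Polish space and $\mathbb{O}=\mathbb{R}^p$, $p<\infty$. $(X_t,Y_t)_{t\in[0,\infty)}$ is a time-homogeneous $\mathbb{S}\times\mathbb{O}$-valued Feller-Markov process (Feller: its semigroup maps $\mathcal{C}_0(\mathbb{S}\times\mathbb{O})$ into itself) with càdlàg paths, realized as the canonical process on $\Omega=D([0,\infty);\mathbb{S})\times D([0,\infty);\mathbb{O})$ (Skorokhod topology) with its Borel $\sigma$-algebra $\mathscr{F}$; $\mathbf{P}_{(x,y)}$ is its law started from $(x,y)$ and $\mathbf{P}_\mu=\int\mathbf{P}_{(x,y)}\,\mu(dx,dy)$ for $\mu\in\mathcal{P}(\mathbb{S}\times\mathbb{O})$, with expectations $\mathbf{E}_{(x,y)}$, $\mathbf{E}_\mu$. Put $\mathscr{F}_t^X=\sigma\{X_s:s\le t\}$, $\mathscr{F}_t^Y=\sigma\{Y_s:s\le t\}$, $\mathscr{F}_t=\sigma\{(X_s,Y_s):s\le t\}$, $\mathscr{G}_t^Y=\sigma\{Y_s-Y_0:s\le t\}$, and $\mathscr{F}^X=\bigvee_t\mathscr{F}^X_t$, $\mathscr{F}^Y=\bigvee_t\mathscr{F}^Y_t$,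 $\mathscr{G}^Y=\bigvee_t\mathscr{G}^Y_t$; all of these are replaced by their usual augmentations with respect to the family $\{\mathbf{P}_\mu\}$. The signal $X_t$ is a Feller-Markov process in its own right and $Y_t$ has conditionally independent increments given the signal, in the following sense: for every bounded $\mathscr{F}^X\vee\mathscr{G}^Y$-measurable $\xi$, the map $(x,y)\mapsto\mathbf{E}_{(x,y)}(\xi)$ does not depend on $y$. For $\mu\in\mathcal{P}(\mathbb{S})$ write $\mathbf{P}^\mu=\mathbf{P}_{\mu\times\delta_{\{0\}}}$, with expectation $\mathbf{E}^\mu$ (so $Y_0=0$ under $\mathbf{P}^\mu$). Observable functions. For $\mu_1,\mu_2\in\mathcal{P}(\mathbb{S})$ write $\mu_1\backsim\mu_2$ if $\mathbf{P}^{\mu_1}|_{\mathscr{F}^Y}=\mathbf{P}^{\mu_2}|_{\mathscr{F}^Y}$. The space of observable functions is $\mathcal{O}=\{f\in\mathcal{C}_b(\mathbb{S}):\mu_1(f)=\mu_2(f)\text{ for all }\mu_1\backsim\mu_2\}$, where $\mu(f)=\int f\,d\mu$ and $\mathcal{C}_b(\mathbb{S})$ is the space of bounded continuous real functions. The processes $t\mapsto\mathbf{E}^\mu(f(X_t)|\mathscr{F}_t^Y)$ always denote càdlàg versions. *)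

(* Defs.v *)
From HB Require Import structures.
From mathcomp Require Import all_boot all_order all_algebra.
From mathcomp Require Import all_classical all_reals all_analysis.

Set Implicit Arguments.
Unset Strict Implicit.
Unset Printing Implicit Defensive.

Import Order.TTheory GRing.Theory Num.Theory.
Import numFieldNormedType.Exports.

Local Open Scope classical_set_scope.
Local Open Scope ring_scope.

(** ** State spaces *)

(* The type carries a complete pseudometric, which separates points as soon as
   the topology is Hausdorff. The notions below depend on the choice of this
   metric only through the topology it induces. *)
Definition polish (R : realType) (T : completePseudoMetricType R) : Prop :=
  hausdorff_space T /\ exists2 D : set T, countable D & dense D.

(* The Borel sigma-algebra. On a product of two separable metrizable spaces it is
   the product sigma-algebra, which is what [borel S * borel O] carries. *)
Notation borel T := (g_sigma_algebraType (@open T)).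

(* Continuous functions vanishing at infinity; on a compact space, all the
   continuous functions. *)
Definition C0 (R : realType) (T : topologicalType) : set (T -> R) :=
  [set g | continuous g /\
     forall e : R, 0 < e ->
       exists2 K : set T, compact K & forall x, ~ K x -> `|g x| < e].

(** ** Skorokhod space *)

Definition cadlag (R : realType) (T : topologicalType) (w : R -> T) : Prop :=
  (forall t : R, 0 <= t -> w s @[s --> t^'+] --> w t) /\
  (forall t : R, 0 < t -> exists l : T, w s @[s --> t^'-] --> l).

(* An element of D([0,oo); T) is encoded as a function on R that is constant on
   ]-oo, 0]. *)
Record skorokhod (R : realType) (T : topologicalType) : Type := Skorokhod {
  path :> R -> T ;
  path_cadlag : cadlag path ;
  path_neg : forall t, t < 0 -> path t = path 0 }.

HB.instance Definition _ R T := gen_eqMixin (@skorokhod R T).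
HB.instance Definition _ R T := gen_choiceMixin (@skorokhod R T).

Section skorokhod_topology.
Context (R : realType).

Definition time_change : set (R -> R) := [set lam |
  {in `[0, +oo[ &, {homo lam : s t / s < t}} /\
  lam @` [set t | 0 <= t] = [set t | 0 <= t]].

Context (T : completePseudoMetricType R).

(* The sets [skorokhod_ball w N e] (N, e > 0) form a basis of neighbourhoods of
   w for the J1 topology of D([0,oo); T): w_n converges to w iff, for every
   N, there are time changes lam_n with
   sup_(t <= N) |lam_n t - t| -> 0 and sup_(t <= N) d(w_n t, w (lam_n t)) -> 0
   (Ethier and Kurtz, Markov Processes, Proposition 3.5.3). *)
Definition skorokhod_ball (w : skorokhod R T) (N e : R) : set (skorokhod R T) :=
  [set v | exists2 lam, time_change lam &
    forall t, 0 <= t <= N -> `|lam t - t| < e /\ ball (w (lam t)) e (v t)].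

Definition skorokhod_open : set_system (skorokhod R T) :=
  [set U | forall w, U w -> exists N e, 0 < e /\ skorokhod_ball w N e `<=` U].

Lemma skorokhod_ballS (w : skorokhod R T) (N N' e e' : R) :
  N <= N' -> e' <= e -> skorokhod_ball w N' e' `<=` skorokhod_ball w N e.
Proof.
move=> NN' e'e v [lam tlam H]; exists lam => // t /andP[t0 tN].
have [|h1 h2] := H t; first by rewrite t0 (le_trans tN).
by split; [exact: lt_le_trans h1 e'e|exact: le_ball e'e _ h2].
Qed.

Lemma skorokhod_openT : skorokhod_open setT.
Proof. by move=> w _; exists 0, 1; split. Qed.

Lemma skorokhod_openI : setI_closed skorokhod_open.
Proof.
move=> U V oU oV w [/oU[N [e [e0 NU]]] /oV[N' [e' [e0' NV]]]].
exists (Num.max N N'), (Num.min e e'); split; first by rewrite lt_min e0.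
by move=> v Hv; split; [apply: NU|apply: NV]; apply: skorokhod_ballS Hv;
  rewrite ?le_max ?ge_min ?lexx ?orbT.
Qed.

Lemma skorokhod_open_bigcup (I : Type) (f : I -> set (skorokhod R T)) :
  (forall i, skorokhod_open (f i)) -> skorokhod_open (\bigcup_i f i).
Proof.
move=> of_ w [i _ /of_[N [e [e0 Nf]]]]; exists N, e; split => //.
by move=> v /Nf fv; exists i.
Qed.

Lemma cadlag_cst (x : T) : cadlag (cst x : R -> T).
Proof.
by split=> [t _|t _]; [exact: cvg_cst|exists x; exact: cvg_cst].
Qed.

HB.instance Definition _ :=
  isPointed.Build (skorokhod R T)
    (Skorokhod (cadlag_cst (point : T)) (fun _ _ => erefl)).

HB.instance Definition _ := isOpenTopological.Build (skorokhod R T)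
  skorokhod_openT skorokhod_openI skorokhod_open_bigcup.

End skorokhod_topology.

(** ** Generated sigma-algebras, completion, conditional expectation *)

Section completion.
Context d (Omega : measurableType d) (R : realType).

Definition completed (P : {measure set Omega -> \bar R}) :
    set (caratheodory_type P^*%mu) -> \bar R :=
  @completed_measure_extension _ _ _ P.

HB.instance Definition _ (P : {measure set Omega -> \bar R}) :=
  Measure.on (@completed P).

End completion.
Arguments completed {d Omega R} P.

Section measure_theory.
Local Open Scope ereal_scope.
Context d (Omega : measurableType d) (R : realType).

Definition sigma_gen I d' (E : measurableType d') (J : set I)
    (Z : I -> Omega -> E) : set (set Omega) :=
  <<s \bigcup_(i in J) preimage_set_system setT (Z i) measurable >>.

(* Z is a version of E_P(xi | G), P being extended to its completion. *)
Definition is_condexp (P : {measure set Omega -> \bar R}) (G : set (set Omega))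
    (xi Z : Omega -> R) : Prop :=
  [/\ measurable_fun [set: g_sigma_algebraType G]
        (Z : g_sigma_algebraType G -> R),
      (completed P).-integrable setT (EFin \o Z) &
      forall A, G A ->
        \int[completed P]_(w in A) (Z w)%:E =
        \int[completed P]_(w in A) (xi w)%:E].

(* Under the laws [P i], the process Z, started from [z0 i], is Markov for its
   own filtration, and its transition semigroup Q leaves C stable. *)
Definition feller_markov d' (E : measurableType d') (C : set (E -> R)) I
    (P : I -> {measure set Omega -> \bar R}) (z0 : I -> E)
    (Z : R -> Omega -> E) : Prop :=
  exists Q : R -> R.-pker E ~> E,
  [/\ forall t g, (0 <= t)%R -> C g ->
        C (fun x => (\int[Q t x]_y g y)%R),
      forall i, {ae P i, forall w, Z 0%R w = z0 i} &
      forall i s t A B, (0 <= s)%R -> (0 <= t)%R ->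
        sigma_gen [set r | (0 <= r <= t)%R] Z A -> measurable B ->
        P i (A `&` Z (t + s)%R @^-1` B) = \int[P i]_(w in A) Q s (Z t w) B].

End measure_theory.

Section mixture.
Local Open Scope ereal_scope.
Context d d' (E : measurableType d) (Omega : measurableType d') (R : realType).
Variables (P : R.-pker E ~> Omega) (mu : probability E R).

Definition mixture (A : set Omega) : \bar R := \int[mu]_z P z A.

Let mixture0 : mixture set0 = 0.
Proof. by rewrite /mixture integral0_eq. Qed.

Let mixture_ge0 A : 0 <= mixture A. Proof. exact: integral_ge0. Qed.

Let mixture_sigma_additive : semi_sigma_additive mixture.
Proof.
move=> U mU tU mUU; rewrite [X in _ --> X](_ : _ =
  \int[mu]_z (\sum_(n <oo) P z (U n))); last first.
  apply: eq_integral => z _.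
  by apply/esym/cvg_lim => //; exact/measure_semi_sigma_additive.
apply/cvg_closeP; split.
  by apply: is_cvg_nneseries => n _ _; exact: integral_ge0.
rewrite closeE// integral_nneseries// => n.
exact: measurable_kernel P _ (mU n).
Qed.

HB.instance Definition _ := isMeasure.Build _ _ _ mixture
  mixture0 mixture_ge0 mixture_sigma_additive.

Let mixture_setT : mixture setT = 1.
Proof.
rewrite /mixture (eq_integral (cst 1)); last by move=> z _; exact: prob_kernel.
by rewrite integral_cst// mul1e; exact: probability_setT.
Qed.

HB.instance Definition _ := Measure_isProbability.Build _ _ _ mixture
  mixture_setT.

Definition law : probability Omega R := mixture.

End mixture.

(** ** The filtering model *)

Definition canonical_space (R : realType) (S O : completePseudoMetricType R) :=
  borel (skorokhod R S * skorokhod R O)%type.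

Section model.
Local Open Scope ereal_scope.
Context (R : realType) (S : completePseudoMetricType R) (p : nat).

Local Notation O := 'rV[R]_p.
Local Notation Omega := (canonical_space S O).

Definition signal (t : R) (w : Omega) : borel S := w.1 t.
Definition observation (t : R) (w : Omega) : borel O := w.2 t.
Definition increment (t : R) (w : Omega) : borel O := (w.2 t - w.2 0)%R.

Variable P : R.-pker (borel S * borel O)%type ~> Omega.

(* Augmentation with respect to the whole family of the laws P_mu. *)
Definition augmentation (G : set (set Omega)) : set (set Omega) :=
  [set A | forall mu : probability (borel S * borel O)%type R,
    <<s G `|` (law P mu).-negligible >> A].

Definition FX : set (set Omega) :=
  augmentation (sigma_gen [set t | (0 <= t)%R] signal).

Definition FY : set (set Omega) :=
  augmentation (sigma_gen [set t | (0 <= t)%R] observation).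

Definition GY : set (set Omega) :=
  augmentation (sigma_gen [set t | (0 <= t)%R] increment).

(* The usual augmentation of a filtration is also right-continuous. *)
Definition FYt (t : R) : set (set Omega) :=
  [set A | forall u, (t < u)%R ->
    augmentation (sigma_gen [set s | (0 <= s <= u)%R] observation) A].

Definition cond_indep_increments : Prop :=
  forall xi : Omega -> R, bounded_fun xi ->
    measurable_fun [set: g_sigma_algebraType (FX `|` GY)]
      (xi : g_sigma_algebraType (FX `|` GY) -> R) ->
  forall (x : S) (y y' : O),
    \int[completed (P (x, y))]_w (xi w)%:E =
    \int[completed (P (x, y'))]_w (xi w)%:E.

Definition filtering_model : Prop :=
  [/\ feller_markov (E := (borel S * borel O)%type) (@C0 R (S * O)%type)
        P id (fun t w => (signal t w, observation t w)),
      feller_markov (E := borel S) (@C0 R S) P fst signal &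
      cond_indep_increments].

(* The law P^mu with initial condition mu x delta_0. *)
Definition law0 (mu : probability (borel S) R) : probability Omega R :=
  law P (mu \x dirac (0%R : borel O)).

Definition obs_equiv (mu1 mu2 : probability (borel S) R) : Prop :=
  forall A, FY A -> completed (law0 mu1) A = completed (law0 mu2) A.

Definition observable : set (S -> R) :=
  [set f | [/\ continuous f, bounded_fun f &
    forall mu1 mu2 : probability (borel S) R, obs_equiv mu1 mu2 ->
      (\int[mu1]_x f x = \int[mu2]_x f x)%R]].

(* pi is a cadlag version of the process t |-> E^mu(f(X_t) | F_t^Y). *)
Definition is_filter (mu : probability (borel S) R) (f : S -> R)
    (pi : R -> Omega -> R) : Prop :=
  (forall t, (0 <= t)%R ->
     is_condexp (law0 mu) (FYt t) (fun w => f (signal t w)) (pi t)) /\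
  {ae law0 mu, forall w, cadlag (pi ^~ w)}.

End model.

(* Main.v *)
Require Import Defs.
From HB Require Import structures.
From mathcomp Require Import all_boot all_order all_algebra.
From mathcomp Require Import all_classical all_reals all_analysis.
From mathcomp Require Import measurable_realfun lra.

Set Implicit Arguments.
Unset Strict Implicit.
Unset Printing Implicit Defensive.

Import Order.TTheory GRing.Theory Num.Theory.
Import numFieldNormedType.Exports.

Local Open Scope classical_set_scope.
Local Open Scope ring_scope.

(** Why the two filters merge.

    An observable [f] is a uniform limit of functions [v] that can be predicted
    from the observations in a way that does not depend on the initial law. Take
    a product [zeta_t] of compactly supported continuous functions of increments
    [Y_(t+s) - Y_t]. By the Markov property and the conditional independence of
    the increments, its conditional expectation given the past up to [t] is
    [h (X_t)], where [h x] is the expectation of [zeta_0] when the signal starts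
    at [x] ([predictor_law0]); the function [h] is continuous by the Feller
    property ([predictor_continuous]). If [f] were at positive distance from the
    span of these [h] and of the constants, the Hahn-Banach theorem would give a
    finitely additive probability on pairs of states that annihilates all the
    [h x - h y] but not [f x - f y] ([mean_annihilator]). On a compact space its
    marginals are represented by probabilities ([mean_represented]). Two initial
    laws with the same integrals of all [h] give the observations the same law
    ([predictors_obs_equiv]), so they have the same integral of [f], which is a
    contradiction ([observable_approx]).

    It remains to compare conditional expectations of [v (X_t)], that is, of the
    bounded variable [zeta_t], which is measurable for the terminal sigma-algebra
    of the observations. The law [P^mu] has a density with respect to [P^nu]
    there, and this density is close in L1 to one that is known at some finite
    time [u] ([early_density]). Such a density is a constant factor for
    conditioning after [u], so from then on both laws predict [zeta_t] almost in
    the same way. To get an almost sure statement without martingale theory,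
    cut the event that the filters differ by more than [4 * eps] at one of
    finitely many times after [u] according to the first such time, and sum the
    integral identities over the pieces: the [P^mu]-probability of this event is
    small ([merging_estimate]). Dyadic times and right-continuity then control
    all times at once ([merging_as]).

    Null sets need care, because the completions of [P^mu] and [P^nu] live on
    different types: both laws are extended to the sigma-algebra enlarged by the
    null sets of [P^nu] ([enlarged]), which contains the augmented filtration. *)

(** * Integrals of bounded measurable functions *)

Lemma sum_ltn_minn (R : realType) (j n : nat) :
  \sum_(i < n) ((i < j)%N%:R : R) = (minn j n)%:R.
Proof.
elim: n => [|n IH]; first by rewrite big_ord0 minn0.
rewrite big_ord_recr /= IH -natrD; congr _%:R.
by case: ltnP => [nj|jn]; [rewrite (minn_idPr nj) addn1
  |rewrite (minn_idPl (leqW jn)) addn0].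
Qed.

Section bounded_measurable.
Context (R : realType) d (T : measurableType d).
Implicit Types f g : T -> R.

(** Bounded measurable functions: the integrands whose integrals against a
    probability obey all the usual rules without side conditions. *)
Definition bmfun f : Prop :=
  measurable_fun setT f /\ exists M : R, forall x, `|f x| <= M.

Lemma bmfun_measurable f : bmfun f -> measurable_fun setT f. Proof. by case. Qed.

Lemma bmfun_cst c : bmfun (fun=> c).
Proof. by split; [exact: measurable_cst|exists `|c|]. Qed.

Lemma bmfunD f g : bmfun f -> bmfun g -> bmfun (fun x => f x + g x).
Proof.
move=> [mf [M fM]] [mg [N gN]]; split; first exact: measurable_funD.
by exists (M + N) => x; rewrite (le_trans (ler_normD _ _))// lerD.
Qed.

Lemma bmfunM f g : bmfun f -> bmfun g -> bmfun (fun x => f x * g x).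
Proof.
move=> [mf [M fM]] [mg [N gN]]; split; first exact: measurable_funM.
by exists (M * N) => x; rewrite normrM ler_pM.
Qed.

Lemma bmfunZ c f : bmfun f -> bmfun (fun x => c * f x).
Proof. by move=> bf; apply: bmfunM => //; exact: bmfun_cst. Qed.

Lemma bmfunN f : bmfun f -> bmfun (fun x => - f x).
Proof.
by move=> /(bmfunZ (-1)); rewrite (_ : (fun x => -1 * f x) = (fun x => - f x))//;
  apply/funext => x; rewrite mulN1r.
Qed.

Lemma bmfunB f g : bmfun f -> bmfun g -> bmfun (fun x => f x - g x).
Proof. by move=> bf bg; apply: bmfunD => //; exact: bmfunN. Qed.

Lemma bmfun_norm f : bmfun f -> bmfun (fun x => `|f x|).
Proof.
move=> [mf [M fM]]; split; first exact: measurableT_comp.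
by exists M => x; rewrite normr_id.
Qed.

Lemma bmfun_indic (A : set T) : measurable A -> bmfun (\1_A).
Proof.
move=> mA; split; first exact: measurable_indic.
by exists 1 => x; rewrite indicE; case: (_ \in _); rewrite ?normr1 ?normr0.
Qed.

Lemma bmfun_sum (I : Type) (s : seq I) (F : I -> T -> R) :
  (forall i, bmfun (F i)) -> bmfun (fun x => \sum_(i <- s) F i x).
Proof.
move=> bF; elim: s => [|i s IH].
  by under eq_fun do rewrite big_nil; exact: bmfun_cst.
by under eq_fun do rewrite big_cons; exact: bmfunD.
Qed.

Lemma measurable_superlevel f (c : R) : measurable_fun setT f ->
  measurable [set x | c < f x].
Proof.
move=> mf; have := mf measurableT _ (measurable_itv `]c, +oo[).
rewrite setTI; congr measurable; apply/seteqP.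
by split => x /=; rewrite in_itv /= andbT.
Qed.

Lemma bmfun_sg f : measurable_fun setT f -> bmfun (fun x => Num.sg (f x)).
Proof.
move=> mf.
have -> : (fun x => Num.sg (f x)) =
    (fun x => \1_[set x | 0 < f x] x - \1_[set x | 0 < - f x] x).
  apply/funext => x; rewrite !indicE.
  have -> : (x \in [set x | 0 < f x]) = (0 < f x).
    by apply/idP/idP => [/set_mem|/mem_set].
  have -> : (x \in [set x | 0 < - f x]) = (f x < 0).
    by apply/idP/idP => [/set_mem/=|?]; rewrite ?oppr_gt0//; apply/mem_set; rewrite /= oppr_gt0.
  by have [_|_|_] := sgrP (f x); rewrite ?subrr ?subr0 ?sub0r.
apply: bmfunB; apply: bmfun_indic; apply: measurable_superlevel => //.
exact: measurable_funN.
Qed.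

End bounded_measurable.

Lemma bmfun_comp (R : realType) d d' (T : measurableType d) (U : measurableType d')
    (phi : T -> U) (f : U -> R) :
  measurable_fun setT phi -> bmfun f -> bmfun (f \o phi).
Proof.
move=> mphi [mf [M fM]]; split; last by exists M => x /=.
exact: measurableT_comp.
Qed.

Section expectation.
Context (R : realType) d (T : measurableType d) (P : {measure set T -> \bar R}).
Hypothesis P1 : P setT = 1%E.
Implicit Types (f g : T -> R) (A B : set T).

Lemma prob_lty A : measurable A -> (P A < +oo)%E.
Proof.
move=> mA; apply: (@le_lt_trans _ _ (P setT)); last by rewrite P1 ltry.
by apply: le_measure; rewrite ?inE.
Qed.

Lemma bmfun_integrable A f : measurable A -> bmfun f ->
  P.-integrable A (EFin \o f).
Proof.
move=> mA [mf [M fM]]; apply: measurable_bounded_integrable => //.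
- exact: prob_lty.
- exact: measurable_funTS.
- exists M; split; first exact: num_real.
  by move=> N MN x _; exact: le_trans (fM x) (ltW MN).
Qed.

Let intT f : bmfun f -> P.-integrable setT (EFin \o f).
Proof. exact: bmfun_integrable. Qed.

Lemma EFin_Rintegral A f : measurable A -> bmfun f ->
  (\int[P]_(x in A) f x)%:E = (\int[P]_(x in A) (f x)%:E)%E.
Proof.
by move=> mA bf; rewrite fineK//; apply: integrable_fin_num => //; exact: bmfun_integrable.
Qed.

Lemma expectD f g : bmfun f -> bmfun g ->
  \int[P]_x (f x + g x) = \int[P]_x f x + \int[P]_x g x.
Proof. by move=> bf bg; rewrite RintegralD//; exact: intT. Qed.

Lemma expectB f g : bmfun f -> bmfun g ->
  \int[P]_x (f x - g x) = \int[P]_x f x - \int[P]_x g x.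
Proof. by move=> bf bg; rewrite RintegralB//; exact: intT. Qed.

Lemma expectZ c f : bmfun f -> \int[P]_x (c * f x) = c * \int[P]_x f x.
Proof. by move=> bf; rewrite RintegralZl//; exact: intT. Qed.

Lemma expect_cst c : \int[P]_x (cst c x) = c :> R.
Proof. by rewrite Rintegral_cst// P1 mulr1. Qed.

Lemma expect_sum (I : Type) (s : seq I) (F : I -> T -> R) :
  (forall i, bmfun (F i)) ->
  \int[P]_x (\sum_(i <- s) F i x) = \sum_(i <- s) \int[P]_x F i x.
Proof.
move=> bF; elim: s => [|i s IH].
  by under eq_Rintegral do rewrite big_nil; rewrite big_nil (expect_cst 0).
under eq_Rintegral do rewrite big_cons.
by rewrite big_cons expectD ?IH//; exact: bmfun_sum.
Qed.

Lemma le_expect f g : bmfun f -> bmfun g -> (forall x, f x <= g x) ->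
  \int[P]_x f x <= \int[P]_x g x.
Proof. by move=> bf bg fg; apply: le_Rintegral => //; exact: intT. Qed.

Lemma expect_norm f : bmfun f -> `|\int[P]_x f x| <= \int[P]_x `|f x|.
Proof. by move=> bf; apply: le_normr_Rintegral => //; exact: intT. Qed.

Lemma expect_le_bound f M : bmfun f -> (forall x, `|f x| <= M) ->
  `|\int[P]_x f x| <= M.
Proof.
move=> bf fM; apply: (le_trans (expect_norm bf)).
rewrite -[leRHS](expect_cst M); apply: le_expect => //; first exact: bmfun_norm.
exact: bmfun_cst.
Qed.

Lemma expect_bounded_cvg (g : nat -> T -> R) f M :
  (forall n, bmfun (g n)) -> bmfun f -> (forall n x, `|g n x| <= M) ->
  (forall x, g n x @[n --> \oo] --> f x) ->
  \int[P]_x g n x @[n --> \oo] --> \int[P]_x f x.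
Proof.
move=> bg bf gM gf.
suff : ((\int[P]_x (g n x)%:E)%E @[n --> \oo] --> (\int[P]_x f x)%:E) by move/fine_cvg.
rewrite EFin_Rintegral//.
have [] := @dominated_convergence _ T R P setT measurableT
  (fun n => EFin \o g n) (EFin \o f) (cst M%:E) _ _ _ _ _.
- by move=> n; apply/measurable_EFinP/bmfun_measurable.
- exact/measurable_EFinP/bmfun_measurable.
- by apply/aeW => x _; apply/fine_cvgP; split; [exact: nearW|exact: gf].
- by apply: bmfun_integrable => //; exact: bmfun_cst.
- by apply/aeW => x n _ /=; rewrite lee_fin.
- by [].
Qed.

Lemma expect_ae f g : bmfun f -> bmfun g -> {ae P, forall x, f x = g x} ->
  \int[P]_x f x = \int[P]_x g x.
Proof.
move=> bf bg fg; congr fine; apply: ae_eq_integral => //.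
- exact/measurable_EFinP/bmfun_measurable.
- exact/measurable_EFinP/bmfun_measurable.
- by move: fg; apply: filterS => x fgx _; rewrite fgx.
Qed.

Lemma expect_indic A : measurable A -> \int[P]_x (\1_A x) = fine (P A) :> R.
Proof. by move=> mA; rewrite /Rintegral integral_indic// setIT. Qed.

Lemma expect_in A f : measurable A ->
  \int[P]_(x in A) f x = \int[P]_x (\1_A x * f x).
Proof.
move=> mA; rewrite Rintegral_mkcond; apply: eq_Rintegral => x _.
by rewrite patchE indicE; case: (x \in A); rewrite ?mul1r ?mul0r.
Qed.

End expectation.

(** * Image measures *)

Section image_measure.
Context (R : realType) d d' (T : measurableType d) (U : measurableType d').
Variables (m : {measure set T -> \bar R}) (phi : T -> U).
Hypothesis mphi : measurable_fun setT phi.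

Definition image_measure : {measure set U -> \bar R} :=
  measure_function_pushforward__canonical__measure_function_Measure m mphi.

Lemma image_measureE A : image_measure A = m (phi @^-1` A).
Proof. by []. Qed.

Lemma ge0_integral_image A (f : U -> \bar R) : measurable A ->
  measurable_fun setT f -> (forall x, (0 <= f x)%E) ->
  (\int[image_measure]_(x in A) f x = \int[m]_(x in phi @^-1` A) f (phi x))%E.
Proof.
by move=> mA mf f0; apply: ge0_integral_pushforward => //; exact: measurable_funTS.
Qed.

End image_measure.

Section as_probability.
Context (R : realType) d (T : measurableType d) (m : {measure set T -> \bar R}).

Definition as_probability (m1 : m setT = 1%E) : set T -> \bar R := m.

Hypothesis m1 : m setT = 1%E.

HB.instance Definition _ := Measure.on (as_probability m1).
HB.instance Definition _ := Measure_isProbability.Build _ _ _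
  (as_probability m1) m1.

(** Kernels and laws ask for a bundled probability. *)
Lemma exists_probability : exists p : probability T R,
  forall A, (p : {measure set T -> \bar R}) A = m A.
Proof. by exists (as_probability m1). Qed.

End as_probability.

Lemma expect_image (R : realType) d d' (T : measurableType d)
    (U : measurableType d') (m : {measure set T -> \bar R}) (phi : T -> U)
    (mphi : measurable_fun setT phi) (f : U -> R) :
  m setT = 1%E -> bmfun f ->
  \int[image_measure m mphi]_x f x = \int[m]_x f (phi x).
Proof.
move=> m1 bf; rewrite /Rintegral (integral_pushforward mphi) ?preimage_setT//.
- exact/measurable_EFinP/bmfun_measurable.
- by apply: (bmfun_integrable m1) => //; exact: bmfun_comp.
Qed.

(** * Hahn-Banach theorem *)

Section hahn_banach.
Context (R : realType) (E : lmodType R) (D : set E).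
Hypotheses (D0 : D 0) (DD : forall x y, D x -> D y -> D (x + y))
  (DZ : forall (a : R) x, D x -> D (a *: x)).

Definition sublinear_on (q : E -> R) : Prop :=
  (forall x y, D x -> D y -> q (x + y) <= q x + q y) /\
  (forall a x, 0 <= a -> D x -> q (a *: x) = a * q x).

Definition linear_on (q : E -> R) : Prop :=
  (forall x y, D x -> D y -> q (x + y) = q x + q y) /\
  (forall a x, D x -> q (a *: x) = a * q x).

Let DN x : D x -> D (- x). Proof. by rewrite -scaleN1r; exact: DZ. Qed.

Lemma sublinear_on0 q : sublinear_on q -> q 0 = 0.
Proof. by move=> [_ qZ]; rewrite -(scale0r 0) qZ// mul0r. Qed.

Lemma sublinear_on_opp q x : sublinear_on q -> D x -> - q (- x) <= q x.
Proof.
move=> sq Dx; have := sq.1 _ _ Dx (DN Dx).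
by rewrite subrr (sublinear_on0 sq) => ?; lra.
Qed.

(** The largest sublinear functional below [q] with value at most [- q x] at
    [- x]; it is linear along the line spanned by [x]. *)
Definition along (q : E -> R) x y :=
  inf [set q (y + t *: x) - t * q x | t in [set t : R | 0 <= t]].

Section along.
Variables (q : E -> R) (x : E).
Hypotheses (sq : sublinear_on q) (Dx : D x).

Lemma along_le y t : D y -> 0 <= t -> along q x y <= q (y + t *: x) - t * q x.
Proof.
move=> Dy t0; apply: ge_inf; last by exists t.
exists (- q (- y)) => _ [s s0 <-]; rewrite -sq.2//.
have := sq.1 _ _ (DD Dy (DZ s Dx)) (DN Dy).
by rewrite [y + _]addrC addrK => ?; lra.
Qed.

Lemma le_along y c : (forall t, 0 <= t -> c <= q (y + t *: x) - t * q x) ->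
  c <= along q x y.
Proof.
move=> H; apply: lb_le_inf; first by exists (q (y + 0 *: x) - 0 * q x), 0 => /=.
by move=> _ [t t0 <-]; exact: H.
Qed.

Lemma along_le_self y : D y -> along q x y <= q y.
Proof. by move=> /along_le/(_ (lexx 0)); rewrite scale0r addr0 mul0r subr0. Qed.

Lemma along_opp : along q x (- x) <= - q x.
Proof.
have := along_le (DN Dx) ler01.
by rewrite scale1r addNr mul1r (sublinear_on0 sq) sub0r.
Qed.

Lemma along_sublinear : sublinear_on (along q x).
Proof.
have homle a y : 0 < a -> D y -> along q x (a *: y) <= a * along q x y.
  move=> a0 Dy; rewrite -ler_pdivrMl//; apply: le_along => t t0.
  rewrite ler_pdivrMl// mulrBr -(sq.2 _ _ (ltW a0) (DD Dy (DZ _ Dx))).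
  rewrite scalerDr scalerA mulrA; apply: along_le; first exact: DZ.
  by rewrite mulr_ge0// ltW.
split=> [y z Dy Dz|a y].
  rewrite -lerBlDr; apply: le_along => s s0.
  rewrite lerBlDr -lerBlDl; apply: le_along => t t0.
  rewrite lerBlDr.
  have := along_le (DD Dy Dz) (addr_ge0 s0 t0); move/le_trans; apply.
  have := sq.1 _ _ (DD Dy (DZ s Dx)) (DD Dz (DZ t Dx)).
  by rewrite addrACA -scalerDl => ?; lra.
rewrite le_eqVlt => /predU1P[<- Dy|a0 Dy].
  rewrite scale0r mul0r; apply/eqP; rewrite eq_le; apply/andP; split.
    by rewrite -[leRHS](sublinear_on0 sq); exact: along_le_self.
  by apply: le_along => t t0; rewrite add0r sq.2// subrr.
apply/eqP; rewrite eq_le homle//=.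
have ai0 : 0 < a^-1 by rewrite invr_gt0.
have := homle _ _ ai0 (DZ a Dy); rewrite scalerA mulVf ?gt_eqF// scale1r.
by rewrite ler_pdivlMl.
Qed.

End along.

(** The infimum of a chain is bounded below by [- p (- x)], and subadditive
    because two members of the chain are comparable: this is what Zorn's lemma
    asks for. *)
Lemma sublinear_chain (p : E -> R) (A : set (E -> R)) : A !=set0 ->
  (forall q, A q -> sublinear_on q /\ forall x, D x -> q x <= p x) ->
  (forall q r, A q -> A r -> (forall x, D x -> q x <= r x) \/
                             (forall x, D x -> r x <= q x)) ->
  exists2 m, sublinear_on m & forall q, A q -> forall x, D x -> m x <= q x.
Proof.
move=> [q0 Aq0] Ap chain; pose m x := inf [set q x | q in A].
have mle q x : A q -> D x -> m x <= q x.
  move=> Aq Dx; apply: ge_inf; last by exists q.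
  exists (- p (- x)) => _ [r Ar <-]; have [sr rp] := Ap _ Ar.
  apply: le_trans (sublinear_on_opp sr Dx); rewrite lerN2; exact/rp/DN.
have lem c x : (forall q, A q -> c <= q x) -> c <= m x.
  move=> H; apply: lb_le_inf; first by exists (q0 x), q0.
  by move=> _ [q Aq <-]; exact: H.
exists m => [|q Aq x Dx]; last exact: mle.
have homle a y : 0 < a -> D y -> m (a *: y) <= a * m y.
  move=> a0 Dy; rewrite -ler_pdivrMl//; apply: (lem) => q Aq.
  rewrite ler_pdivrMl// -((Ap _ Aq).1.2 _ _ (ltW a0) Dy).
  by apply: (mle) => //; exact: DZ.
split=> [x y Dx Dy|a y].
  rewrite -lerBlDr; apply: (lem) => q Aq.
  rewrite lerBlDr -lerBlDl; apply: (lem) => r Ar; rewrite lerBlDr.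
  have [qr|rq] := chain _ _ Aq Ar.
    apply: (le_trans (mle _ _ Aq (DD Dx Dy))).
    by apply: (le_trans ((Ap _ Aq).1.1 _ _ Dx Dy)); have := qr _ Dy; lra.
  apply: (le_trans (mle _ _ Ar (DD Dx Dy))).
  by apply: (le_trans ((Ap _ Ar).1.1 _ _ Dx Dy)); have := rq _ Dx; lra.
rewrite le_eqVlt => /predU1P[<- Dy|a0 Dy].
  rewrite scale0r mul0r; apply/eqP; rewrite eq_le; apply/andP; split.
    by rewrite -[leRHS](sublinear_on0 (Ap _ Aq0).1); exact: mle.
  by apply: (lem) => q Aq; rewrite (sublinear_on0 (Ap _ Aq).1).
apply/eqP; rewrite eq_le homle//=.
have ai0 : 0 < a^-1 by rewrite invr_gt0.
have := homle _ _ ai0 (DZ a Dy); rewrite scalerA mulVf ?gt_eqF// scale1r.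
by rewrite ler_pdivlMl.
Qed.

(** A minimal sublinear functional [q] is linear: by minimality it coincides
    with [along q x] for every [x], whence [q (- x) <= - q x]. *)
Lemma sublinear_minorant (p : E -> R) : sublinear_on p ->
  exists2 L, linear_on L & forall x, D x -> L x <= p x.
Proof.
move=> sp.
pose T := {q : E -> R | sublinear_on q /\ forall x, D x -> q x <= p x}.
pose r (q s : T) := `[< forall x, D x -> sval s x <= sval q x >].
pose t0 : T := exist _ p (conj sp (fun x _ => lexx (p x))).
have [| | |[q [sq qp]] qmin] := @ZL_preorder T t0 r.
- by move=> t; apply/asboolP.
- move=> a b c /asboolP ba /asboolP cb; apply/asboolP => x Dx.
  exact: le_trans (cb _ Dx) (ba _ Dx).
- move=> A Atot; have [[a Aa]|A0] := pselect (A !=set0); last first.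
    by exists t0 => s As; exfalso; apply: A0; exists s.
  have [||| m sm mA] := @sublinear_chain p [set sval q | q in A].
  + by exists (sval a), a.
  + by move=> _ [q _ <-]; exact: (svalP q).
  + move=> _ _ [b Ab <-] [c Ac <-].
    by have [/asboolP|/asboolP] := Atot _ _ Ab Ac; [right|left].
  have mp x : D x -> m x <= p x.
    move=> Dx; apply: le_trans ((svalP a).2 _ Dx).
    by apply: mA Dx; exists a.
  exists (exist _ m (conj sm mp)) => s As; apply/asboolP => x Dx /=.
  by apply: mA Dx; exists s.
have qN x : D x -> q (- x) = - q x.
  move=> Dx; apply/eqP; rewrite eq_le; apply/andP; split; last first.
    by have := sublinear_on_opp sq Dx; lra.
  apply: le_trans (along_opp sq Dx).
  have alp y : D y -> along q x y <= p y.
    by move=> Dy; exact: le_trans (along_le_self sq Dx Dy) (qp _ Dy).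
  pose s : T := exist _ _ (conj (along_sublinear sq Dx) alp).
  have /qmin/asboolP sq_le : r (exist _ q (conj sq qp)) s.
    by apply/asboolP => y Dy; exact: along_le_self.
  exact/sq_le/DN.
exists q => //; split=> [x y Dx Dy|a x Dx].
  apply/eqP; rewrite eq_le sq.1//=.
  have := sq.1 _ _ (DN Dx) (DN Dy).
  by rewrite -opprD !qN//; [lra|exact: DD].
have [a0|a0] := leP 0 a; first exact: sq.2.
rewrite -[a]opprK scaleNr qN; last exact: DZ.
by rewrite sq.2 ?mulNr// oppr_ge0 ltW.
Qed.

(** A linear minorant [L] of [along p x] satisfies [L (- x) <= - p x], which forces
    the value [p x] at [x]. *)
Lemma hahn_banach (p : E -> R) x : sublinear_on p -> D x ->
  exists2 L, linear_on L & L x = p x /\ forall y, D y -> L y <= p y.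
Proof.
move=> sp Dx.
have [L [LD LZ] Lp] := sublinear_minorant (along_sublinear sp Dx).
exists L => //; split=> [|y Dy]; last first.
  exact: le_trans (Lp _ Dy) (along_le_self sp Dx Dy).
apply/eqP; rewrite eq_le (le_trans (Lp _ Dx) (along_le_self sp Dx Dx))//=.
have := le_trans (Lp _ (DN Dx)) (along_opp sp Dx).
by rewrite -scaleN1r LZ// mulN1r lerN2.
Qed.

End hahn_banach.

Section bounded_functionals.
Context (R : realType) (T : Type).

Definition bounded_funs : set (T -> R) := [set g | exists M, forall z, `|g z| <= M].

(** Finitely additive probabilities, seen as functionals. *)
Definition mean (L : (T -> R) -> R) : Prop :=
  [/\ linear_on bounded_funs L,
      forall g, bounded_funs g -> (forall z, 0 <= g z) -> 0 <= L g &
      L (cst 1) = 1].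

Lemma bounded_funs_cst c : bounded_funs (cst c).
Proof. by exists `|c| => z. Qed.

Lemma bounded_funsD g h : bounded_funs g -> bounded_funs h -> bounded_funs (g + h).
Proof.
move=> [M gM] [N hN]; exists (M + N) => z; rewrite fctE.
by rewrite (le_trans (ler_normD _ _))// lerD.
Qed.

Lemma bounded_funsZ (a : R) g : bounded_funs g -> bounded_funs (a *: g).
Proof.
move=> [M gM]; exists (`|a| * M) => z.
by rewrite fctE /= normrM ler_wpM2l.
Qed.

(** The functional is dominated by
    [p g = inf_(w in W) sup_z (g z + w z)], which is nonpositive on [W] and on
    nonpositive functions. *)
Lemma mean_annihilator (W : set (T -> R)) (z0 : T) (f : T -> R) (c : R) :
  W `<=` bounded_funs -> W 0 -> (forall g h, W g -> W h -> W (g + h)) ->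
  (forall (a : R) g, W g -> W (a *: g)) -> (forall w, W w -> w z0 = 0) ->
  bounded_funs f -> (forall w, W w -> exists z, c <= f z + w z) ->
  exists L, [/\ mean L, forall w, W w -> L w = 0 & c <= L f].
Proof.
move=> Wb W0 WD WZ Wz0 fb fc.
pose s (g : T -> R) := sup (range g).
have s_ub g z : bounded_funs g -> g z <= s g.
  move=> [M gM]; apply: ub_le_sup; last by exists z.
  by exists M => _ [y _ <-]; exact: le_trans (ler_norm _) (gM y).
have le_s g d : (forall z, g z <= d) -> s g <= d.
  by move=> H; apply: ge_sup => [|_ [z _ <-]//]; exists (g z0), z0.
pose p g := inf [set s (g + w) | w in W].
have p_le g w : bounded_funs g -> W w -> p g <= s (g + w).
  move=> gb Ww; apply: ge_inf; last by exists w.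
  exists (g z0) => _ [v Wv <-].
  have -> : g z0 = (g + v) z0 by rewrite fctE (Wz0 v)// addr0.
  exact: s_ub (bounded_funsD gb (Wb _ Wv)).
have le_p g d : (forall w, W w -> d <= s (g + w)) -> d <= p g.
  move=> H; apply: lb_le_inf; first by exists (s (g + 0)), 0.
  by move=> _ [w Ww <-]; exact: H.
have homle a g : 0 < a -> bounded_funs g -> p (a *: g) <= a * p g.
  move=> a0 gb; rewrite -ler_pdivrMl//; apply: (le_p) => w Ww.
  rewrite ler_pdivrMl//.
  apply: (le_trans (p_le _ (a *: w) (bounded_funsZ a gb) (WZ _ _ Ww))).
  apply: (le_s) => z; rewrite -scalerDr fctE /= ler_pM2l//.
  exact: s_ub (bounded_funsD gb (Wb _ Ww)).
have sp : sublinear_on bounded_funs p.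
  split=> [g h gb hb|a g].
    rewrite -lerBlDr; apply: (le_p) => w Ww.
    rewrite lerBlDr -lerBlDl; apply: (le_p) => v Wv; rewrite lerBlDr.
    apply: (le_trans (p_le _ (w + v) (bounded_funsD gb hb) (WD _ _ Ww Wv))).
    apply: (le_s) => z; rewrite addrACA addrC.
    by rewrite fctE lerD// s_ub//; apply: bounded_funsD => //; exact: Wb.
  rewrite le_eqVlt => /predU1P[<- gb|a0 gb].
    rewrite scale0r mul0r; apply/eqP; rewrite eq_le; apply/andP; split.
      apply: (le_trans (p_le _ 0 (Wb _ W0) W0)).
      by apply: (le_s) => z; rewrite addr0.
    apply: (le_p) => w Ww; rewrite add0r -(Wz0 _ Ww); apply: (s_ub); exact: Wb.
  apply/eqP; rewrite eq_le homle//=.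
  have ai0 : 0 < a^-1 by rewrite invr_gt0.
  have := homle _ _ ai0 (bounded_funsZ a gb).
  by rewrite scalerA mulVf ?gt_eqF// scale1r ler_pdivlMl.
have p_ub g d : bounded_funs g -> (forall z, g z <= d) -> p g <= d.
  move=> gb gd; apply: (le_trans (p_le _ 0 gb W0)).
  by apply: (le_s) => z; rewrite addr0.
have b0 : bounded_funs (0 : T -> R) by exact: bounded_funs_cst.
have [L [LD LZ] [Lf Lp]] := hahn_banach b0 (@bounded_funsD) bounded_funsZ sp fb.
have LN g : bounded_funs g -> L (- g) = - L g.
  by move=> gb; rewrite -scaleN1r LZ// mulN1r.
have bN g : bounded_funs g -> bounded_funs (- g).
  by move=> gb; rewrite -scaleN1r; exact: bounded_funsZ.
exists L; split=> [|w Ww|].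
- split=> // [g gb g0|].
    rewrite -oppr_le0 -LN//; apply: (le_trans (Lp _ (bN _ gb))).
    by apply: (p_ub) => [|z]; [exact: bN|rewrite fctE oppr_le0].
  have b1 : bounded_funs (cst (1 : R)) by exact: bounded_funs_cst.
  apply/eqP; rewrite eq_le; apply/andP; split.
    by apply: (le_trans (Lp _ b1)); exact: p_ub.
  rewrite -lerN2 -LN//; apply: (le_trans (Lp _ (bN _ b1))).
  by apply: (p_ub) => //; exact: bN.
- have Lw0 v : W v -> L v <= 0.
    move=> Wv; apply: (le_trans (Lp _ (Wb _ Wv))).
    have WNv : W (- v) by rewrite -scaleN1r; exact: WZ.
    apply: (le_trans (p_le _ _ (Wb _ Wv) WNv)).
    by apply: (le_s) => z; rewrite subrr.
  apply/eqP; rewrite eq_le Lw0//= -oppr_le0 -LN; last exact: Wb.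
  by apply: (Lw0); rewrite -scaleN1r; exact: WZ.
- rewrite Lf; apply: (le_p) => w Ww; have [z cz] := fc _ Ww.
  exact: le_trans cz (s_ub (f + w) _ (bounded_funsD fb (Wb _ Ww))).
Qed.

End bounded_functionals.

(** * Approximation of open sets from inside *)

Section erosion.
Context (R : realType) (T : pseudoMetricType R).
Implicit Type U : set T.

Definition erosion U (n : nat) : set T :=
  ~` \bigcup_(y in ~` U) (ball y n.+1%:R^-1)°.

Lemma closed_erosion U n : closed (erosion U n).
Proof. by apply: open_closedC; apply: bigcup_open => y _; exact: open_interior. Qed.

Lemma erosion_sub U n : erosion U n `<=` U.
Proof.
move=> x; apply: contra_notP => nUx; exists x => //.
by apply: nbhsx_ballx; rewrite invr_gt0.
Qed.

Lemma near_erosion U x : open U -> U x ->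
  \forall n \near \oo, nbhs x (erosion U n).
Proof.
move=> oU Ux; have /nbhs_ballP[e /= e0 eU] : nbhs x U by exact: open_nbhs_nbhs.
near=> n; have n2 : n.+1%:R^-1 < e / 2.
  by near: n; apply: near_infty_natSinv_lt (PosNum (divr_gt0 e0 (ltr0Sn _ 1))).
apply/nbhs_ballP; exists (e / 2); first exact: divr_gt0.
move=> z xz [y nUy /interior_subset yz]; apply: nUy; apply: eU.
rewrite (splitr e); apply: ball_triangle xz _.
exact/ball_sym/(le_ball (ltW n2)).
Unshelve. all: by end_near. Qed.

(** Urysohn functions that separate [C] from the erosions of its complement. *)
Lemma closed_indicator_approx (C : set T) : closed C ->
  exists g : nat -> T -> R, [/\ forall n, continuous (g n),
    forall n x, 0 <= g n x <= 1, forall n x, C x -> g n x = 1 &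
    forall x, ~ C x -> \forall n \near \oo, g n x = 0].
Proof.
move=> cC.
have H n : exists f : T -> R, [/\ continuous f, range f `<=` `[0, 1],
    f @` (erosion (~` C) n) `<=` [set 0] & f @` C `<=` [set 1]].
  apply/uniform_separatorP.
  apply: (@normal_separatorP R T).1 => //; first exact: pseudometric_normal.
    exact: closed_erosion.
  by rewrite -subset0 => x [/erosion_sub].
have [g gP] := choice H; exists g; split => [n|n x|n x Cx|x nCx].
- by have [] := gP n.
- have [_ g01 _ _] := gP n.
  by have /= := g01 (g n x) (ex_intro2 _ _ x I erefl); rewrite in_itv.
- by have [_ _ _ g1] := gP n; apply: g1; exists x.
- have := near_erosion (closed_openC cC) nCx; apply: filterS => n /nbhs_singleton Ex.
  by have [_ _ g0 _] := gP n; apply: g0; exists x.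
Qed.

End erosion.

(** * Finitely additive probabilities on a compact space *)

Section mean_content.
Context (R : realType) (T : Type) (L : (T -> R) -> R).
Hypothesis mL : mean L.

Definition mass (A : set T) : R := L (\1_A).

Lemma bounded_funs_indic (A : set T) : bounded_funs (\1_A : T -> R).
Proof. by exists 1 => z; rewrite indicE; case: (_ \in _); rewrite ?normr1 ?normr0. Qed.

Lemma le_mean f g : bounded_funs f -> bounded_funs g -> (forall x, f x <= g x) ->
  L f <= L g.
Proof.
move=> fb gb fg; have [[LD LZ] Lge0 _] := mL.
have Nfb : bounded_funs (-1 *: f) by exact: bounded_funsZ.
have LN : L (-1 *: f) = - L f by move: LZ => ->; rewrite ?mulN1r.
rewrite -subr_ge0 -LN -LD//; apply: Lge0; first exact: bounded_funsD.
by move=> x; rewrite scaleN1r fctE subr_ge0.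
Qed.

Lemma mass_ge0 A : 0 <= mass A.
Proof.
by have [_ Lge0 _] := mL; apply: Lge0 => //; exact: bounded_funs_indic.
Qed.

Lemma massT : mass setT = 1.
Proof. by have [_ _ <-] := mL; rewrite /mass indicT. Qed.

Lemma le_mass A B : A `<=` B -> mass A <= mass B.
Proof.
move=> AB; apply: le_mean; try exact: bounded_funs_indic.
move=> x; rewrite !indicE ler_nat; case: (boolP (x \in A)) => // /set_mem/AB/mem_set.
by move=> ->.
Qed.

Lemma massU A B : A `&` B = set0 -> mass (A `|` B) = mass A + mass B.
Proof.
move=> AB; have [[LD _] _ _] := mL.
rewrite /mass -LD; [|exact: bounded_funs_indic..].
congr L; apply/funext => x; rewrite fctE !indicE in_setU.
have : ~ ((x \in A) && (x \in B)) by rewrite -in_setI AB in_set0.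
by case: (x \in A); case: (x \in B) => //= _; rewrite ?addr0 ?add0r.
Qed.

Lemma mass0 : mass set0 = 0.
Proof. by have := massU (setI0 set0); rewrite setU0 => ?; lra. Qed.

Lemma mass_leU A B : mass (A `|` B) <= mass A + mass B.
Proof.
have -> : A `|` B = A `|` (B `\` A) by rewrite setUDr setDv setD0.
rewrite massU; last by rewrite setDE setICA setICr setI0.
by rewrite lerD2l; apply: le_mass => x [].
Qed.

Lemma mass_le_sum (I : Type) (s : seq I) (F : I -> set T) :
  mass (\big[setU/set0]_(i <- s) F i) <= \sum_(i <- s) mass (F i).
Proof.
elim: s => [|i s IH]; first by rewrite !big_nil mass0.
by rewrite !big_cons (le_trans (mass_leU _ _))// lerD2l.
Qed.

End mean_content.

Section alexandroff.
Context (R : realType) (S : completePseudoMetricType R) (L : (S -> R) -> R).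
Hypotheses (mL : mean L) (Sc : compact [set: S]).
Local Notation mass := (mass L).

(** Sets that [L] does not distinguish from a closed subset and from an open
    superset. They form an algebra, and the mass is countably additive on it
    (Alexandroff). *)
Definition tight_set (A : set S) : Prop := forall e : R, 0 < e ->
  exists K U, [/\ closed K, open U, K `<=` A, A `<=` U & mass (U `\` K) < e].

Lemma tight_setT : tight_set setT.
Proof.
move=> e e0; exists setT, setT.
by split; [exact: closedT|exact: openT| | |rewrite setDv mass0].
Qed.

Lemma tight_setD A B : tight_set A -> tight_set B -> tight_set (A `\` B).
Proof.
move=> tA tB e e0; have e20 : 0 < e / 2 by rewrite divr_gt0.
have [K [U [cK oU KA AU KU]]] := tA _ e20.
have [K' [U' [cK' oU' KB BU KU']]] := tB _ e20.
exists (K `\` U'), (U `\` K'); split.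
- by rewrite setDE; apply: closedI => //; exact: open_closedC.
- by rewrite setDE; apply: openI => //; exact: closed_openC.
- by apply: setDSS.
- by apply: setDSS.
- apply: (@le_lt_trans _ _ (mass ((U `\` K) `|` (U' `\` K')))).
    apply: le_mass => // x [[Ux nK'x] nKU].
    by have [Kx|nKx] := pselect (K x); [right|left]; split => //;
      apply: contrapT => nU'x; apply: nKU.
  by rewrite (le_lt_trans (mass_leU mL _ _))// [ltRHS]splitr ltrD.
Qed.

(** A closed subset of [A] is compact, so it is covered by finitely many of the
    open sets that approximate the [F n] from outside. *)
Lemma tight_sigma_subadditive (A : set S) (F : (set S)^nat) (e : R) : 0 < e ->
  tight_set A -> (forall n, tight_set (F n)) -> A `<=` \bigcup_n F n ->
  exists n, mass A <= \sum_(i < n) mass (F i) + e.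
Proof.
move=> e0 tA tF AF; have e20 : 0 < e / 2 by rewrite divr_gt0.
have [K [U [cK oU KA AU KU]]] := tA _ e20.
have ei (i : nat) : 0 < e / 2 / (2 ^+ i.+1) by rewrite !divr_gt0 ?exprn_gt0.
have H i : exists V : set S, [/\ open V, F i `<=` V &
    mass V <= mass (F i) + e / 2 / (2 ^+ i.+1)].
  have [K' [V [cK' oV K'F FV K'V]]] := tF i _ (ei i).
  exists V; split => //.
  have -> : V = K' `|` (V `\` K') by rewrite setDUK//; exact: subset_trans FV.
  rewrite (le_trans (mass_leU mL _ _))// lerD ?(ltW K'V)//.
  exact: le_mass.
have [V VP] := choice H.
have : compact K by exact: subclosed_compact cK Sc _.
rewrite compact_cover => /(_ nat setT V)[i _|x /KA/AF[i _ Fix]|D _ KD].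
- by have [] := VP i.
- by exists i => //; have [_ + _] := VP i; exact.
pose n := (\max_(i <- finmap.enum_fset D) i).+1.
exists n.
have KV : K `<=` \big[setU/set0]_(i < n) V i.
  move=> x /KD[i /= iD Vix]; rewrite -bigcup_mkord; exists i => //=.
  by rewrite ltnS; exact: (@leq_bigmax_seq nat (finmap.enum_fset D) xpredT id).
have massAK : mass A <= mass K + e / 2.
  apply: (@le_trans _ _ (mass (K `|` (U `\` K)))).
    by apply: le_mass => // x /AU Ux; have [?|?] := pselect (K x); [left|right].
  by rewrite (le_trans (mass_leU mL _ _))// lerD2l ltW.
have sumE m : \sum_(i < m) (e / 2 / (2 ^+ i.+1)) <= e / 2.
  suff -> : \sum_(i < m) (e / 2 / (2 ^+ i.+1)) = e / 2 * (1 - (2 ^+ m)^-1).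
    by rewrite ler_piMr ?ltW// lerBlDr lerDl invr_ge0 exprn_ge0.
  elim: m => [|m IH]; first by rewrite big_ord0 expr0 invr1 subrr mulr0.
  rewrite big_ord_recr IH /= -mulrDr; congr (_ * _).
  rewrite exprS invfM.
  by set z := (2 ^+ m)^-1; lra.
have massK : mass K <= \sum_(i < n) mass (F i) + e / 2.
  apply: (le_trans (le_mass mL KV)); rewrite -(big_mkord xpredT V).
  apply: (le_trans (mass_le_sum mL _ _)); rewrite big_mkord.
  apply: (@le_trans _ _ (\sum_(i < n) (mass (F i) + e / 2 / (2 ^+ i.+1)))).
    by apply: ler_sum => i _; have [] := VP i.
  rewrite big_split /= lerD2l; exact: sumE.
lra.
Qed.

End alexandroff.

(** * Riesz representation on a compact space *)

Section tight_levels.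
Context (R : realType) (S : completePseudoMetricType R) (L : (S -> R) -> R).
Hypotheses (mL : mean L).
Local Notation mass := (mass L).

(** The mass of the sublevel set at [r] is monotone in [r], hence continuous at
    all but countably many [r]. At a point of continuity, a closed sublevel set
    just below and an open one just above have almost the same mass. *)
Lemma tight_level (g : S -> R) (a b : R) : continuous g -> a < b ->
  exists2 r, a < r < b & tight_set L [set x | g x < r].
Proof.
move=> cg ab; pose F r := mass [set x | g x < r].
have ndF x y : x <= y -> F x <= F y.
  by move=> xy; apply: le_mass => // z /= /lt_le_trans; exact.
have cD := @discontinuity_countable R a b F (fun x y _ _ xy => ndF _ _ xy).
have [r [rab Dr]] : exists r, r \in (`]a, b[) /\ ~ discontinuity F r.
  apply: contrapT => /forallNP H.
  have sD : [set` `]a, b[] `<=` [set x | x \in (`]a, b[) /\ discontinuity F x].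
    move=> x /= xab; split => //; apply: contrapT => nD; apply: (H x).
    by split.
  have /countable_lebesgue_measure0 := sub_countable (subset_card_le sD) cD.
  by rewrite lebesgue_measure_itv /= lte_fin ab -EFinB => -[]; lra.
have cl : cvg (F x @[x --> r^'-]).
  apply: nondecreasing_at_left_is_cvgr; near=> x.
    by move=> y z _ _; exact: ndF.
  by exists 1 => _ [y _ <-]; rewrite -(massT mL); exact: le_mass.
have cr : cvg (F x @[x --> r^'+]).
  apply: nondecreasing_at_right_is_cvgr; near=> x.
    by move=> y z _ _; exact: ndF.
  by exists 0 => _ [y _ <-]; exact: mass_ge0.
have llr : lim (F x @[x --> r^'-]) = lim (F x @[x --> r^'+]).
  by apply/eqP/negPn/negP => H; apply: Dr.
exists r; first by move: rab; rewrite in_itv.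
move=> e e0; set l := lim (F x @[x --> r^'-]) in llr.
have e20 : 0 < e / 2 by rewrite divr_gt0.
have [x [xr Fx]] : exists x, x < r /\ l - e / 2 < F x.
  have /filter_ex [x []] : \forall x \near r^'-, x < r /\ l - e / 2 < F x.
    near=> x; split; first by near: x; exact: nbhs_left_lt.
    have : `|l - F x| < e / 2.
      by near: x; move/cvgrPdist_lt : cl; exact.
    by rewrite ltr_norml => /andP[_]; lra.
  by exists x.
have [y [ry Fy]] : exists y, r < y /\ F y < l + e / 2.
  have /filter_ex [y []] : \forall y \near r^'+, r < y /\ F y < l + e / 2.
    near=> y; split; first by near: y; exact: nbhs_right_gt.
    have : `|l - F y| < e / 2.
      by rewrite llr; near: y; move/cvgrPdist_lt : cr; exact.
    by rewrite ltr_norml => /andP[+ _]; lra.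
  by exists y.
exists (g @^-1` [set z | z <= x]), (g @^-1` [set z | z < y]); split.
- by apply: closed_comp => [z _|]; [exact: cg|exact: closed_le].
- by apply: open_comp => [z _|]; [exact: cg|exact: open_lt].
- by move=> z /= /le_lt_trans; exact.
- by move=> z /= /lt_trans; exact.
- set U := _ @^-1` _; set K := _ @^-1` _.
  have /(le_mass mL) : [set z | g z < x] `|` (U `\` K) `<=` [set z | g z < y].
    by move=> z [gx|[Uz _]]; [exact: lt_trans gx (lt_trans xr ry)|exact: Uz].
  rewrite massU//; first by rewrite -/(F x) -/(F y); lra.
  by rewrite -subset0 => z [/= gx [_]] /=; apply; exact: ltW.
Unshelve. all: by end_near. Qed.

End tight_levels.

Fact tight_display : measure_display. Proof. exact: default_measure_display. Qed.

(** A copy of [S] whose measurable sets are the tight sets. *)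
Definition tight_type (R : realType) (S : completePseudoMetricType R)
  (L : (S -> R) -> R) (H : mean L /\ compact [set: S]) : Type := S.

Section tight_algebra.
Context (R : realType) (S : completePseudoMetricType R) (L : (S -> R) -> R).
Variable (H : mean L /\ compact [set: S]).
Local Notation T := (tight_type H).

HB.instance Definition _ := Pointed.on T.

HB.instance Definition _ := @isAlgebraOfSets_setD.Build tight_display T
  (tight_set L : set (set T)) (tight_setT H.1) (tight_setD H.1).

Definition tight_mass (A : set T) : \bar R := (mass L A)%:E.

Let tight_mass_ge0 A : (0 <= tight_mass A)%E.
Proof. by rewrite lee_fin (mass_ge0 H.1). Qed.

Let tight_mass_additive : measure_function.semi_additive tight_mass.
Proof.
apply/(additive2P (mu := tight_mass)); first by rewrite /tight_mass (mass0 H.1).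
by move=> A B _ _ AB; rewrite /tight_mass (massU H.1)// EFinD.
Qed.

HB.instance Definition _ := isContent.Build _ T R tight_mass
  tight_mass_ge0 tight_mass_additive.

Let tight_mass_sigma_subadditive : measurable_subset_sigma_subadditive tight_mass.
Proof.
move=> A F mF mA AF; apply/lee_addgt0Pr => e e0.
have [n nA] := tight_sigma_subadditive H.1 H.2 e0 mA mF AF.
apply: (@le_trans _ _ (\sum_(i < n) tight_mass (F i) + e%:E)%E).
  by rewrite /tight_mass sumEFin -EFinD lee_fin.
rewrite leeD2r// -(big_mkord xpredT (fun i => tight_mass (F i))).
exact: nneseries_lim_ge.
Qed.

HB.instance Definition _ := Content_SigmaSubAdditive_isMeasure.Build _ R T
  tight_mass tight_mass_sigma_subadditive.

Local Notation tightT := (g_sigma_algebraType (@measurable _ T)).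

(** An open set is a countable union of tight sublevel sets of functions that
    equal 1 outside it, so the extension measures all Borel sets. *)
Lemma tight_borel : measurable_fun [set: tightT] (id : tightT -> borel S).
Proof.
apply: (@measurability _ _ tightT (borel S) setT id (@open S)) => //.
move=> _ [U oU <-]; rewrite setTI preimage_id.
have [g [cg g01 g1 g0]] := closed_indicator_approx (open_closedC oU).
have Hr n : exists r, 0 < r < 1 /\ tight_set L [set x | g n x < r].
  by have [r r01 tr] := tight_level H.1 (cg n) ltr01; exists r.
have [r rP] := choice Hr.
have -> : U = \bigcup_n [set x | g n x < r n].
  apply/seteqP; split=> [x Ux|x [n _ /= gr]].
    have nCx : ~ (~` U) x by exact.
    have /filter_ex [n gn0] := g0 _ nCx.
    by exists n => //=; rewrite gn0; have [/andP[]] := rP n.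
  apply: contrapT => nUx; move: gr; rewrite g1//.
  by have [/andP[_ ?] _] := rP n; apply/negP; rewrite -leNgt ltW.
apply: bigcupT_measurable => n; apply: sub_sigma_algebra.
by have [] := rP n.
Qed.

Definition mean_measure : {measure set (borel S) -> \bar R} :=
  image_measure (measure_extension tight_mass) tight_borel.

Lemma mean_measureE (A : set S) : tight_set L A -> mean_measure A = (mass L A)%:E.
Proof.
by move=> tA; rewrite image_measureE /= /measure_extension measurable_mu_extE.
Qed.

End tight_algebra.

Lemma continuous_borel (R : realType) (T : ptopologicalType) (g : T -> R) :
  continuous g -> measurable_fun setT (g : borel T -> R).
Proof.
move=> /continuousP cg.
apply: (measurability _ (RGenOpens.measurableE R)) => _ [_ [a [b [-> <-]]] ].
by apply: measurableI => //; apply: sub_sigma_algebra; exact/cg/interval_open.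
Qed.

Lemma compact_continuous_bounded (R : realType) (T : topologicalType) (g : T -> R) :
  compact [set: T] -> continuous g -> exists M, forall x, `|g x| <= M.
Proof.
move=> Tc cg; have : compact (g @` setT).
  by apply: continuous_compact => //; exact: continuous_subspaceT.
move=> /compact_bounded[M [_ gM]]; exists (M + 1) => x.
by apply: (gM (M + 1)); [rewrite ltrDl|exists x].
Qed.

Section riesz.
Context (R : realType) (S : completePseudoMetricType R) (L : (S -> R) -> R).
Hypotheses (mL : mean L) (Sc : compact [set: S]).

Let cb (g : S -> R) : continuous g -> bounded_funs g.
Proof. exact: compact_continuous_bounded. Qed.

Let cbm (g : S -> R) : continuous g -> bmfun (g : borel S -> R).
Proof. by move=> cg; split; [exact: continuous_borel|exact: cb]. Qed.

(** With good levels [r i] in [(i / N, (i + 1) / N)], the function [N * g] is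
    within 1 of the number of levels below it. *)
Lemma mean_represented : exists m : probability (borel S) R,
  forall g : S -> R, continuous g -> \int[m]_x g x = L g.
Proof.
have mT : mean_measure (conj mL Sc) setT = 1%E.
  by rewrite mean_measureE ?(massT mL)//; exact: tight_setT.
have [m mE] := exists_probability mT; exists m.
have m1 : m setT = 1%E by rewrite mE.
have [[LD LZ] Lge0 L1] := mL.
have key (g : S -> R) : continuous g -> (forall x, 0 <= g x <= 1) ->
    \int[m]_x g x = L g.
  move=> cg g01.
  suff H (N : nat) : (0 < N)%N -> `|\int[m]_x g x - L g| <= 2 / N%:R.
    apply/eqP; rewrite -subr_eq0 -normr_le0; apply/ler_addgt0Pr => e e0.
    rewrite add0r; have [k ke] : exists k : nat, 2 / e < k.+1%:R.
      exists (Num.truncn (2 / e)); exact: truncnS_gt.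
    apply: (le_trans (H k.+1 isT)).
    by rewrite ler_pdivrMr// -ler_pdivrMl// mulrC ltW.
  move=> N0; have N0' : 0 < N%:R :> R by rewrite ltr0n.
  have Hr i : exists r, i%:R / N%:R < r < i.+1%:R / N%:R /\ tight_set L [set x | g x < r].
    have [|r r1 r2] := @tight_level R S L mL g (i%:R / N%:R) (i.+1%:R / N%:R) cg.
      by rewrite ltr_pM2r ?invr_gt0// ltr_nat.
    by exists r.
  have [r rP] := choice Hr.
  pose G i := [set x | g x < r i].
  pose s (x : S) : R := N%:R^-1 * \sum_(i < N) (1 - \1_(G i) x).
  have mG i : measurable (G i : set (borel S)).
    apply: sub_sigma_algebra; apply: (open_comp (f := g) (D := [set z | z < r i])).
      by move=> z _; exact: cg.
    exact: open_lt.
  have gs x : `|g x - s x| <= N%:R^-1.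
    have /andP[gx0 gx1] := g01 x.
    pose k := Num.truncn (N%:R * g x).
    have /andP[kN Nk] : k%:R <= N%:R * g x < k.+1%:R.
      by rewrite truncn_itv// mulr_ge0.
    have kleN : (k <= N)%N.
      by rewrite -(ler_nat R) (le_trans kN)// ler_piMr// ltW.
    have lo : k%:R <= \sum_(i < N) (1 - \1_(G i) x) :> R.
      rewrite -{1}(minn_idPl kleN) -sum_ltn_minn; apply: ler_sum => i _; rewrite indicE.
      have [ik|] := ltnP i k; last by case: (x \in _); rewrite ?subr0 ?subrr.
      suff -> : (x \in G i) = false by rewrite subr0.
      apply/negP => /set_mem /=; apply/negP; rewrite -leNgt.
      have [/andP[_ ri] _] := rP i; apply/ltW/(lt_le_trans ri).
      by rewrite ler_pdivrMr// mulrC (le_trans _ kN)// ler_nat.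
    have hi : \sum_(i < N) (1 - \1_(G i) x) <= k.+1%:R :> R.
      apply: (@le_trans _ _ (minn k.+1 N)%:R); last by rewrite ler_nat geq_minl.
      rewrite -sum_ltn_minn; apply: ler_sum => i _; rewrite indicE.
      have [ik|ki] := ltnP i k.+1; first by rewrite lerBlDr lerDl.
      suff -> : x \in G i by rewrite subrr.
      apply/mem_set => /=; have [/andP[ri _] _] := rP i; apply: le_lt_trans ri.
      by rewrite ler_pdivlMr// mulrC (le_trans (ltW Nk))// ler_nat.
    have -> : g x - s x = N%:R^-1 * (N%:R * g x - \sum_(i < N) (1 - \1_(G i) x)).
      by rewrite mulrBr mulKf// gt_eqF.
    rewrite normrM ger0_norm ?invr_ge0// ler_piMr ?invr_ge0//.
    by rewrite ler_norml; move: Nk; rewrite -natr1 => ?; apply/andP; split; lra.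
  have b1G i : bmfun ((fun x => 1 - \1_(G i) x) : borel S -> R).
    by apply: bmfunB; [exact: bmfun_cst|exact: bmfun_indic].
  have bs : bmfun (s : borel S -> R) by apply: bmfunZ; exact: bmfun_sum.
  have ms : \int[m]_x s x = N%:R^-1 * \sum_(i < N) (1 - mass L (G i)).
    rewrite (expectZ m1); last exact: bmfun_sum.
    rewrite (expect_sum m1)//; congr (_ * _); apply: eq_bigr => i _.
    rewrite (expectB m1); [|exact: bmfun_cst|exact: bmfun_indic].
    rewrite (expect_cst m1) expect_indic// mE mean_measureE//.
    by have [] := rP i.
  have b1 : bounded_funs (cst (1 : R) : S -> R) by exact: bounded_funs_cst.
  have bG i : bounded_funs (-1 *: \1_(G i) : S -> R).
    exact/bounded_funsZ/bounded_funs_indic.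
  pose F n (x : S) : R := \sum_(i < n) (1 - \1_(G i) x).
  have F0 : F 0%N = 0 *: cst 1.
    by apply/funext => x; rewrite /F big_ord0 scale0r.
  have FS n : F n.+1 = F n + (cst 1 + -1 *: \1_(G n)).
    by apply/funext => x; rewrite /F big_ord_recr scaleN1r.
  have bsum n : bounded_funs (F n) /\ L (F n) = \sum_(i < n) (1 - mass L (G i)).
    elim: n => [|n [IHb IHL]].
      by rewrite F0 LZ// mul0r big_ord0; split => //; apply: bounded_funsZ.
    have b1GL : bounded_funs (cst 1 + -1 *: \1_(G n) : S -> R).
      exact: bounded_funsD b1 (bG n).
    rewrite FS LD// big_ord_recr /= IHL LD// L1 LZ ?mulN1r.
      by split => //; exact: bounded_funsD.
    exact: bounded_funs_indic.
  have bsL : bounded_funs s by apply: (bounded_funsZ N%:R^-1); exact: (bsum N).1.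
  have Ls : L s = N%:R^-1 * \sum_(i < N) (1 - mass L (G i)).
    by rewrite -(bsum N).2 -LZ//; exact: (bsum N).1.
  have dm : `|\int[m]_x g x - \int[m]_x s x| <= N%:R^-1.
    rewrite -(expectB m1)//; last exact: cbm.
    by apply: (expect_le_bound m1) => //; apply: bmfunB => //; exact: cbm.
  have dL : `|L g - L s| <= N%:R^-1.
    have up u v : bounded_funs u -> bounded_funs v ->
        (forall x, `|u x - v x| <= N%:R^-1) -> L u - L v <= N%:R^-1.
      move=> bu bv uv; have LN : L (N%:R^-1 *: cst 1) = N%:R^-1.
        by rewrite LZ// L1 mulr1.
      rewrite -[leRHS]LN lerBlDr -LD//; last exact: bounded_funsZ.
      apply: (le_mean mL) => //; first by apply: bounded_funsD => //; exact: bounded_funsZ.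
      move=> x; rewrite [leRHS](_ : _ = N%:R^-1 + v x); last first.
        by congr (_ + _); exact: mulr1.
      by have := uv x; rewrite ler_norml => /andP[_]; lra.
    rewrite ler_norml lerNl opprB !up//; try exact: cb.
    by move=> x; rewrite distrC.
  rewrite ms in dm; rewrite Ls in dL.
  set c := N%:R^-1 * _ in dm dL.
  rewrite (_ : _ - _ = (\int[m]_x g x - c) - (L g - c)); last by lra.
  by rewrite (le_trans (ler_normB _ _))// mulr_natl mulr2n lerD.
move=> g cg; have [M gM] := cb cg.
have M0 : 0 <= M by exact: le_trans (gM point).
pose h x := (2 * (M + 1))^-1 * (g x + (M + 1)).
have M1 : 0 < 2 * (M + 1) by lra.
have ch : continuous h.
  by move=> x; apply: cvgMr; apply: cvgD; [exact: cg|exact: cvg_cst].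
have h01 x : 0 <= h x <= 1.
  have := gM x; rewrite ler_norml => /andP[g1 g2].
  rewrite /h ler_pdivrMl// mulr1 mulr_ge0 ?invr_ge0 ?(ltW M1)//=; last by lra.
  by lra.
have gE : g = (2 * (M + 1)) *: h + (- (M + 1)) *: cst 1.
  apply/funext => x; rewrite !fctE /= /h.
  by rewrite -[_ *: _]/(_ * _) -[(- _) *: _]/(_ * _) mulVKf ?gt_eqF//; lra.
have hb : bounded_funs h by exact: cb.
have b1 : bounded_funs (cst (1 : R) : S -> R) by exact: bounded_funs_cst.
rewrite [in RHS]gE LD; [|exact: bounded_funsZ..].
rewrite (LZ _ h)// (LZ _ (cst 1))// L1 -key// [in LHS]gE.
transitivity (\int[m]_x (2 * (M + 1) * h x + - (M + 1) * 1)) => //.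
rewrite (expectD m1); [|apply: bmfunZ; exact: cbm|exact: bmfun_cst].
rewrite (expectZ m1); last exact: cbm.
by congr (_ + _); exact: (expect_cst m1).
Qed.

End riesz.

(** * Measurability of the coordinates of Skorokhod space *)

Section evaluation.
Context (R : realType) (T : completePseudoMetricType R).

Lemma open_skorokhod (U : set (skorokhod R T)) : skorokhod_open U -> open U.
Proof. exact. Qed.

(** Time changes close to the identity cannot move a time out of an open
    interval. *)
Lemma open_visits (a b : R) (U : set T) : 0 <= a -> open U ->
  open [set w : skorokhod R T | exists s, [/\ a < s, s < b & U (w s)]].
Proof.
move=> a0 oU; apply: open_skorokhod => w [s [as_ sb Us]].
have /nbhs_ballP[e1 /= e10 eU] : nbhs (w s) U by exact: open_nbhs_nbhs.
have s0 : 0 <= s by exact: le_trans (ltW as_).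
exists (s + 1), (Num.min (Num.min e1 1) (Num.min (s - a) (b - s))); split.
  by rewrite !lt_min e10 ltr01 !subr_gt0 as_ sb.
move=> v [lam [lam_incr lam_surj] H].
have [t t0 lamt] : (lam @` [set t | 0 <= t]) s by rewrite lam_surj.
have tN : t <= s + 1.
  rewrite leNgt; apply/negP => st.
  have [|h _] := H (s + 1); first by rewrite lexx addr_ge0.
  have : lam (s + 1) < s.
    rewrite -[ltRHS]lamt; apply: lam_incr st; rewrite in_itv/= andbT.
      exact: addr_ge0.
    exact: t0.
  move: h; rewrite !lt_min => /andP[/andP[_ +] _].
  by rewrite ltr_norml => /andP[+ _]; lra.
have [|h1 h2] := H t; first by rewrite t0.
rewrite lamt in h1 h2; exists t; move: h1.
rewrite !lt_min !ltr_norml => /andP[_ /andP[/andP[h3 h4] /andP[h5 h6]]].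
split; [lra|lra|]; apply: eU; apply: le_ball h2.
by rewrite !ge_min lexx.
Qed.

(** Evaluation at [t] is not continuous, but by right-continuity [w t] lies in
    an open set [U] iff, just after [t], the path stays in some erosion of [U]. *)
Lemma measurable_coordinate (t : R) : 0 <= t ->
  measurable_fun setT ((fun w => w t) : borel (skorokhod R T) -> borel T).
Proof.
move=> t0; apply: (@measurability _ _ (borel (skorokhod R T)) (borel T) setT _ (@open T)).
  by [].
move=> _ [U oU <-]; rewrite setTI.
pose V n m : set (skorokhod R T) :=
  [set w | exists s, [/\ t < s, s < t + m.+1%:R^-1 & (~` erosion U n) (w s)]].
have -> : (fun w : skorokhod R T => w t) @^-1` U = \bigcup_n \bigcup_m ~` V n m.
  apply/seteqP; split => [w /= wU|w [n _ [m _ /= nV]]].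
    have [n /= En] := filter_ex (near_erosion oU wU).
    have [wr _] := path_cadlag w.
    have [e /= e0 He] : \forall s \near t^'+, erosion U n (w s).
      exact: wr t0 _ En.
    have [m me] : exists m : nat, m.+1%:R^-1 < e.
      exact: filter_ex (near_infty_natSinv_lt (PosNum e0)).
    exists n => //; exists m => // -[s [ts st]]; apply; apply: He => //=.
    have {}st : s < t + e by apply: (lt_trans st); rewrite ltrD2l.
    have {}e0 : 0 < e by [].
    by rewrite ltr_norml; apply/andP; split; lra.
  have [wr _] := path_cadlag w; apply: (@erosion_sub _ _ _ n).
  refine (@closed_cvg _ _ t^'+ (at_right_proper_filter t) w _
    (@closed_erosion _ _ _ _) _ _ (wr t t0)).
  have ts : \forall s \near t^'+, t < s by exact: nbhs_right_gt.
  have st : \forall s \near t^'+, s < t + m.+1%:R^-1.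
    by apply: nbhs_right_lt; rewrite ltrDl invr_gt0.
  apply: filterS2 ts st => s ts st; apply: contrapT => nEs; apply: nV.
  by exists s; split.
apply: bigcupT_measurable => n; apply: bigcupT_measurable => m.
apply: measurableC; apply: sub_sigma_algebra; apply: open_visits => //.
by apply: closed_openC; exact: closed_erosion.
Qed.

End evaluation.

Section coordinates.
Context (R : realType) (S O : completePseudoMetricType R).

Lemma measurable_fst_canonical :
  measurable_fun setT (fst : canonical_space S O -> borel (skorokhod R S)).
Proof.
apply: (@measurability _ _ (canonical_space S O) (borel (skorokhod R S)) setT _
  (@open (skorokhod R S))) => // _ [U oU <-]; rewrite setTI.
by apply: sub_sigma_algebra; apply: open_comp => // w _; exact: cvg_fst.
Qed.

Lemma measurable_snd_canonical :
  measurable_fun setT (snd : canonical_space S O -> borel (skorokhod R O)).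
Proof.
apply: (@measurability _ _ (canonical_space S O) (borel (skorokhod R O)) setT _
  (@open (skorokhod R O))) => // _ [U oU <-]; rewrite setTI.
by apply: sub_sigma_algebra; apply: open_comp => // w _; exact: cvg_snd.
Qed.

End coordinates.

Section process.
Context (R : realType) (S : completePseudoMetricType R) (p : nat).
Local Notation O := 'rV[R]_p.
Local Notation Omega := (canonical_space S O).

Lemma measurable_signal t : 0 <= t -> measurable_fun setT (@signal R S p t).
Proof.
move=> t0; apply: (measurableT_comp (measurable_coordinate t0)).
exact: measurable_fst_canonical.
Qed.

Lemma measurable_observation t : 0 <= t ->
  measurable_fun setT (@observation R S p t).
Proof.
move=> t0; apply: (measurableT_comp (measurable_coordinate t0)).
exact: measurable_snd_canonical.
Qed.

Lemma bmfun_signal t (v : S -> R) : compact [set: S] -> 0 <= t -> continuous v ->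
  bmfun (fun w : Omega => v (signal t w)).
Proof.
move=> Sc t0 cv; have bv : bmfun (v : borel S -> R).
  by split; [exact: continuous_borel|exact: compact_continuous_bounded].
exact: (bmfun_comp (measurable_signal t0) bv).
Qed.

End process.

(** * Induction on bounded measurable functions *)

Section bmfun_induction.
Context (R : realType) d (T : measurableType d) (K : (T -> R) -> Prop).
Hypotheses (Kindic : forall A, measurable A -> K (\1_A))
  (KD : forall f g, bmfun f -> bmfun g -> K f -> K g -> K (fun x => f x + g x))
  (KZ : forall (c : R) f, bmfun f -> K f -> K (fun x => c * f x))
  (Klim : forall f (g : nat -> T -> R), bmfun f ->
    (forall n, bmfun (g n) /\ K (g n)) ->
    (forall n x, `|f x - g n x| <= n.+1%:R^-1) -> K f).

(** A function with values in [[0, 1]] is within [1 / N] of [1 / N] times the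
    number of levels [i / N], [i > 0], that it reaches. *)
Lemma bmfun_ind f : bmfun f -> K f.
Proof.
have K1 c : K (fun=> c).
  rewrite (_ : (fun=> c) = (fun x : T => c * \1_setT x)); last first.
    by apply/funext => x; rewrite indicT mulr1.
  by apply: KZ; [exact: bmfun_indic|exact: Kindic].
have key g : bmfun g -> (forall x, 0 <= g x <= 1) -> K g.
  move=> bg g01; have mg := bmfun_measurable bg.
  pose A N i := [set x | i.+1%:R <= N%:R * g x].
  have mA N i : measurable (A N i).
    rewrite -[A N i]setTI.
    by apply: measurable_fun_le => //; exact: measurable_funM.
  pose s N n x : R := \sum_(i < n) \1_(A N i) x.
  have sK N n : bmfun (s N n) /\ K (s N n).
    elim: n => [|n [bs Ks]].
      rewrite (_ : s N 0 = fun=> 0); first by split => //; exact: bmfun_cst.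
      by apply/funext => x; rewrite /s big_ord0.
    rewrite (_ : s N n.+1 = fun x => s N n x + \1_(A N n) x); last first.
      by apply/funext => x; rewrite /s big_ord_recr.
    split; first by apply: bmfunD => //; exact: bmfun_indic.
    by apply: KD => //; [exact: bmfun_indic|exact: Kindic].
  apply: (Klim (g := fun n x => n.+1%:R^-1 * s n.+1 n.+1 x)) => // [n|n x].
    by have [? ?] := sK n.+1 n.+1; split; [exact: bmfunZ|exact: KZ].
  have /andP[g0 g1] := g01 x.
  have /andP[kN Nk] := truncn_itv (mulr_ge0 (ler0n R n.+1) g0).
  set k := Num.truncn _ in kN Nk.
  have kn : (k <= n.+1)%N.
    by rewrite -(ler_nat R) (le_trans kN)// ler_piMr.
  have -> : s n.+1 n.+1 x = k%:R.
    transitivity (\sum_(i < n.+1) ((i < k)%N%:R : R)).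
      apply: eq_bigr => i _; rewrite indicE; congr (_%:R).
      have [ik|ki] := ltnP i k.
        by rewrite mem_set// /A /= (le_trans _ kN)// ler_nat.
      apply/eqP; rewrite eqb0; apply/negP => /set_mem; apply/negP.
      by rewrite /A /= -ltNge (lt_le_trans Nk)// ler_nat.
    by rewrite sum_ltn_minn (minn_idPl kn).
  rewrite -(mulKf (_ : n.+1%:R != 0) (g x))// -mulrBr normrM.
  rewrite ger0_norm ?invr_ge0// ler_piMr ?invr_ge0//.
  by rewrite ger0_norm; move: Nk; rewrite -natr1; lra.
move=> bf; have [_ [M fM]] := bf.
have [T0|] := pselect ([set: T] = set0).
  rewrite (_ : f = fun=> 0)//; apply/funext => x.
  by have : [set: T] x by []; rewrite T0.
move=> /eqP/set0P[x0 _]; have M0 : 0 <= M by exact: le_trans (fM x0).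
have M1 : 0 < 2 * (M + 1) by lra.
pose h x := (2 * (M + 1))^-1 * (f x + (M + 1)).
have bh : bmfun h by apply/bmfunZ/bmfunD => //; exact: bmfun_cst.
rewrite (_ : f = (fun x => 2 * (M + 1) * h x + - (M + 1))); last first.
  by apply/funext => x; rewrite /h mulVKf ?gt_eqF//; lra.
apply: KD; [exact: bmfunZ|exact: bmfun_cst| |exact: K1].
apply: KZ => //; apply: key => // x.
have := fM x; rewrite ler_norml => /andP[f1 f2].
by rewrite /h ler_pdivrMl// mulr1 mulr_ge0 ?invr_ge0 ?(ltW M1)//=; lra.
Qed.

End bmfun_induction.

(** * Bounded linear functionals on bounded measurable functions *)

Lemma uniform_cvg (R : realType) (u : nat -> R) (l C : R) :
  (forall n, `|l - u n| <= C * n.+1%:R^-1) -> u @ \oo --> l.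
Proof.
move=> ul; apply/cvgrPdist_lt => e e0.
have C1 : 0 < `|C| + 1 by rewrite ltr_wpDl.
near=> n; apply: (le_lt_trans (ul n)).
apply: (@le_lt_trans _ _ ((`|C| + 1) * n.+1%:R^-1)).
  by rewrite ler_pM2r ?invr_gt0// (le_trans (ler_norm C))// lerDl.
rewrite -ltr_pdivlMl// mulrC; near: n.
exact: (near_infty_natSinv_lt (PosNum (divr_gt0 e0 C1))).
Unshelve. all: by end_near. Qed.

Section monotone_class.
Context (R : realType) d (T : measurableType d) (G : set (set T)).
Variable (K : (T -> R) -> Prop).
Hypotheses (GE : @measurable _ T = <<s G >>) (GI : setI_closed G) (GT : G setT).
Hypotheses (KG : forall A, G A -> K (\1_A))
  (KD : forall f g, bmfun f -> bmfun g -> K f -> K g -> K (fun x => f x + g x))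
  (KZ : forall (c : R) f, bmfun f -> K f -> K (fun x => c * f x))
  (Klim : forall (g : nat -> T -> R) f (M : R),
    (forall n, bmfun (g n) /\ K (g n)) -> bmfun f ->
    (forall n x, `|g n x| <= M) -> (forall x, g n x @[n --> \oo] --> f x) -> K f).

(** The events whose indicators satisfy [K] form a Dynkin class. *)
Lemma monotone_class_indic A : measurable A -> K (\1_A).
Proof.
have b1 B : measurable B -> bmfun (\1_B : T -> R) by exact: bmfun_indic.
move: A; suff: <<s G >> `<=` [set A | K (\1_A)] by rewrite -GE.
apply: (dynkin_induction GE GI) => //=.
- exact: KG.
- move=> B mB LB.
  have -> : \1_(~` B) = (fun x => \1_setT x + -1 * \1_B x) :> (T -> R).
    apply/funext => x; rewrite indicT !indicE in_setC.
    by case: (x \in B); rewrite /=; lra.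
  have bB := b1 _ mB; apply: KD; [exact: b1|exact: bmfunZ|exact: KG|exact: KZ].
- move=> F mF tF LF.
  pose U n := \big[setU/set0]_(i < n) F i.
  have mU n : measurable (U n) by exact: bigsetU_measurable.
  have KU n : bmfun (\1_(U n) : T -> R) /\ K (\1_(U n)).
    split; first exact: b1.
    elim: n => [|n IH].
      rewrite /U big_ord0.
      have -> : \1_set0 = (fun x => 0 * \1_setT x) :> (T -> R).
        by apply/funext => x; rewrite indic0 mul0r.
      by apply: KZ; [exact: b1|exact: KG].
    have -> : \1_(U n.+1) = (fun x => \1_(U n) x + \1_(F n) x) :> (T -> R).
      apply/funext => x; rewrite /U big_ord_recr /= !indicE in_setU -/(U n).
      have : ~ ((x \in U n) && (x \in F n)).
        rewrite -in_setI => /set_mem[]; rewrite /U -bigcup_mkord => -[i /= ilt Fi] Fn.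
        have /eqP := tF i n I I (ex_intro _ x (conj Fi Fn)).
        by rewrite ltn_eqF.
      by case: (x \in U n); case: (x \in F n) => //= _; lra.
    by apply: KD => //; exact: b1.
  have cU x : \1_(U n) x @[n --> \oo] --> (\1_(\bigcup_k F k) x : R).
    apply: cvg_near_cst; have [[k _ Fkx]|nFx] := pselect ((\bigcup_k F k) x).
      exists k.+1 => // n /= kn; rewrite !indicE !mem_set//; first by exists k.
      by rewrite /U -bigcup_mkord; exists k.
    apply: nearW => n; rewrite !indicE !memNset// => Ux; apply: nFx.
    by move: Ux; rewrite /U -bigcup_mkord => -[k _ Fkx]; exists k.
  apply: (Klim (M := 1) KU _ _ cU) => [|n x].
    by apply: b1; exact: bigcupT_measurable.
  by rewrite indicE; case: (_ \in _); rewrite ?normr1 ?normr0.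
Qed.

Lemma monotone_class f : bmfun f -> K f.
Proof.
move: f; apply: bmfun_ind => //; first exact: monotone_class_indic.
move=> f g bf bg fg; have [_ [M fM]] := bf.
apply: (Klim (M := M + 1) bg bf) => [n x|x].
  have -> : g n x = f x - (f x - g n x) by lra.
  rewrite (le_trans (ler_normB _ _))// lerD// (le_trans (fg n x))//.
  by rewrite invf_le1// ler1n.
by apply: (@uniform_cvg _ _ _ 1) => n; rewrite mul1r.
Qed.

End monotone_class.

Section normal_linear.
Context (R : realType) d (T : measurableType d).
Implicit Type La : (T -> R) -> R.

(** Linear functionals with the convergence property of integration against a
    finite measure. *)
Definition normal_linear La : Prop :=
  [/\ forall f g, bmfun f -> bmfun g -> La (fun x => f x + g x) = La f + La g,
      forall c f, bmfun f -> La (fun x => c * f x) = c * La f &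
      forall (g : nat -> T -> R) f (M : R), (forall n, bmfun (g n)) -> bmfun f ->
        (forall n x, `|g n x| <= M) -> (forall x, g n x @[n --> \oo] --> f x) ->
        La (g n) @[n --> \oo] --> La f].

Lemma normal_linear_ext_pi La La' (G : set (set T)) :
  normal_linear La -> normal_linear La' -> @measurable _ T = <<s G >> ->
  setI_closed G -> G setT -> (forall A, G A -> La (\1_A) = La' (\1_A)) ->
  forall f, bmfun f -> La f = La' f.
Proof.
move=> [LD LZ LC] [LD' LZ' LC'] GE GI GT GL.
apply: (monotone_class GE GI GT) => // [f g bf bg ef eg|c f bf ef|g f M bg bf gM gf].
- by rewrite LD ?LD' ?ef ?eg.
- by rewrite LZ ?LZ' ?ef.
- have bg' n : bmfun (g n) by have [] := bg n.
  apply: cvg_unique (LC g f _ bg' bf gM gf) _ => //.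
  rewrite (_ : (fun n => La (g n)) = (fun n => La' (g n))).
    exact: (LC' g f _ bg' bf gM gf).
  by apply/funext => n; have [] := bg n.
Qed.

Lemma normal_linear_ext La La' : normal_linear La -> normal_linear La' ->
  (forall A, measurable A -> La (\1_A) = La' (\1_A)) ->
  forall f, bmfun f -> La f = La' f.
Proof.
move=> nL nL'; apply: (normal_linear_ext_pi nL nL') => //.
  by rewrite sigma_algebra_id//; exact: sigma_algebra_measurable.
by move=> A B; exact: measurableI.
Qed.

End normal_linear.

Lemma expect_normal_linear (R : realType) d d' (T : measurableType d)
    (U : measurableType d') (P : {measure set T -> \bar R}) (P1 : P setT = 1%E)
    (eta : T -> R) (phi : T -> U) : bmfun eta -> measurable_fun setT phi ->
  normal_linear (fun f : U -> R => \int[P]_w (eta w * f (phi w))).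
Proof.
move=> be mphi.
have b (f : U -> R) : bmfun f -> bmfun (fun w => eta w * f (phi w)).
  by move=> bf; exact: (bmfunM be (bmfun_comp mphi bf)).
split=> [f g bf bg|c f bf|g f M bg bf gM gf].
- by under eq_Rintegral do rewrite mulrDr; rewrite (expectD P1)//; exact: b.
- by under eq_Rintegral do rewrite mulrCA; rewrite (expectZ P1)//; exact: b.
- have [_ [C eC]] := be.
  apply: (@expect_bounded_cvg _ _ _ _ P1 _ _ (C * M)) => [n||n w|w].
  + exact: b.
  + exact: b.
  + by rewrite normrM ler_pM.
  + by apply: cvgMr; exact: gf.
Qed.

Section kernels.
Context (R : realType) d d' (X : measurableType d) (Y : measurableType d').
Variable k : R.-pker X ~> Y.

Let k1 x : k x setT = 1%E. Proof. exact: prob_kernel. Qed.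

Lemma fine_kernelE x B : measurable B -> (fine (k x B))%:E = k x B.
Proof. by move=> mB; rewrite fineK// ge0_fin_numE// (prob_lty (k1 x)). Qed.

Lemma bmfun_kernel_set B : measurable B -> bmfun (fun x => fine (k x B)).
Proof.
move=> mB; split.
  by apply: measurableT_comp => //; exact: measurable_kernel.
exists 1 => x; rewrite ger0_norm ?fine_ge0// -lee_fin fine_kernelE//.
by rewrite -(k1 x); apply: le_measure; rewrite ?inE.
Qed.

Lemma bmfun_kernel f : bmfun f -> bmfun (fun x => \int[k x]_y f y).
Proof.
elim/bmfun_ind => {f} [A mA|f g bf bg|c f bf|f g bf bg fg].
- by under eq_fun do rewrite expect_indic//; exact: bmfun_kernel_set.
- by under [X in _ -> _ -> bmfun X]eq_fun do rewrite (expectD (k1 _))//;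
    exact: bmfunD.
- by under [X in _ -> bmfun X]eq_fun do rewrite (expectZ (k1 _))//; exact: bmfunZ.
- have [_ [M fM]] := bf; split; last first.
    by exists M => x; exact: (expect_le_bound (k1 x)).
  have bg' n : bmfun (g n) by have [] := bg n.
  apply: (measurable_fun_cvg (h := fun n x => \int[k x]_y g n y)) => [n|x _].
    by apply: bmfun_measurable; have [] := bg n.
  apply: (@uniform_cvg _ _ _ 1) => n; rewrite mul1r -(expectB (k1 x))//.
  by apply: (expect_le_bound (k1 x)) => //; exact: bmfunB.
Qed.

Lemma kernel_normal_linear d0 (Omega : measurableType d0)
    (P : {measure set Omega -> \bar R}) (P1 : P setT = 1%E) (eta : Omega -> R)
    (phi : Omega -> X) : bmfun eta -> measurable_fun setT phi ->
  normal_linear (fun f => \int[P]_w (eta w * \int[k (phi w)]_y f y)).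
Proof.
move=> be mphi.
have [ED EZ EC] := expect_normal_linear P1 be mphi.
split=> [f g bf bg|c f bf|g f M bg bf gM gf].
- rewrite -(ED (fun x => \int[k x]_y f y) (fun x => \int[k x]_y g y));
    [|exact: bmfun_kernel..].
  by apply: eq_Rintegral => w _; rewrite (expectD (k1 _)).
- rewrite -(EZ c (fun x => \int[k x]_y f y)); last exact: bmfun_kernel.
  by apply: eq_Rintegral => w _; rewrite (expectZ (k1 _)).
- apply: (EC (fun n x => \int[k x]_y g n y) (fun x => \int[k x]_y f y) M).
  + by move=> n; exact: bmfun_kernel.
  + exact: bmfun_kernel.
  + by move=> n x; exact: (expect_le_bound (k1 x)).
  + by move=> x; exact: (expect_bounded_cvg (k1 x) bg bf gM gf).
Qed.

Lemma expect_transfer d0 (Omega : measurableType d0)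
    (P : {measure set Omega -> \bar R}) (P1 : P setT = 1%E)
    (phi : Omega -> X) (psi : Omega -> Y) A :
  measurable_fun setT phi -> measurable_fun setT psi -> measurable A ->
  (forall B, measurable B ->
    P (A `&` psi @^-1` B) = (\int[P]_(w in A) k (phi w) B)%E) ->
  forall f, bmfun f ->
  \int[P]_w (\1_A w * f (psi w)) = \int[P]_w (\1_A w * \int[k (phi w)]_y f y).
Proof.
move=> mphi mpsi mA H.
have b1 : bmfun (\1_A : Omega -> R) by exact: bmfun_indic.
apply: normal_linear_ext => [||B mB].
- exact: (expect_normal_linear P1).
- exact: (kernel_normal_linear P1).
- have mB' : measurable (A `&` psi @^-1` B).
    by apply: measurableI => //; rewrite -[X in measurable X]setTI; exact: mpsi.
  rewrite (@eq_Rintegral _ _ _ _ _ (\1_(A `&` psi @^-1` B))); last first.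
    by move=> w _; rewrite indicI.
  rewrite expect_indic// H// -expect_in//; congr fine.
  by apply: eq_integral => w _; rewrite expect_indic// fine_kernelE.
Qed.

Lemma expect_law (mu : probability X R) f : bmfun f ->
  \int[law k mu]_y f y = \int[mu]_x \int[k x]_y f y.
Proof.
have mu1 : (mu : {measure set X -> \bar R}) setT = 1%E by exact: probability_setT.
have l1 : (law k mu : {measure set Y -> \bar R}) setT = 1%E by exact: probability_setT.
move=> bf; pose one (T : Type) (_ : T) : R := 1.
transitivity (\int[law k mu]_y (one _ y * f (id y))).
  by apply: eq_Rintegral => y _; rewrite mul1r.
transitivity (\int[mu]_x (one _ x * \int[k (id x)]_y f y)); last first.
  by apply: eq_Rintegral => y _; rewrite mul1r.
move: f bf; apply: normal_linear_ext => [||B mB].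
- by apply: (expect_normal_linear l1) => //; exact: bmfun_cst.
- by apply: (kernel_normal_linear mu1) => //; exact: bmfun_cst.
- under eq_Rintegral do rewrite mul1r; under [RHS]eq_Rintegral do rewrite mul1r.
  rewrite expect_indic//; congr fine; apply: eq_integral => x _.
  by rewrite expect_indic// fine_kernelE.
Qed.

End kernels.

(** * Sub-sigma-algebras *)

Section sub_sigma.
Context (R : realType) d (T : measurableType d).
Implicit Types G : set (set T).

Lemma measurable_id_sub G : G `<=` @measurable _ T ->
  measurable_fun setT (id : T -> g_sigma_algebraType G).
Proof.
move=> Gm; apply: (@measurability _ _ T (g_sigma_algebraType G) setT id G) => //.
by move=> _ [A GA <-]; rewrite setTI preimage_id; exact: Gm.
Qed.

Lemma measurable_id_gsub G G' : G `<=` <<s G' >> ->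
  measurable_fun setT (id : g_sigma_algebraType G' -> g_sigma_algebraType G).
Proof.
move=> GG'; apply: (@measurability _ _ (g_sigma_algebraType G')
  (g_sigma_algebraType G) setT id G) => //.
by move=> _ [A GA <-]; rewrite setTI preimage_id; exact: GG'.
Qed.

Lemma bmfun_sub G (f : T -> R) : G `<=` @measurable _ T ->
  bmfun (f : g_sigma_algebraType G -> R) -> bmfun f.
Proof. by move=> /measurable_id_sub mG bf; exact: (bmfun_comp mG bf). Qed.

Lemma bmfun_gsub G G' (f : T -> R) : G `<=` <<s G' >> ->
  bmfun (f : g_sigma_algebraType G -> R) -> bmfun (f : g_sigma_algebraType G' -> R).
Proof. by move=> /measurable_id_gsub mG bf; exact: (bmfun_comp mG bf). Qed.

Context I d' (E : measurableType d') (Z : I -> T -> E).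

Lemma sigma_gen_measurable (J : set I) :
  (forall i, J i -> measurable_fun setT (Z i)) ->
  sigma_gen J Z `<=` @measurable _ T.
Proof.
move=> mZ; apply: smallest_sub; first exact: sigma_algebra_measurable.
by apply: bigcup_sub => i Ji _ [B mB <-]; exact: mZ.
Qed.

Lemma sigma_gen_coordinate (J : set I) i : J i ->
  measurable_fun setT (Z i : g_sigma_algebraType (sigma_gen J Z) -> E).
Proof.
move=> Ji _ B mB; rewrite setTI; apply: sub_sigma_algebra; apply: sub_sigma_algebra.
by exists i => //; exists B => //; rewrite setTI.
Qed.

Lemma sigma_gen_sub (J J' : set I) : J `<=` J' ->
  sigma_gen J Z `<=` sigma_gen J' Z.
Proof.
move=> JJ'; apply: sub_sigma_algebra2; apply: bigcup_sub => i Ji B ZB.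
by exists i => //; exact: JJ'.
Qed.

Lemma sigma_gen_sigma_algebra (J : set I) : sigma_algebra setT (sigma_gen J Z).
Proof. exact: smallest_sigma_algebra. Qed.

End sub_sigma.

(** * Markov processes *)

Lemma normal_linear_sub (R : realType) d (T : measurableType d)
    (G : set (set T)) (La : (T -> R) -> R) : G `<=` @measurable _ T ->
  normal_linear La -> normal_linear (La : (g_sigma_algebraType G -> R) -> R).
Proof.
move=> Gm [LD LZ LC]; split=> [f g bf bg|c f bf|g f M bg bf gM gf].
- by apply: LD; exact: bmfun_sub Gm _.
- by apply: LZ; exact: bmfun_sub Gm _.
- by apply: (LC _ _ M) => // [n|]; exact: bmfun_sub Gm _.
Qed.

Section chains.
Context (R : realType) d' (E : measurableType d') (Omega : Type).
Variables (Q : R -> R.-pker E ~> E) (Z : R -> Omega -> E).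
Implicit Type l : seq (R * (E -> R)).

(** A list [(u_1, phi_1), (u_2, phi_2), ...] stands for the observables [phi_i]
    at the successive times [u_1], [u_1 + u_2], ... after the present; [nest]
    integrates out their product, the latest factor first. *)
Fixpoint admissible (K : set (E -> R)) l : Prop :=
  if l is x :: l' then [/\ 0 <= x.1, K x.2 & admissible K l'] else True.

Fixpoint path_prod l (t : R) (w : Omega) : R :=
  if l is x :: l' then x.2 (Z (t + x.1) w) * path_prod l' (t + x.1) w else 1.

Fixpoint nest l (z : E) : R :=
  if l is x :: l' then \int[Q x.1 z]_y (x.2 y * nest l' y) else 1.

Lemma bmfun_nest l : admissible (@bmfun R _ E) l -> bmfun (nest l).
Proof.
elim: l => [_|x l IH /= [x0 bx /IH bl]]; first exact: bmfun_cst.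
by apply: bmfun_kernel; exact: bmfunM.
Qed.

(** Times are relative to the preceding observable, so that an insertion cuts a
    waiting time in two. *)
Fixpoint insert (x : R * (E -> R)) l :=
  if l is y :: l' then
    if x.1 <= y.1 then x :: (y.1 - x.1, y.2) :: l'
    else y :: insert (x.1 - y.1, x.2) l'
  else [:: x].

Lemma path_prod_insert x l t w :
  path_prod (insert x l) t w = x.2 (Z (t + x.1) w) * path_prod l t w.
Proof.
elim: l x t => [//|y l IH] x t /=; case: ifP => xy /=.
  by rewrite -addrA (addrC x.1) subrK.
by rewrite IH /= -addrA (addrC y.1) subrK mulrCA.
Qed.

Lemma admissible_insert K x l : 0 <= x.1 -> K x.2 -> admissible K l ->
  admissible K (insert x l).
Proof.
elim: l x => [|y l IH] x x0 bx //= [y0 byy bl]; case: ifPn => xy /=.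
  by split => //; rewrite subr_ge0.
split => //; apply: IH => //=.
by rewrite subr_ge0 ltW// ltNge.
Qed.

Lemma admissible_sub (K K' : set (E -> R)) l : K `<=` K' ->
  admissible K l -> admissible K' l.
Proof. by move=> KK'; elim: l => [//|x l IH] /= [x0 /KK' Kx /IH]. Qed.

Lemma admissible_cat K l l' : admissible K l -> admissible K l' ->
  admissible K (l ++ l').
Proof. by elim: l => [//|x l IH] /= [x0 bx al] al'; split => //; exact: IH. Qed.

(** From observables dated by the time elapsed since the present to successive
    ones. *)
Definition chain l := foldr insert [::] l.

Lemma admissible_chain K l : admissible K l -> admissible K (chain l).
Proof.
by elim: l => [//|x l IH] /= [x0 bx /IH al]; exact: admissible_insert.
Qed.

Lemma path_prod_chain l t w :
  path_prod (chain l) t w = \prod_(x <- l) x.2 (Z (t + x.1) w).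
Proof.
elim: l => [|x l IH]; first by rewrite big_nil.
by rewrite big_cons /= path_prod_insert IH.
Qed.

End chains.

Lemma bmfun_prod_admissible (R : realType) d' (E : measurableType d') (K : set (E -> R))
    d (T : measurableType d) (F : R -> (E -> R) -> T -> R) l :
  (forall t g, 0 <= t -> K g -> bmfun (F t g)) -> admissible K l ->
  bmfun (fun w => \prod_(x <- l) F x.1 x.2 w).
Proof.
move=> bF; elim: l => [_|x l IH /= [x0 Kx /IH bl]].
  by under eq_fun do rewrite big_nil; exact: bmfun_cst.
by under eq_fun do rewrite big_cons; apply: bmfunM => //; exact: bF.
Qed.

Lemma bmfun_path_prod (R : realType) d' (E : measurableType d') (K : set (E -> R))
    d (T : measurableType d) (Y : R -> T -> E) l : K `<=` @bmfun R _ E ->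
  (forall t, 0 <= t -> measurable_fun setT (Y t)) -> admissible K l ->
  bmfun (fun w => \prod_(x <- l) x.2 (Y x.1 w)).
Proof.
move=> Kb mY al; suff bF t (g : E -> R) : 0 <= t -> K g -> bmfun (fun w => g (Y t w)).
  exact: (bmfun_prod_admissible bF al).
by move=> t0 /Kb bg; exact: (bmfun_comp (mY t t0) bg).
Qed.

Section cylinders.
Context (R : realType) d' (E : measurableType d') d (Omega : measurableType d).
Variables (Y : R -> Omega -> E) (K : set (E -> R)) (C : set (set E)).
Hypotheses (Kb : K `<=` @bmfun R _ E) (CE : @measurable _ E = <<s C >>)
  (KC : forall A, C A -> K (\1_A)).

(** Finite-dimensional cylinders with sides in a class that generates the
    sigma-algebra of [E], described by the factors of their indicators. *)
Definition cylinders : set (set Omega) := [set A | exists2 l,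
  admissible K l & forall w, \1_A w = \prod_(x <- l) x.2 (Y x.1 w) :> R].

Lemma cylinders_setI : setI_closed cylinders.
Proof.
move=> A B [l al Al] [l' al' Bl']; exists (l ++ l'); first exact: admissible_cat.
by move=> w; rewrite indicI big_cat /= -Al -Bl'.
Qed.

Lemma cylinders_setT : cylinders setT.
Proof. by exists [::] => // w; rewrite indicT big_nil. Qed.

Lemma sigma_cylinders : sigma_gen [set t | 0 <= t] Y = <<s cylinders >>.
Proof.
set GY := sigma_gen _ _.
rewrite eqEsubset; split; apply: smallest_sub; try exact: smallest_sigma_algebra.
  apply: bigcup_sub => t /= t0 _ [B mB <-].
  suff mt : measurable_fun setT (Y t : g_sigma_algebraType cylinders -> E).
    exact: mt.
  apply: (@measurability _ _ (g_sigma_algebraType cylinders) E setT _ C) => //.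
  move=> _ [A CA <-]; apply: sub_sigma_algebra; exists [:: (t, \1_A)].
    by split => //; exact: KC.
  by move=> w; rewrite big_seq1 /= setTI !indicE.
move=> A [l al Al].
have bl : bmfun ((fun w => \prod_(x <- l) x.2 (Y x.1 w)) : g_sigma_algebraType GY -> R).
  apply: (bmfun_path_prod (Y := fun t => Y t : g_sigma_algebraType GY -> E) Kb _ al).
  move=> t t0; exact: (@sigma_gen_coordinate _ _ _ _ _ Y [set r | 0 <= r] t t0).
have -> : A = [set: Omega] `&` (fun w => \prod_(x <- l) x.2 (Y x.1 w)) @^-1` [set 1].
  apply/seteqP; split=> w; rewrite setTI /= -Al indicE.
    by move=> Aw; rewrite mem_set.
  by case: (boolP (w \in A)) => [/set_mem//|_ /= /eqP]; rewrite eq_sym oner_eq0.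
have := bmfun_measurable bl measurableT (measurable_set1 1).
by rewrite /measurable /= sigma_algebra_id//; exact: smallest_sigma_algebra.
Qed.

End cylinders.

Section markov.
Context (R : realType) d' (E : measurableType d') d (Omega : measurableType d).
Variables (P : R.-pker E ~> Omega) (Z : R -> Omega -> E) (Q : R -> R.-pker E ~> E).
Hypotheses (mZ : forall t, 0 <= t -> measurable_fun setT (Z t))
  (Z0 : forall z, {ae P z, forall w, Z 0 w = z}).

Definition past t := sigma_gen [set r | 0 <= r <= t] Z.
Definition whole := sigma_gen [set r | 0 <= r] Z.

Hypothesis step : forall z s t A B, 0 <= s -> 0 <= t -> past t A ->
  measurable B ->
  P z (A `&` Z (t + s) @^-1` B) = (\int[P z]_(w in A) Q s (Z t w) B)%E.

Let P1 z : P z setT = 1%E. Proof. exact: prob_kernel. Qed.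

Lemma past_measurable t : past t `<=` @measurable _ Omega.
Proof. by apply: sigma_gen_measurable => r /= /andP[r0 _]; exact: mZ. Qed.

Lemma whole_measurable : whole `<=` @measurable _ Omega.
Proof. by apply: sigma_gen_measurable => r /=; exact: mZ. Qed.

Lemma past_mono s t : s <= t -> past s `<=` past t.
Proof.
by move=> st; apply: sigma_gen_sub => r /= /andP[-> /=] /le_trans; exact.
Qed.

Lemma bmfun_past_coordinate s t (f : E -> R) : 0 <= s <= t -> bmfun f ->
  bmfun ((fun w => f (Z s w)) : g_sigma_algebraType (past t) -> R).
Proof.
move=> st bf.
exact: (bmfun_comp (@sigma_gen_coordinate _ _ _ _ _ Z [set r | 0 <= r <= t] s st) bf).
Qed.

(** The Markov property on events extends to functions of the future position,
    then to weights that are measurable for the past. *)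
Lemma markov_step z s t (eta : Omega -> R) f : 0 <= s -> 0 <= t ->
  bmfun (eta : g_sigma_algebraType (past t) -> R) -> bmfun f ->
  \int[P z]_w (eta w * f (Z (t + s) w)) =
  \int[P z]_w (eta w * \int[Q s (Z t w)]_y f y).
Proof.
move=> s0 t0 + bf.
under eq_Rintegral do rewrite mulrC.
under [in X in _ -> _ = X]eq_Rintegral do rewrite mulrC.
have mid := measurable_id_sub (@past_measurable t).
have mts := mZ (addr_ge0 t0 s0); have mt := mZ t0.
apply: (normal_linear_ext
  (expect_normal_linear (P1 z) (bmfun_comp mts bf) mid)
  (expect_normal_linear (P1 z) (bmfun_comp mt (bmfun_kernel (Q s) bf)) mid)).
move=> A mA /=.
have pA : past t A by rewrite /past -(sigma_algebra_id (sigma_gen_sigma_algebra _ _)).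
under eq_Rintegral do rewrite mulrC.
under [RHS]eq_Rintegral do rewrite mulrC.
apply: (expect_transfer (P1 z)) => //; first exact: past_measurable pA.
by move=> B mB; exact: step.
Qed.

Lemma markov_chain z l t (eta : Omega -> R) : admissible (@bmfun R _ E) l -> 0 <= t ->
  bmfun (eta : g_sigma_algebraType (past t) -> R) ->
  \int[P z]_w (eta w * path_prod Z l t w) = \int[P z]_w (eta w * nest Q l (Z t w)).
Proof.
elim: l t eta => [//|x l IH] t eta /= [x0 bx al] t0 be.
have tx : t <= t + x.1 by rewrite lerDl.
under eq_Rintegral do rewrite mulrA.
rewrite (IH _ (fun w => eta w * x.2 (Z (t + x.1) w)))//; last 2 first.
- exact: addr_ge0.
- apply: bmfunM; last by apply: bmfun_past_coordinate; rewrite ?addr_ge0/=.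
  by apply: bmfun_gsub be; exact: subset_trans (past_mono tx) (@sub_sigma_algebra _ _ _).
under eq_Rintegral do rewrite -mulrA.
rewrite (markov_step _ (f := fun y => x.2 y * nest Q l y))//.
by apply: bmfunM => //; exact: bmfun_nest.
Qed.

Lemma nest_law z l : admissible (@bmfun R _ E) l -> \int[P z]_w path_prod Z l 0 w = nest Q l z.
Proof.
move=> al; have b1 t : bmfun ((fun=> 1) : g_sigma_algebraType (past t) -> R).
  exact: bmfun_cst.
transitivity (\int[P z]_w (1 * path_prod Z l 0 w)).
  by apply: eq_Rintegral => w _; rewrite mul1r.
rewrite (markov_chain z al (lexx 0) (b1 0)).
rewrite -[RHS](expect_cst (P1 z)); apply: expect_ae.
- exact/bmfunZ/(bmfun_comp (mZ (lexx 0)) (bmfun_nest _ al)).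
- exact: bmfun_cst.
- by have := Z0 z; apply: filterS => w Zw; rewrite mul1r Zw.
Qed.

Variable shift : R -> Omega -> Omega.
Hypothesis shiftE : forall s t w, 0 <= s -> 0 <= t -> Z s (shift t w) = Z (t + s) w.

Lemma measurable_shift t : 0 <= t ->
  measurable_fun setT (shift t : Omega -> g_sigma_algebraType whole).
Proof.
move=> t0; apply: (@measurability _ _ Omega (g_sigma_algebraType whole) setT _
  (\bigcup_(r in [set r | 0 <= r]) preimage_set_system setT (Z r) measurable)).
  by rewrite [LHS]sigma_algebra_id//; exact: sigma_gen_sigma_algebra.
move=> _ [_ [r /= r0 [B mB <-]] <-]; rewrite !setTI.
have -> : shift t @^-1` (Z r @^-1` B) = Z (t + r) @^-1` B.
  by apply/seteqP; split => w /=; rewrite shiftE.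
by rewrite -[X in measurable X]setTI; apply: mZ => //; exact: addr_ge0.
Qed.

(** Both sides are integrals of [xi] against measures, and they agree on
    finite-dimensional cylinders. *)
Lemma markov_shift z t (eta xi : Omega -> R) : 0 <= t ->
  bmfun (eta : g_sigma_algebraType (past t) -> R) ->
  bmfun (xi : g_sigma_algebraType whole -> R) ->
  \int[P z]_w (eta w * xi (shift t w)) =
  \int[P z]_w (eta w * \int[P (Z t w)]_v xi v).
Proof.
move=> t0 be; have be' := bmfun_sub (@past_measurable t) be.
pose C := cylinders Z (@bmfun R _ E).
have EC : @measurable _ (g_sigma_algebraType whole) = <<s C >>.
  rewrite [LHS]sigma_algebra_id; last exact: sigma_gen_sigma_algebra.
  apply: (@sigma_cylinders _ _ _ _ _ _ _ (@measurable _ E)) => // [|A mA].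
    by rewrite sigma_algebra_id//; exact: sigma_algebra_measurable.
  exact: bmfun_indic.
move: xi; apply: (normal_linear_ext_pi
  (expect_normal_linear (P1 z) be' (measurable_shift t0))
  (normal_linear_sub whole_measurable
    (kernel_normal_linear P (P1 z) be' (mZ t0)))
  EC (@cylinders_setI _ _ _ _ _ Z _) (@cylinders_setT _ _ _ _ _ Z _)) => //.
move=> A [l al Al].
transitivity (\int[P z]_w (eta w * path_prod Z (chain l) t w)).
  apply: eq_Rintegral => w _; rewrite Al path_prod_chain; congr (_ * _).
  elim: l al {Al} => [|x l IH /= [x0 bx /IH al]]; first by rewrite !big_nil.
  by rewrite !big_cons al shiftE.
rewrite markov_chain//; last exact: admissible_chain.
apply: eq_Rintegral => w _; congr (_ * _).
rewrite -nest_law; last exact: admissible_chain.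
apply: eq_Rintegral => v _; rewrite Al path_prod_chain.
by apply: eq_bigr => x _; rewrite add0r.
Qed.

End markov.

(** * Merging of filters *)

Import HBSimple.

Section density.
Context (R : realType) d (T : measurableType d) (pm pn : probability T R).

(** A simple function close in L1 to the Radon-Nikodym density. *)
Lemma bounded_density (delta : R) : pm `<< pn -> 0 < delta ->
  exists2 g, bmfun g & forall Z K, bmfun Z -> (forall x, `|Z x| <= K) ->
    `|\int[pm]_x Z x - \int[pn]_x (Z x * g x)| <= K * delta.
Proof.
move=> mn d0.
have pm1 : (pm : {measure set T -> \bar R}) setT = 1%E by exact: probability_setT.
have pn1 : (pn : {measure set T -> \bar R}) setT = 1%E by exact: probability_setT.
pose D := Radon_Nikodym (charge_of_finite_measure pm) pn.
have iD : pn.-integrable setT D by exact: Radon_Nikodym_integrable.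
have finD x : D x \is a fin_num by exact: Radon_Nikodym_fin_num.
pose r x := fine (D x).
have rE : EFin \o r = D by apply/funext => x; rewrite /r /= fineK.
have ir : pn.-integrable setT (EFin \o r) by rewrite rE.
have [s [is_ _ sD]] := approximation_sfun_integrable measurableT iD.
have bs n : bmfun (s n).
  split; first exact: measurable_funPT.
  have [M [_ sM]] := simple_bounded (s n).
  by exists (M + 1) => x; apply: sM => //; rewrite ltrDl.
have [n sn] : exists n, \int[pn]_x `|r x - s n x| < delta.
  have /fine_cvg/cvgrPdist_lt/(_ _ d0)[N _ /(_ N (leqnn N)) /=] := sD.
  rewrite sub0r normrN => sN; exists N; apply: le_lt_trans sN.
  apply: (le_trans _ (ler_norm _)); rewrite le_eqVlt; apply/orP; left; apply/eqP.
  by congr fine; apply: eq_integral => x _; rewrite -rE.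
exists (s n) => // Z K bZ ZK.
have K0 : 0 <= K by exact: le_trans (ZK point).
have bdZ : [bounded Z x | x in setT].
  by exists K; split; [exact: num_real|move=> N KN x _; exact: le_trans (ZK x) (ltW KN)].
have ird : pn.-integrable setT (EFin \o (fun x => r x - s n x)).
  rewrite (_ : EFin \o _ = (EFin \o r) \- (EFin \o s n))%E//.
  by apply: integrableB => //; exact: (bmfun_integrable pn1).
have iZ h : pn.-integrable setT (EFin \o h) ->
    pn.-integrable setT (EFin \o (fun x => Z x * h x)).
  by move=> ih; apply: (integrableMr measurableT _ bdZ ih); case: bZ.
have -> : \int[pm]_x Z x = \int[pn]_x (Z x * r x).
  congr fine; rewrite -(Radon_Nikodym_change_of_variables mn measurableT).
    by apply: eq_integral => x _; rewrite EFinM -[(r x)%:E]/((EFin \o r) x) rE.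
  exact: (bmfun_integrable pm1).
rewrite -RintegralB//; [|exact: iZ|exact/iZ/(bmfun_integrable pn1)].
under eq_Rintegral do rewrite -mulrBr.
apply: (le_trans (le_normr_Rintegral measurableT (iZ _ ird))).
apply: (@le_trans _ _ (\int[pn]_x (K * `|r x - s n x|))); last first.
  rewrite RintegralZl//; first by rewrite ler_wpM2l// ltW.
  exact: integrable_norm ird.
apply: le_Rintegral => //.
- exact: (integrable_norm (iZ _ ird)).
- rewrite (_ : EFin \o _ = (fun x => K%:E * (`|r x - s n x|)%:E)%E)//.
  by apply: integrableZl => //; exact: integrable_norm ird.
- by move=> x _; rewrite normrM ler_wpM2r.
Qed.

End density.

Section dyadic_times.
Context (R : realType).

(** Every time is a limit of dyadic times from the right. *)
Lemma right_continuous_le (g : R -> R) (u c : R) : 0 <= u ->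
  (forall t, 0 <= t -> g s @[s --> t^'+] --> g t) ->
  (forall i n : nat, g (u + i%:R / 2 ^+ n) <= c) ->
  forall t, u <= t -> g t <= c.
Proof.
move=> u0 rc gc t ut; rewrite leNgt; apply/negP => cg.
have t0 : 0 <= t by exact: le_trans ut.
have : \forall s \near t^'+, c < g s by exact: cvgr_gt (rc t t0) _ cg.
case=> e /= e0 He.
have [n ne] : exists n : nat, (2 ^+ n)^-1 < e.
  exists (Num.truncn e^-1); rewrite invf_plt ?posrE ?exprn_gt0//.
  apply: (lt_le_trans (truncnS_gt _)); rewrite -natrX ler_nat.
  exact: ltn_expl.
pose i := (Num.truncn ((t - u) * 2 ^+ n)).+1.
have tu0 : 0 <= (t - u) * 2 ^+ n by rewrite mulr_ge0 ?subr_ge0.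
have /andP[i1 i2] := truncn_itv tu0.
have p0 : 0 < 2 ^+ n :> R by rewrite exprn_gt0.
have ti : t < u + i%:R / 2 ^+ n.
  by rewrite -ltrBlDl ltr_pdivlMr.
have it : u + i%:R / 2 ^+ n < t + e.
  apply: (@le_lt_trans _ _ (t + (2 ^+ n)^-1)); last by rewrite ltrD2l.
  have : i%:R / 2 ^+ n <= (t - u) + (2 ^+ n)^-1.
    rewrite ler_pdivrMr// mulrDl mulVf ?gt_eqF// /i -natr1.
    by rewrite lerD2r.
  by move=> ?; lra.
have /He/(_ ti) : ball t e (u + i%:R / 2 ^+ n).
  by rewrite /ball /= ltr_norml; apply/andP; split; lra.
by rewrite ltNge gc.
Qed.

End dyadic_times.

Section filtration.
Context (R : realType) d (T : measurableType d) (F : R -> set (set T)).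
Hypotheses (Fm : forall t, 0 <= t -> F t `<=` @measurable _ T)
  (Fsig : forall t, 0 <= t -> sigma_algebra setT (F t))
  (Fmono : forall s t, 0 <= s -> s <= t -> F s `<=` F t).

Definition terminal : set (set T) := \bigcup_(t in [set t | 0 <= t]) F t.
Local Notation Tinf := (g_sigma_algebraType terminal).

Lemma terminal_measurable : terminal `<=` @measurable _ T.
Proof. by apply: bigcup_sub => t /= t0; exact: Fm. Qed.

Lemma bmfun_terminal t (f : T -> R) : 0 <= t ->
  bmfun (f : g_sigma_algebraType (F t) -> R) -> bmfun (f : Tinf -> R).
Proof.
move=> t0; apply: bmfun_gsub => A FA; apply: sub_sigma_algebra.
by exists t.
Qed.

Lemma bmfun_mono s t (f : T -> R) : 0 <= s -> s <= t ->
  bmfun (f : g_sigma_algebraType (F s) -> R) ->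
  bmfun (f : g_sigma_algebraType (F t) -> R).
Proof.
move=> s0 st; apply: bmfun_gsub => A FA; apply: sub_sigma_algebra.
exact: Fmono FA.
Qed.

Let bT (f : T -> R) : bmfun (f : Tinf -> R) -> bmfun f.
Proof. exact: bmfun_sub terminal_measurable. Qed.

Let bFT t (f : T -> R) : 0 <= t ->
  bmfun (f : g_sigma_algebraType (F t) -> R) -> bmfun f.
Proof. by move=> t0; exact: bmfun_sub (Fm t0). Qed.

Lemma terminal_setI : setI_closed terminal.
Proof.
move=> A B [s /= s0 FA] [t /= t0 FB].
have [st|ts] := leP s t.
- exists t => //; have := Fmono s0 st FA => FA'.
  by have := @measurableI _ (g_sigma_algebraType (F t)) A B; rewrite /measurable /=
    (sigma_algebra_id (Fsig t0)); exact.
- exists s => //; have := Fmono t0 (ltW ts) FB => FB'.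
  by have := @measurableI _ (g_sigma_algebraType (F s)) A B; rewrite /measurable /=
    (sigma_algebra_id (Fsig s0)); exact.
Qed.

Section dense.
Variable (P : {measure set T -> \bar R}).
Hypothesis P1 : P setT = 1%E.

(** Events known at a finite time form a pi-system that generates the terminal
    sigma-algebra, and the functions that can be approximated form a monotone
    class. *)
Lemma filtration_dense g : bmfun (g : Tinf -> R) -> forall e : R, 0 < e ->
  exists u h, [/\ 0 <= u, bmfun (h : g_sigma_algebraType (F u) -> R) &
    \int[P]_x `|g x - h x| <= e].
Proof.
move: g; apply: (@monotone_class _ _ Tinf terminal) => //.
- exact: terminal_setI.
- exists 0 => //=; have [F0 FC _] := Fsig (lexx 0).
  by rewrite -[setT]setC0 -setTD; exact: FC.
- move=> A [t /= t0 FA] e e0; exists t, (\1_A); split => //.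
    apply: (@bmfun_indic _ _ (g_sigma_algebraType (F t))).
    exact: sub_sigma_algebra.
  under eq_Rintegral do rewrite subrr normr0.
  by rewrite (expect_cst P1) ltW.
- move=> f g bf bg Kf Kg e e0; have e20 : 0 < e / 2 by rewrite divr_gt0.
  have [s [f' [s0 bf' ff']]] := Kf _ e20.
  have [t [g' [t0 bg' gg']]] := Kg _ e20.
  exists (Num.max s t), (fun x => f' x + g' x).
  have bf2 : bmfun (f' : g_sigma_algebraType (F (Num.max s t)) -> R).
    by apply: bmfun_mono bf' => //; rewrite le_max lexx.
  have bg2 : bmfun (g' : g_sigma_algebraType (F (Num.max s t)) -> R).
    by apply: bmfun_mono bg' => //; rewrite le_max lexx orbT.
  split; [by rewrite le_max s0|exact: bmfunD|].
  have bff' : bmfun (fun x : T => `|f x - f' x|).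
    exact: bmfun_norm (bmfunB (bT bf) (bFT s0 bf')).
  have bgg' : bmfun (fun x : T => `|g x - g' x|).
    exact: bmfun_norm (bmfunB (bT bg) (bFT t0 bg')).
  apply: (@le_trans _ _ (\int[P]_x (`|f x - f' x| + `|g x - g' x|))).
    apply: le_expect => //; last by move=> x; rewrite opprD addrACA ler_normD.
    + exact: bmfun_norm (bmfunB (bmfunD (bT bf) (bT bg))
        (bmfunD (bFT s0 bf') (bFT t0 bg'))).
    + exact: bmfunD.
  by rewrite (expectD P1)// [leRHS]splitr lerD.
- move=> c f bf Kf e e0.
  have e1 : 0 < e / (`|c| + 1) by rewrite divr_gt0// ltr_wpDl.
  have [s [f' [s0 bf' ff']]] := Kf _ e1.
  exists s, (fun x => c * f' x); split => //; first exact: bmfunZ.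
  have bff' : bmfun (fun x : T => `|f x - f' x|).
    exact: bmfun_norm (bmfunB (bT bf) (bFT s0 bf')).
  under eq_Rintegral do rewrite -mulrBr normrM.
  rewrite (expectZ P1)// (le_trans (ler_wpM2l (normr_ge0 c) ff'))//.
  by rewrite mulrCA ler_piMr// ?(ltW e0)// ler_pdivrMr ?mul1r ?lerDl// ltr_wpDl.
- move=> g f M bg bf gM gf e e0; have e20 : 0 < e / 2 by rewrite divr_gt0.
  have bg' n : bmfun (g n : T -> R) by apply: bT; have [] := bg n.
  have bf' := bT bf; have [_ [N fN]] := bf.
  have bd n : bmfun (fun x : T => `|f x - g n x|).
    exact: bmfun_norm (bmfunB bf' (bg' n)).
  have : \int[P]_x `|f x - g n x| @[n --> \oo] --> \int[P]_x (cst 0 x).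
    apply: (@expect_bounded_cvg _ _ _ _ P1 _ _ (N + M)) => // [|n x|x].
    + exact: bmfun_cst.
    + by rewrite normr_id (le_trans (ler_normB _ _))// lerD.
    + rewrite -(normr0 R) -(subrr (f x)); apply: cvg_norm.
      by apply: cvgB; [exact: cvg_cst|exact: gf].
  rewrite (expect_cst P1) => /cvgrPdist_le/(_ _ e20)[n _ /(_ n (leqnn n)) /=].
  rewrite sub0r normrN => /(le_trans (ler_norm _)) fgn.
  have [_ /(_ _ e20)[u [h [u0 bh gh]]]] := bg n.
  exists u, h; split => //.
  have bgh : bmfun (fun x : T => `|g n x - h x|).
    exact: bmfun_norm (bmfunB (bg' n) (bFT u0 bh)).
  apply: (@le_trans _ _ (\int[P]_x (`|f x - g n x| + `|g n x - h x|))).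
    apply: le_expect => //; last by move=> x; exact: ler_distD.
    + exact: bmfun_norm (bmfunB bf' (bFT u0 bh)).
    + exact: bmfunD.
  by rewrite (expectD P1)// [leRHS]splitr lerD.
Qed.

End dense.

(** On the terminal sigma-algebra, [Pm] is close in total variation to a measure
    whose density with respect to [Pn] is observed at a finite time. *)
Lemma early_density (Pm Pn : {measure set T -> \bar R}) (delta : R) :
  Pm setT = 1%E -> Pn setT = 1%E -> Pm `<< Pn -> 0 < delta ->
  exists u h, [/\ 0 <= u, bmfun (h : g_sigma_algebraType (F u) -> R) &
    forall Z K, bmfun (Z : Tinf -> R) -> (forall x, `|Z x| <= K) ->
      `|\int[Pm]_x Z x - \int[Pn]_x (Z x * h x)| <= K * delta].
Proof.
move=> Pm1 Pn1 mn d0; have d20 : 0 < delta / 2 by rewrite divr_gt0.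
have mid := measurable_id_sub terminal_measurable.
have [pm pmE] := @exists_probability _ _ _ (image_measure Pm mid) Pm1.
have [pn pnE] := @exists_probability _ _ _ (image_measure Pn mid) Pn1.
have int_pm Z : bmfun (Z : Tinf -> R) -> \int[pm]_x Z x = \int[Pm]_x Z x.
  move=> bZ; rewrite -(expect_image mid Pm1 bZ); congr fine.
  by apply: eq_measure_integral => A _ _; exact: pmE.
have int_pn Z : bmfun (Z : Tinf -> R) -> \int[pn]_x Z x = \int[Pn]_x Z x.
  move=> bZ; rewrite -(expect_image mid Pn1 bZ); congr fine.
  by apply: eq_measure_integral => A _ _; exact: pnE.
have pmn : pm `<< pn.
  apply/null_content_dominatesP => A mA pnA; rewrite pmE /=.
  move/null_content_dominatesP : mn; apply; last exact: etrans (esym (pnE A)) pnA.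
  by rewrite -[X in measurable X]setTI; exact: (mid).
have [g bg gP] := bounded_density pmn d20.
have [u [h [u0 bh gh]]] := filtration_dense Pn1 bg d20.
exists u, h; split => // Z K bZ ZK.
have K0 : 0 <= K by exact: le_trans (ZK point).
have bh' : bmfun (h : Tinf -> R) by exact: bmfun_terminal bh.
have := gP _ _ bZ ZK; rewrite int_pm// int_pn; last exact: bmfunM.
have bZg : bmfun (fun x : T => Z x * g x) by apply: bT; exact: bmfunM.
have bZh : bmfun (fun x : T => Z x * h x) by apply: bT; exact: bmfunM.
have bgh : bmfun (fun x : T => `|g x - h x|).
  exact: bmfun_norm (bmfunB (bT bg) (bFT u0 bh)).
have : `|\int[Pn]_x (Z x * g x) - \int[Pn]_x (Z x * h x)| <= K * (delta / 2).
  rewrite -(expectB Pn1)//; apply: (le_trans (expect_norm Pn1 (bmfunB bZg bZh))).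
  apply: (@le_trans _ _ (\int[Pn]_x (K * `|g x - h x|))).
    apply: le_expect => //.
    + exact: bmfun_norm (bmfunB bZg bZh).
    + exact: bmfunZ bgh.
    + by move=> x; rewrite -mulrBr normrM ler_wpM2r.
  by rewrite (expectZ Pn1)// ler_wpM2l.
rewrite !ler_norml => /andP[h1 h2] /andP[h3 h4].
by apply/andP; split; lra.
Qed.

Lemma filtration_weight (P : {measure set T -> \bar R}) t (g g' eta : T -> R) :
  P setT = 1%E -> 0 <= t -> bmfun g -> bmfun g' ->
  (forall A, F t A -> \int[P]_x (\1_A x * g x) = \int[P]_x (\1_A x * g' x)) ->
  bmfun (eta : g_sigma_algebraType (F t) -> R) ->
  \int[P]_x (eta x * g x) = \int[P]_x (eta x * g' x).
Proof.
move=> P1 t0 bg bg' H.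
under eq_Rintegral do rewrite mulrC.
under [in X in _ -> _ = X]eq_Rintegral do rewrite mulrC.
have mid := measurable_id_sub (Fm t0).
apply: (normal_linear_ext (expect_normal_linear P1 bg mid)
  (expect_normal_linear P1 bg' mid)) => A mA /=.
under eq_Rintegral do rewrite mulrC.
under [RHS]eq_Rintegral do rewrite mulrC.
by apply: H; rewrite -(sigma_algebra_id (Fsig t0)).
Qed.

(** The case in view: [f t] and [v t] are functions of the signal at time [t],
    [a t] and [b t] are the filters of [f t] under [Pm] and [Pn], and [zeta t]
    predicts [v t] from the observations. *)
Section merging.
Variables (Pm Pn : {measure set T -> \bar R}).
Hypotheses (Pm1 : Pm setT = 1%E) (Pn1 : Pn setT = 1%E) (mn : Pm `<< Pn).
Variables (eps C : R) (f v zeta a b : R -> T -> R).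
Hypotheses (eps0 : 0 < eps)
  (bf : forall t, 0 <= t -> bmfun (f t)) (bv : forall t, 0 <= t -> bmfun (v t))
  (fv : forall t x, 0 <= t -> `|f t x - v t x| <= eps)
  (bz : forall t, 0 <= t -> bmfun (zeta t : Tinf -> R))
  (zC : forall t x, 0 <= t -> `|zeta t x| <= C)
  (ba : forall t, 0 <= t -> bmfun (a t : g_sigma_algebraType (F t) -> R))
  (bb : forall t, 0 <= t -> bmfun (b t : g_sigma_algebraType (F t) -> R))
  (bC : forall t x, 0 <= t -> `|b t x| <= C).
Hypotheses
  (aE : forall t A, 0 <= t -> F t A ->
    \int[Pm]_x (\1_A x * a t x) = \int[Pm]_x (\1_A x * f t x))
  (bE : forall t A, 0 <= t -> F t A ->
    \int[Pn]_x (\1_A x * b t x) = \int[Pn]_x (\1_A x * f t x))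
  (vmE : forall t A, 0 <= t -> F t A ->
    \int[Pm]_x (\1_A x * v t x) = \int[Pm]_x (\1_A x * zeta t x))
  (vnE : forall t A, 0 <= t -> F t A ->
    \int[Pn]_x (\1_A x * v t x) = \int[Pn]_x (\1_A x * zeta t x)).

Lemma disjoint_weights (N : nat) (B : nat -> set T) (c : nat -> T -> R) K :
  0 <= K -> trivIset setT B -> (forall i x, `|c i x| <= K) ->
  forall x, `|\sum_(i < N) \1_(B i) x * c i x| <= K.
Proof.
move=> K0 tB cK x.
have [[i /= iN Bix]|nB] := pselect (exists2 i, (i < N)%N & B i x).
  rewrite (bigD1 (Ordinal iN))//= big1 ?addr0.
    by rewrite indicE mem_set// mul1r.
  move=> j ji; rewrite indicE memNset ?mul0r// => Bjx.
  have := tB j i I I (ex_intro _ x (conj Bjx Bix)) => /= jiE.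
  by move: ji; rewrite -(inj_eq val_inj) /= jiE eqxx.
rewrite big1 ?normr0// => i _; rewrite indicE memNset ?mul0r// => Bix.
by apply: nB; exists i.
Qed.

(** Let [B i] be the event that [tau i] is the first of the given times at which
    [a] exceeds [b] by more than [4 * eps]. Over the [B i], the integral of [a]
    under [Pm] exceeds that of [b] by [4 * eps] times the mass of their union. On
    the other hand, [a] integrates like [f], which is within [eps] of [v], and [v]
    like [zeta]; in the integrals of [zeta] and [b], [Pm] can be replaced by the
    early density [D] times [Pn], where [zeta] again integrates like [v], within
    [eps] of [f], and [f] like [b]. So the two integrals differ by at most
    [2 * eps] times this mass, up to the error in the density. *)
Lemma merging_estimate (delta : R) : 0 < delta ->
  exists2 u, 0 <= u & forall (tau : nat -> R) N, (forall i, u <= tau i) ->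
    {homo tau : i j / (i <= j)%N >-> i <= j} ->
    fine (Pm (\big[setU/set0]_(i < N) [set x | 4 * eps < a (tau i) x - b (tau i) x]))
      <= delta.
Proof.
move=> d0.
have C0 : 0 <= C by exact: le_trans (bC point (lexx 0)).
(* solves [(2 * C + eps) * dl = 2 * eps * delta]: the errors made by replacing the
   density are [C * dl] for [b], [C * dl] for [zeta] and [eps * dl] for the sign *)
pose dl := 2 * eps * delta / (2 * C + eps).
have Ce : 0 < 2 * C + eps by rewrite ltr_wpDl// mulr_ge0.
have dd : 0 < dl by rewrite !divr_gt0// !mulr_gt0.
have [u [D [u0 bD HD]]] := early_density Pm1 Pn1 mn dd.
exists u => // tau N utau tau_incr.
have tau0 i : 0 <= tau i by exact: le_trans (utau i).
pose A i := [set x | 4 * eps < a (tau i) x - b (tau i) x].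
have FA i : F (tau i) (A i).
  rewrite -(sigma_algebra_id (Fsig (tau0 i))).
  have mb : measurable_fun [set: g_sigma_algebraType (F (tau i))]
      (fun x => a (tau i) x - b (tau i) x).
    by apply: bmfun_measurable; apply: bmfunB; [exact: ba|exact: bb].
  exact: measurable_superlevel mb.
pose B := seqDU A.
have tB : trivIset setT B by exact: trivIset_seqDU.
have FB i : F (tau i) (B i).
  rewrite -(sigma_algebra_id (Fsig (tau0 i))).
  apply: (@measurableD _ (g_sigma_algebraType (F (tau i)))).
    exact: sub_sigma_algebra.
  apply: (@bigsetU_measurable _ (g_sigma_algebraType (F (tau i)))) => j _.
  apply: sub_sigma_algebra; apply: (Fmono (tau0 j)) (FA j).
  by apply: tau_incr; exact: ltnW.
have bB i : bmfun (\1_(B i) : g_sigma_algebraType (F (tau i)) -> R).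
  by apply: bmfun_indic; exact: sub_sigma_algebra.
have bB' i : bmfun (\1_(B i) : T -> R) by exact: bFT (bB i).
have bBT i : bmfun (\1_(B i) : Tinf -> R) by exact: bmfun_terminal (bB i).
have bDT : bmfun (D : Tinf -> R) by exact: bmfun_terminal bD.
have bD' : bmfun (D : T -> R) by exact: bT.
have bDi i : bmfun (D : g_sigma_algebraType (F (tau i)) -> R) by exact: bmfun_mono bD.
have b_T i : bmfun (b (tau i) : Tinf -> R).
  by apply: (@bmfun_terminal (tau i)) => //; exact: bb.
have a' i : bmfun (a (tau i)) by apply: bFT (ba _).
have b' i : bmfun (b (tau i)) by apply: bFT (bb _).
have f' i : bmfun (f (tau i)) by exact: bf.
have v' i : bmfun (v (tau i)) by exact: bv.
have z' i : bmfun (zeta (tau i)) by apply: bT; exact: bz.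
pose S (x : T) : R := \sum_(i < N) \1_(B i) x * 1.
pose Zb (x : T) : R := \sum_(i < N) \1_(B i) x * b (tau i) x.
pose Zz (x : T) : R := \sum_(i < N) \1_(B i) x * zeta (tau i) x.
pose Zs (x : T) : R := \sum_(i < N) \1_(B i) x * Num.sg (D x).
have Zb1 : `|\int[Pm]_x Zb x - \int[Pn]_x (Zb x * D x)| <= C * dl.
  apply: HD; first by apply: bmfun_sum => i; exact: bmfunM.
  exact: (@disjoint_weights N B (fun i => b (tau i)) C C0 tB (fun i x => bC x (tau0 i))).
have Zz1 : `|\int[Pm]_x Zz x - \int[Pn]_x (Zz x * D x)| <= C * dl.
  apply: HD; first by apply: bmfun_sum => i; apply: bmfunM => //; exact: bz.
  exact: (@disjoint_weights N B (fun i => zeta (tau i)) C C0 tB (fun i x => zC x (tau0 i))).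
have Zs1 : `|\int[Pm]_x Zs x - \int[Pn]_x (Zs x * D x)| <= 1 * dl.
  apply: HD; first by apply: bmfun_sum => i; apply: bmfunM => //; apply: bmfun_sg; case: bDT.
  apply: (@disjoint_weights N B (fun _ x => Num.sg (D x)) 1 ler01 tB) => _ x.
  by have [_|_|_] := sgrP (D x); rewrite ?normr0 ?normrN ?normr1.
have bS : bmfun S by apply: bmfun_sum => i; apply: bmfunM => //; exact: bmfun_cst.
have S0 x : 0 <= S x.
  by apply: sumr_ge0 => i _; rewrite mulr1 indicE; case: (_ \in _).
have i01 i x : 0 <= \1_(B i) x :> R by rewrite indicE; case: (_ \in _).
have bsum (c : nat -> T -> R) : (forall i, bmfun (c i)) ->
    bmfun (fun x => \sum_(i < N) \1_(B i) x * c i x).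
  by move=> bc; apply: bmfun_sum => i; exact: bmfunM.
have esum (P : {measure set T -> \bar R}) (c : nat -> T -> R) : P setT = 1%E ->
    (forall i, bmfun (c i)) -> \int[P]_x (\sum_(i < N) \1_(B i) x * c i x) =
      \sum_(i < N) \int[P]_x (\1_(B i) x * c i x).
  by move=> P1 bc; rewrite (expect_sum P1)// => i; exact: bmfunM.
rewrite -/A; set be := \int[Pm]_x S x.
apply: (@le_trans _ _ be).
  have mU : measurable (\big[setU/set0]_(i < N) A i).
    by apply: bigsetU_measurable => i _; exact: (Fm (tau0 i)) (FA i).
  rewrite -(expect_indic Pm mU); apply: le_expect => //; first exact: bmfun_indic.
  move=> x; rewrite indicE; case: (boolP (x \in _)) => [|_]; last exact: S0.
  rewrite bigsetU_seqDU => /set_mem; rewrite -bigcup_mkord => -[i /= iN Bix].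
  rewrite /S (bigD1 (Ordinal iN))//= mulr1 indicE mem_set//= lerDl.
  by apply: sumr_ge0 => k _; rewrite mulr1.
have I1 : 4 * eps * be + \int[Pm]_x Zb x <=
    \int[Pm]_x (\sum_(i < N) \1_(B i) x * f (tau i) x).
  have -> : \int[Pm]_x (\sum_(i < N) \1_(B i) x * f (tau i) x) =
      \int[Pm]_x (\sum_(i < N) \1_(B i) x * a (tau i) x).
    rewrite (esum _ (fun i => f (tau i)))// (esum _ (fun i => a (tau i)))//.
    by apply: eq_bigr => i _; rewrite aE.
  have bsb : bmfun Zb := bsum _ b'; have bsa := bsum _ a'.
  rewrite -(expectZ Pm1)// -(expectD Pm1)//; last exact: bmfunZ.
  apply: le_expect => //; first by apply: bmfunD => //; exact: bmfunZ.
  move=> x; rewrite mulr_sumr -big_split /=; apply: ler_sum => i _.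
  rewrite mulr1 mulrC -mulrDr indicE; have [|] := boolP (x \in B i); last by rewrite !mul0r.
  by move=> /set_mem Bix; have := subset_seqDU Bix; rewrite /A /= !mul1r; lra.
have bfD i : bmfun (fun x : T => f (tau i) x * D x) by exact: bmfunM.
have bvD i : bmfun (fun x : T => v (tau i) x * D x) by exact: bmfunM.
have bbD i : bmfun (fun x : T => b (tau i) x * D x) by exact: bmfunM.
have bzD i : bmfun (fun x : T => zeta (tau i) x * D x) by exact: bmfunM.
have swap i (g g' : T -> R) : bmfun g -> bmfun g' ->
    (forall A, F (tau i) A -> \int[Pn]_x (\1_A x * g x) = \int[Pn]_x (\1_A x * g' x)) ->
    \int[Pn]_x (\1_(B i) x * (g x * D x)) = \int[Pn]_x (\1_(B i) x * (g' x * D x)).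
  move=> bg bg' gg'.
  under eq_Rintegral do rewrite mulrCA mulrC.
  under [RHS]eq_Rintegral do rewrite mulrCA mulrC.
  by apply: (filtration_weight Pn1 (tau0 i)) => //; exact: bmfunM.
(* [D] need not be nonnegative: its sign turns [`|D|] into a weight times [D] *)
have I2 : `|\int[Pn]_x (Zb x * D x) - \int[Pn]_x (Zz x * D x)| <=
    eps * \int[Pn]_x (Zs x * D x).
  have -> : \int[Pn]_x (Zb x * D x) =
      \int[Pn]_x (\sum_(i < N) \1_(B i) x * (f (tau i) x * D x)).
    rewrite (esum _ (fun i x => f (tau i) x * D x))//.
    under eq_Rintegral do rewrite mulr_suml.
    under eq_Rintegral do under eq_bigr do rewrite -mulrA.
    rewrite (esum _ (fun i x => b (tau i) x * D x))//.
    by apply: eq_bigr => i _; apply: swap => // A' FA'; exact: bE.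
  have -> : \int[Pn]_x (Zz x * D x) =
      \int[Pn]_x (\sum_(i < N) \1_(B i) x * (v (tau i) x * D x)).
    rewrite (esum _ (fun i x => v (tau i) x * D x))//.
    under eq_Rintegral do rewrite mulr_suml.
    under eq_Rintegral do under eq_bigr do rewrite -mulrA.
    rewrite (esum _ (fun i x => zeta (tau i) x * D x))//.
    by apply: eq_bigr => i _; apply: swap => // A' FA'; apply/esym; exact: vnE.
  have bZsD : bmfun (fun x => Zs x * D x).
    apply: bmfunM => //.
    exact: (bsum (fun _ x => Num.sg (D x)) (fun _ => bmfun_sg (bmfun_measurable bD'))).
  have bsf := bsum _ bfD; have bsv := bsum _ bvD.
  rewrite -(expectB Pn1)//; apply: (le_trans (expect_norm Pn1 (bmfunB bsf bsv))).
  rewrite -(expectZ Pn1)//; apply: le_expect => //.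
  + exact: bmfun_norm (bmfunB bsf bsv).
  + exact: bmfunZ.
  + move=> x; rewrite -sumrB mulr_suml mulr_sumr (le_trans (ler_norm_sum _ _ _))//.
    apply: ler_sum => i _.
    have -> : eps * (\1_(B i) x * Num.sg (D x) * D x) = \1_(B i) x * (eps * `|D x|).
      by rewrite -mulrA -normrEsg mulrCA.
    by rewrite -mulrBr -mulrBl normrM ger0_norm// ler_wpM2l// normrM ler_wpM2r// fv.
have I3 : `|\int[Pm]_x (\sum_(i < N) \1_(B i) x * f (tau i) x) - \int[Pm]_x Zz x| <=
    eps * be.
  have -> : \int[Pm]_x Zz x = \int[Pm]_x (\sum_(i < N) \1_(B i) x * v (tau i) x).
    rewrite (esum _ (fun i => v (tau i)))// (esum _ (fun i => zeta (tau i)))//.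
    by apply: eq_bigr => i _; rewrite vmE.
  have bsf := bsum _ f'; have bsv := bsum _ v'.
  rewrite -(expectB Pm1)//; apply: (le_trans (expect_norm Pm1 (bmfunB bsf bsv))).
  rewrite -(expectZ Pm1)//; apply: le_expect => //.
  + exact: bmfun_norm (bmfunB bsf bsv).
  + exact: bmfunZ.
  + move=> x; rewrite -sumrB mulr_sumr (le_trans (ler_norm_sum _ _ _))//.
    apply: ler_sum => i _; rewrite -mulrBr normrM mulr1 ger0_norm// mulrC.
    by rewrite ler_wpM2r// fv.
have I4 : \int[Pm]_x Zs x <= be.
  have bsg : bmfun Zs := bsum (fun _ x => Num.sg (D x)) (fun _ => bmfun_sg (bmfun_measurable bD')).
  apply: le_expect => //.
  move=> x; apply: ler_sum => i _; apply: ler_wpM2l => //.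
  by have [_|_|_] := sgrP (D x) => //; lra.
have I5 : 2 * eps * be <= (2 * C + eps) * dl.
  move: Zb1 Zz1 Zs1 I2 I3; rewrite !ler_norml.
  move=> /andP[b1 b2] /andP[z1 z2] /andP[s1 s2] /andP[i1 i2] /andP[j1 j2].
  have := ler_wpM2l (ltW eps0) I4; have := ler_wpM2l (ltW eps0) s1.
  by rewrite !mulrBr; lra.
have dlE : (2 * C + eps) * dl = 2 * eps * delta.
  by rewrite /dl mulrC mulfVK ?gt_eqF.
by move: I5; rewrite dlE ler_pM2l ?mulr_gt0.
Qed.

(** The estimate is uniform over finite sets of times, so it bounds the probability
    of an excess at some dyadic time after [u]; right-continuity gives the other
    times. *)
Lemma merging_as :
  {ae Pm, forall x, forall t, 0 <= t ->
    (a s x - b s x) @[s --> t^'+] --> a t x - b t x} ->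
  {ae Pm, forall x, exists2 u, 0 <= u &
    forall t, u <= t -> a t x - b t x <= 4 * eps}.
Proof.
move=> rc.
have mexc t : 0 <= t -> measurable [set x | 4 * eps < a t x - b t x].
  move=> t0; apply: measurable_superlevel; apply: bmfun_measurable.
  by apply: bmfunB; [apply: bFT (ba _)|apply: bFT (bb _)].
have H (k : nat) : exists E u, [/\ measurable E, (Pm E <= k.+1%:R^-1%:E)%E, 0 <= u &
    forall (i n : nat), [set x | 4 * eps < a (u + i%:R / 2 ^+ n) x -
      b (u + i%:R / 2 ^+ n) x] `<=` E].
  have k0 : 0 < k.+1%:R^-1 :> R by rewrite invr_gt0.
  have [u u0 Hu] := merging_estimate k0.
  pose tau n i : R := u + i%:R / 2 ^+ n.
  have tauu n i : u <= tau n i by rewrite lerDl divr_ge0.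
  pose X n i := [set x | 4 * eps < a (tau n i) x - b (tau n i) x].
  (* the dyadic times of level [n] up to [2 ^ n] after [u]: with this bound the
     grids increase with [n] and exhaust all dyadic times *)
  pose G n := \big[setU/set0]_(i < 4 ^ n) X n i.
  have mX n i : measurable (X n i) by apply: mexc; exact: le_trans (tauu n i).
  have mG n : measurable (G n) by exact: bigsetU_measurable.
  have GS n : G n `<=` G n.+1.
    move=> x; rewrite /G -!bigcup_mkord => -[i /= iN Xi].
    exists (2 * i)%N => /=.
      by rewrite expnS (ltn_trans (n := 2 * 4 ^ n)%N) ?ltn_pmul2l// ltn_pmul2r ?expn_gt0.
    suff -> : X n.+1 (2 * i)%N = X n i by [].
    rewrite /X; suff -> : tau n.+1 (2 * i)%N = tau n i by [].
    rewrite /tau natrM exprS -mulf_div divff ?mul1r//.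
  have GP n : (Pm (G n) <= k.+1%:R^-1%:E)%E.
    have := Hu (tau n) (4 ^ n)%N (tauu n) _.
    rewrite -lee_fin fineK; last by rewrite ge0_fin_numE// (prob_lty Pm1 (mG n)).
    apply=> i j ij; rewrite lerD2l ler_pM2r ?invr_gt0 ?exprn_gt0//.
    by rewrite ler_nat.
  exists (\bigcup_n G n), u; split => //.
  - exact: bigcupT_measurable.
  - have ndG : nondecreasing_seq G by apply/nondecreasing_seqP => n; exact/subsetPset.
    have := nondecreasing_cvg_mu (mu := Pm) mG (bigcupT_measurable _ mG) ndG.
    move=> /cvg_lim <-//; apply: lime_le; last exact: nearW.
    apply/cvg_ex; exists (Pm (\bigcup_n G n)).
    by apply: nondecreasing_cvg_mu => //; exact: bigcupT_measurable.
  - move=> i n x /= Hx; exists (n + i)%N => //.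
    rewrite /G -bigcup_mkord; exists (i * 2 ^ i)%N => /=.
      apply: (@leq_trans (2 ^ i * 2 ^ i)%N).
        by rewrite ltn_pmul2r ?expn_gt0// ltn_expl.
      by rewrite -expnMn; apply: leq_pexp2l => //; exact: leq_addl.
    suff tauE : tau (n + i)%N (i * 2 ^ i)%N = u + i%:R / 2 ^+ n by rewrite /X /= tauE.
    by rewrite /tau exprD natrM natrX invfM mulrACA divff ?mulr1 ?expf_neq0.
have [E HE] := choice H; have [u uP] := choice HE.
have : Pm.-negligible (\bigcap_k E k).
  exists (\bigcap_k E k); split => //.
    by apply: bigcapT_measurable => k; have [] := uP k.
  apply/eqP; rewrite -measure_le0; apply/lee_addgt0Pr => e e0; rewrite add0e.
  have [k ke] : exists k : nat, k.+1%:R^-1 < e.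
    exact: filter_ex (near_infty_natSinv_lt (PosNum e0)).
  have [mE PE _ _] := uP k.
  apply: (@le_trans _ _ (Pm (E k))); last by rewrite (le_trans PE)// lee_fin ltW.
  apply: le_measure; rewrite ?inE//.
    by apply: bigcapT_measurable => j; have [] := uP j.
  exact: bigcap_inf.
move=> neg; have aeE : {ae Pm, forall x, ~ (\bigcap_k E k) x}.
  by apply: negligibleS neg => x /= /contrapT.
move: aeE rc; apply: filterS2 => x nE rcx.
have /existsNP[k /not_implyP[_ nEk]] := nE.
have [_ _ u0 Hk] := uP k; exists (u k) => //.
apply: right_continuous_le => // i n; rewrite leNgt; apply/negP => Hx.
by apply: nEk; exact: Hk Hx.
Qed.

End merging.

End filtration.

(** * Completion and augmentation *)

Section augmentation_approx.
Context (R : realType) d (T : measurableType d) (P : {measure set T -> \bar R}).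

Definition symdiff (A B : set T) := (A `\` B) `|` (B `\` A).

(** Augmented sigma-algebras contain the same events up to null sets. *)
Lemma augmentation_approx (G N : set (set T)) A : sigma_algebra setT G ->
  N `<=` P.-negligible -> <<s G `|` N >> A ->
  exists A', G A' /\ P.-negligible (symdiff A A').
Proof.
move=> [G0 GC GU] NP.
pose H := [set A | exists A', G A' /\ P.-negligible (symdiff A A')].
suff : <<s G `|` N >> `<=` H by apply.
apply: smallest_sub; last first.
  move=> B [GB|NB].
    by exists B; rewrite /symdiff setDv setU0; split => //; exact: negligible_set0.
  by exists set0; rewrite /symdiff setD0 set0D setU0; split => //; exact: NP.
split.
- by exists set0; rewrite /symdiff setDv setU0; split => //; exact: negligible_set0.
- move=> B [B' [GB' nB]]; exists (setT `\` B'); split; first exact: GC.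
  rewrite !setTD; apply: negligibleS nB => x [[/= nB nnB']|[/= nB' nnB]].
    by right; split => //; exact: contrapT.
  by left; split => //; exact: contrapT.
- move=> F /choice[F' F'P].
  exists (\bigcup_n F' n); split; first by apply: GU => n; have [] := F'P n.
  apply: (@negligibleS _ _ _ _ (\bigcup_n symdiff (F n) (F' n))).
    move=> x [[[n _ Fx] nF']|[[n _ F'x] nF]]; exists n => //.
      by left; split => // F'x; apply: nF'; exists n.
    by right; split => // Fx; apply: nF; exists n.
  by apply: negligible_bigcup => n; have [] := F'P n.
Qed.

Lemma negligible_symdiff A B : P.-negligible (symdiff A B) ->
  {ae P, forall x, \1_A x = \1_B x :> R}.
Proof.
apply: negligibleS => x /= nAB; apply: contrapT => nD; apply: nAB.
rewrite !indicE; suff -> : (x \in A) = (x \in B) by [].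
apply/idP/idP => /set_mem Ax; apply/mem_set; apply: contrapT => nB; apply: nD.
  by left.
by right.
Qed.

Lemma completed_symdiff A A' : measurable A' -> P.-negligible (symdiff A A') ->
  completed P A = P A'.
Proof.
move=> mA' [B [mB B0 AB]].
have B0' : (P^*)%mu B = 0%E by rewrite measurable_mu_extE.
rewrite -[RHS]measurable_mu_extE//; apply/eqP; rewrite eq_le; apply/andP; split.
- apply: (@le_trans _ _ ((P^*)%mu (A' `|` B))).
    apply: le_outer_measure => x Ax.
    by have [A'x|nA'x] := pselect (A' x); [left|right; apply: AB; left].
  by apply: (le_trans (outer_measureU2 _ _ _)); rewrite [X in (_ + X)%E]B0' adde0.
- apply: (@le_trans _ _ ((P^*)%mu (A `|` B))).
    apply: le_outer_measure => x A'x.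
    by have [Ax|nAx] := pselect (A x); [left|right; apply: AB; right].
  by apply: (le_trans (outer_measureU2 _ _ _)); rewrite [X in (_ + X)%E]B0' adde0.
Qed.

End augmentation_approx.

Section enlarged.
Context (R : realType) d (T : measurableType d).
Variable N : set (set T).

(** The sigma-algebra on which laws whose null sets include [N] can be compared:
    the completions of two measures live on different types. *)
Definition enlargedT := g_sigma_algebraType (@measurable _ T `|` N).

Lemma measurable_from_enlarged : measurable_fun setT (id : enlargedT -> T).
Proof.
by move=> _ A mA; rewrite setTI preimage_id; apply: sub_sigma_algebra; left.
Qed.

Lemma bmfun_enlarged (f : T -> R) : bmfun f -> bmfun (f : enlargedT -> R).
Proof. exact: (bmfun_comp measurable_from_enlarged). Qed.

Variable P : {measure set T -> \bar R}.
Hypotheses (P1 : P setT = 1%E) (NP : N `<=` P.-negligible).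
Local Notation cara := (caratheodory_type (P^*)%mu).

Lemma measurable_to_enlarged : measurable_fun setT (id : cara -> enlargedT).
Proof.
apply: (@measurability _ _ cara enlargedT setT id (@measurable _ T `|` N)) => //.
move=> _ [A [mA|/NP[B [mB B0 AB]]] <-]; rewrite setTI preimage_id.
  exact: caratheodory_measurable_mu_ext.
apply: (measure_is_complete_caratheodory (mu := (P^*)%mu)).
exists B; split => //; first exact: caratheodory_measurable_mu_ext.
by rewrite /= measurable_mu_extE.
Qed.

Definition enlarged : {measure set enlargedT -> \bar R} :=
  image_measure (completed P) measurable_to_enlarged.

Lemma enlargedE (A : set T) : measurable A -> enlarged A = P A.
Proof. by move=> mA; rewrite /enlarged image_measureE; exact: measurable_mu_extE. Qed.

Lemma enlarged_setT : enlarged setT = 1%E.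
Proof. by rewrite enlargedE. Qed.

Lemma expect_enlarged (f : T -> R) : bmfun f -> \int[enlarged]_x f x = \int[P]_x f x.
Proof.
move=> bf; rewrite -(expect_image measurable_from_enlarged enlarged_setT bf); congr fine.
by apply: eq_measure_integral => A mA _; exact: (enlargedE mA).
Qed.

Lemma enlarged_ae (Q : T -> Prop) : {ae P, forall x, Q x} -> {ae enlarged, forall x, Q x}.
Proof.
move=> [A [mA A0 QA]]; exists A; split => //; last by rewrite enlargedE.
by apply: sub_sigma_algebra; left.
Qed.

(** A null event of the enlarged sigma-algebra differs from an event of the
    original one by a null set. *)
Lemma ae_of_enlarged (Q : T -> Prop) : {ae enlarged, forall x, Q x} -> {ae P, forall x, Q x}.
Proof.
move=> [A [mA A0 QA]].
have [A' [mA' nA]] := augmentation_approx (@sigma_algebra_measurable _ T) NP mA.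
have [B [mB B0 AB]] := nA.
exists (A' `|` B); split; first exact: measurableU.
  apply/eqP; rewrite -measure_le0; apply: (le_trans (measureU2 P mA' mB)).
  rewrite [X in (_ + X)%E]B0 adde0.
  have menl (C : set T) : measurable C -> measurable (C : set enlargedT).
    by move=> mC; apply: sub_sigma_algebra; left.
  have hB : enlarged B = 0%E by rewrite enlargedE.
  have <- : enlarged (A `|` B) = 0%E.
    apply/eqP; rewrite -measure_le0.
    apply: (le_trans (measureU2 enlarged mA (menl _ mB))).
    by rewrite [X in (X + _)%E]A0 [X in (_ + X)%E]hB adde0.
  apply: (@le_trans _ _ (enlarged A')); first by rewrite (enlargedE mA').
  apply: le_measure; rewrite ?inE; [exact: menl|..].
    by apply: measurableU => //; exact: menl.
  move=> x A'x; have [Ax|nAx] := pselect (A x); [by left|right].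
  by apply: AB; right; split.
move=> x /QA Ax; have [A'x|nA'x] := pselect (A' x); [by left|right].
by apply: AB; left; split.
Qed.

Lemma integral_enlarged A (f : T -> R) : measurable (A : set enlargedT) ->
  measurable_fun setT (f : enlargedT -> R) ->
  (completed P).-integrable setT (EFin \o f) ->
  (\int[completed P]_(x in A) (f x)%:E = \int[enlarged]_(x in A) (f x)%:E)%E.
Proof.
move=> mA mf intf; rewrite /enlarged /=.
rewrite (integral_pushforward measurable_to_enlarged (D := A)) ?preimage_id//.
- exact/measurable_EFinP.
- apply: (integrableS measurableT) => //.
  by have := measurable_to_enlarged measurableT mA; rewrite setTI preimage_id.
Qed.

End enlarged.

(** * Laws with the observation starting at the origin *)

Section laws.
Context (R : realType) (S : completePseudoMetricType R) (p : nat).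
Local Notation O := 'rV[R]_p.
Local Notation Omega := (canonical_space S O).
Variable P : R.-pker (borel S * borel O)%type ~> Omega.
Implicit Types kappa mu nu : probability (borel S) R.

Definition at_origin (x : borel S) : borel S * borel O := (x, 0).

Lemma measurable_at_origin : measurable_fun setT at_origin.
Proof. exact: measurable_fun_pair. Qed.

Lemma initialE kappa A : measurable A ->
  (kappa \x dirac (0%R : borel O))%E A =
  image_measure (kappa : {measure set _ -> \bar R}) measurable_at_origin A.
Proof.
move=> mA; rewrite image_measureE /product_measure1 /=.
rewrite (eq_integral (fun x => (\1_(at_origin @^-1` A) x)%:E)); last first.
  move=> x _; rewrite diracE indicE; congr (_%:R%:E); congr nat_of_bool.
  by apply/idP/idP => [/set_mem/xsectionP Ax|/set_mem Ax]; apply/mem_set => //; apply/xsectionP.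
rewrite integral_indic ?setIT//.
by rewrite -[X in measurable X]setTI; exact: measurable_at_origin.
Qed.

Lemma law0E kappa A : measurable A -> law0 P kappa A = (\int[kappa]_x P (x, 0%R) A)%E.
Proof.
move=> mA; rewrite /law0 /law /= /mixture.
transitivity (\int[image_measure (kappa : {measure set _ -> \bar R}) measurable_at_origin]_z P z A)%E.
  by apply: eq_measure_integral => B mB _; exact: initialE.
by apply: ge0_integral_image => //; exact: measurable_kernel.
Qed.

Lemma expect_law0 kappa (f : Omega -> R) : bmfun f ->
  \int[law0 P kappa]_w f w = \int[kappa]_x \int[P (x, 0)]_w f w.
Proof.
move=> bf; rewrite (expect_law P (kappa \x dirac (0%R : borel O))%E bf).
rewrite -(expect_image measurable_at_origin (f := fun z => \int[P z]_w f w))//.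
- congr fine; apply: eq_measure_integral => B mB _; exact: initialE.
- exact: probability_setT.
- exact: bmfun_kernel.
Qed.

Lemma law0_dominates mu nu : mu `<< nu -> law0 P mu `<< law0 P nu.
Proof.
move=> /null_content_dominatesP munu; apply/null_content_dominatesP => A mA.
have mPA : measurable_fun setT (fun x : borel S => P (x, 0%R) A).
  exact: (measurableT_comp (measurable_kernel P A mA) measurable_at_origin).
have intP (kappa : probability (borel S) R) : law0 P kappa A = 0%E <->
    ae_eq kappa setT (fun x => P (x, 0%R) A) (cst 0%E).
  rewrite law0E// -ae_eq_integral_abs//.
  rewrite (_ : (\int[kappa]_x `|P (x, 0%R) A| = \int[kappa]_x P (x, 0%R) A)%E)//.
  by apply: eq_integral => x _; rewrite gee0_abs.
move=> /(intP nu)[B [mB B0 PB]]; apply/(intP mu); exists B; split => //.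
exact: munu.
Qed.

(** The completion only adds null events, so it does not change integrals. *)
Lemma expect_completed d (T : measurableType d) (Q : {measure set T -> \bar R})
    (f : T -> R) : Q setT = 1%E -> bmfun f ->
  (\int[completed Q]_x (f x)%:E = (\int[Q]_x f x)%:E)%E.
Proof.
move=> Q1 bf.
have mid : measurable_fun setT (id : caratheodory_type (Q^*)%mu -> T).
  by move=> _ A mA; rewrite setTI preimage_id; exact: caratheodory_measurable_mu_ext.
have QE A : measurable A -> image_measure (completed Q) mid A = Q A.
  by move=> mA; rewrite image_measureE; exact: measurable_mu_extE.
have Q1' : completed Q setT = 1%E by rewrite -Q1; exact: measurable_mu_extE.
rewrite EFin_Rintegral//.
transitivity (\int[image_measure (completed Q) mid]_x (f x)%:E)%E; last first.
  by apply: eq_measure_integral => A mA _; exact: QE.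
rewrite (integral_pushforward mid) ?preimage_setT//.
- exact/measurable_EFinP/bmfun_measurable.
- exact: (bmfun_integrable Q1' measurableT (bmfun_comp mid bf)).
Qed.

End laws.

(** * Shifted paths *)

Section shifts.
Context (R : realType).

Lemma cvg_at_right_addl (t x : R) : t + s @[s --> x^'+] --> (t + x)^'+.
Proof.
move=> A [e /= e0 H]; exists e => //= s xs ltxs; apply: H => /=.
  by rewrite opprD addrACA subrr add0r.
by rewrite ltrD2l.
Qed.

Lemma cvg_at_left_addl (t x : R) : t + s @[s --> x^'-] --> (t + x)^'-.
Proof.
move=> A [e /= e0 H]; exists e => //= s xs ltxs; apply: H => /=.
  by rewrite opprD addrACA subrr add0r.
by rewrite ltrD2l.
Qed.

Lemma cadlag_shift (T : topologicalType) (w : R -> T) t : cadlag w ->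
  cadlag (fun s => w (Num.max t 0 + Num.max s 0)).
Proof.
move=> [wr wl]; have t0 : 0 <= Num.max t 0 by rewrite le_max lexx orbT.
set u := Num.max t 0 in t0 *; split=> s s0.
  have us0 : 0 <= u + s by exact: addr_ge0.
  rewrite (max_idPl s0); apply: cvg_trans (cvg_comp _ _ (@cvg_at_right_addl u s) (wr _ us0)).
  apply: near_eq_cvg; have := nbhs_right_gt s; apply: filterS => r sr /=.
  by rewrite (max_idPl _)// (le_trans s0)// ltW.
have us0 : 0 < u + s by rewrite ltr_wpDl.
have [l wl'] := wl _ us0; exists l.
apply: cvg_trans (cvg_comp _ _ (@cvg_at_left_addl u s) wl').
apply: near_eq_cvg; have := nbhs_left_gt s0; apply: filterS => r r0 /=.
by rewrite (max_idPl _)// ltW.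
Qed.

Definition shift_path (T : topologicalType) (t : R) (w : skorokhod R T) : skorokhod R T.
Proof.
refine (Skorokhod (@cadlag_shift T w t (path_cadlag w)) _) => s s0.
by rewrite maxxx [Num.max s 0](max_idPr _)// ltW.
Defined.

End shifts.

(** * Increments of vector-valued observations *)

Section differences.
Context (R : realType) (p : nat) d (T : measurableType d).
Local Notation O := 'rV[R]_p.

Definition grid (n : nat) (k : 'rV[int]_p) : O := \row_i ((k 0 i)%:~R / n.+1%:R).

Definition cell (n : nat) (y : O) : 'rV[int]_p := \row_i Num.floor (y 0 i * n.+1%:R).

Lemma cvg_grid (y : O) : grid n (cell n y) @[n --> \oo] --> y.
Proof.
apply/cvg_ballP => e e0.
have : \forall n \near \oo, n.+1%:R^-1 < e.
  exact: (near_infty_natSinv_lt (PosNum e0)).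
apply: filterS => n ne.
split => // i j; rewrite !mxE ord1.
have n0 : 0 < n.+1%:R :> R by [].
have := floor_itv (y 0 j * n.+1%:R); set f := (Num.floor _)%:~R => /andP[f1 f2].
rewrite /ball /= ger0_norm ?subr_ge0 ?ler_pdivrMr//.
apply: le_lt_trans ne.
by rewrite lerBlDr -[X in X + _]mul1r -mulrDl ler_pdivlMr// addrC ltW// -[1]/(1%:~R) -intrD.
Qed.

(** Subtraction is continuous, but the sigma-algebra of the pair is only generated
    by rectangles. Replacing [Y0] by approximations with countably many values
    reduces the claim to translates of [g]. *)
Lemma measurable_difference (Y Y0 : T -> borel O) (g : O -> R) :
  measurable_fun setT Y -> measurable_fun setT Y0 -> continuous g ->
  measurable_fun setT (fun w => g (Y w - Y0 w)).
Proof.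
move=> mY mY0 cg.
apply: (measurable_fun_cvg (h := fun n w => g (Y w - grid n (cell n (Y0 w))))).
  move=> n _ B mB; rewrite setTI.
  have -> : (fun w => g (Y w - grid n (cell n (Y0 w)))) @^-1` B = \bigcup_i
      (if unpickle i is Some k then (fun w => cell n (Y0 w)) @^-1` [set k] `&`
        (fun w => g (Y w - grid n k)) @^-1` B else set0).
    apply/seteqP; split=> [w Bw|w [i _]].
      by exists (pickle (cell n (Y0 w))) => //; rewrite pickleK.
    by case: (unpickle i) => [k|//] [/= ->].
  apply: bigcupT_measurable => i; case: (unpickle i) => [k|//]; apply: measurableI.
    have -> : (fun w => cell n (Y0 w)) @^-1` [set k] = \bigcap_(j in [set: 'I_p])
        (fun w => Y0 w 0 j * n.+1%:R) @^-1` `[(k 0 j)%:~R, (k 0 j + 1)%:~R[%classic.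
      apply/seteqP; split=> [w /= <- j _|w /= cw].
        by rewrite !mxE /= in_itv /= floor_itv.
      apply/rowP => j; rewrite mxE; have := cw j I.
      by rewrite /= in_itv /= => /floor_def.
    apply: fin_bigcap_measurable; first exact: finite_finset.
    move=> j _; rewrite -[X in measurable X]setTI.
    have mj : measurable_fun setT (fun y : borel O => y 0 j).
      exact: (continuous_borel (g := fun y : O => y 0 j) (@coord_continuous _ _ _ _ _)).
    have mjn : measurable_fun setT (fun w => Y0 w 0 j * n.+1%:R).
      by apply: measurable_funM => //; exact: (measurableT_comp mj mY0).
    by apply: mjn => //; exact: measurable_itv.
  have mg : measurable_fun setT (fun y : borel O => g (y - grid n k)).
    suff : continuous (fun y : O => g (y - grid n k)) by exact: continuous_borel.
    move=> y; apply: (@continuous_comp _ _ _ (fun y : O => y - grid n k) g) (cg _).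
    by apply: (@cvgB _ O _ (nbhs y) (nbhs_filter y)); [exact: cvg_id|exact: cvg_cst].
  have mgY : measurable_fun setT (fun w => g (Y w - grid n k)).
    exact: (measurableT_comp mg mY).
  by rewrite -[X in measurable X]setTI; exact: mgY.
move=> w _; apply: continuous_cvg; first exact: cg.
by apply: cvgB; [exact: cvg_cst|exact: cvg_grid].
Qed.

End differences.

(** * Test functions of the observation *)

Section tests.
Context (R : realType) (p : nat).
Local Notation O := 'rV[R]_p.

(** As [S] is compact, a test function seen as a function on [S * O] still has
    compact support. *)
Definition test : set (O -> R) := [set g : O -> R | [/\ continuous g,
  forall y, 0 <= g y <= 1 & exists2 K, compact K & forall y, ~ K y -> g y = 0]].

Lemma bmfun_test g : test g -> bmfun (g : borel O -> R).
Proof.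
move=> [cg g01 _]; split; first exact: continuous_borel.
by exists 1 => y; have /andP[g0 g1] := g01 y; rewrite ger0_norm.
Qed.

(** The positive part of [1 - |y| / n.+1]. *)
Definition tent (n : nat) (y : O) : R :=
  let z := 1 - `|y| / n.+1%:R in (z + `|z|) / 2.

Lemma test_tent n : test (tent n).
Proof.
have n0 : 0 < n.+1%:R :> R by [].
split.
- have cz : continuous (fun y : O => 1 - `|y| / n.+1%:R).
    move=> y; apply: (@cvgB _ _ _ _ (nbhs_filter y)); first exact: cvg_cst.
    by apply: (@cvgM _ _ _ (nbhs_filter y)); [exact: norm_continuous|exact: cvg_cst].
  move=> y; apply: (@cvgM _ _ _ (nbhs_filter y)); last exact: cvg_cst.
  apply: (@cvgD _ _ _ _ (nbhs_filter y)); first exact: cz.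
  exact: (cvg_norm (cz y)).
- move=> y; rewrite /tent; set z := 1 - _.
  have z1 : z <= 1 by rewrite gerBl divr_ge0.
  by have [z0|z0] := ger0P z; apply/andP; split; lra.
- exists [set y | `|y| <= n.+1%:R].
    apply: bounded_closed_compact.
      exists n.+1%:R; split; first exact: num_real.
      by move=> x nx y /= /le_trans; apply; exact: ltW.
    apply: (@closed_comp _ _ (fun y : O => `|y|) [set r | r <= n.+1%:R]).
      by move=> y _; exact: norm_continuous.
    exact: closed_le.
  move=> y /negP; rewrite -ltNge => ny; rewrite /tent ltr0_norm ?subrr ?mul0r//.
  by rewrite subr_lt0 ltr_pdivlMr// mul1r.
Qed.

Lemma cvg_tent (y : O) : tent n y @[n --> \oo] --> (1 : R).
Proof.
have z1 : 1 - `|y| / n.+1%:R @[n --> \oo] --> (1 : R).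
  rewrite -[X in _ --> X]subr0; apply: cvgB; first exact: cvg_cst.
  rewrite -[X in _ --> X](mulr0 `|y|); by apply: cvgM; [exact: cvg_cst|exact: cvg_harmonic].
rewrite -[X in _ --> X](_ : (1 + `|1|) / 2 = 1); last by rewrite normr1; lra.
by apply: cvgM; [apply: cvgD => //; exact: cvg_norm|exact: cvg_cst].
Qed.

Lemma test_approx (C : set O) : closed C -> exists g : nat -> O -> R,
  (forall n, test (g n)) /\ forall y, g n y @[n --> \oo] --> (\1_C y : R).
Proof.
move=> /(@closed_indicator_approx R)[g [cg g01 g1 g0]].
exists (fun n y => g n y * tent n y); split.
  move=> n; have [cb b01 [K cK bK]] := test_tent n; split.
  - by move=> y; apply: (@cvgM _ _ _ (nbhs_filter y)); [exact: cg|exact: cb].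
  - move=> y; have /andP[h0 h1] := g01 n y; have /andP[b0 b1] := b01 y.
    by rewrite mulr_ge0//= mulr_ile1.
  - by exists K => // y /bK ->; rewrite mulr0.
move=> y; rewrite indicE; case: (boolP (y \in C)) => [/set_mem Cy|/negP yC].
  rewrite (_ : (fun n => _) = tent^~ y); first exact: cvg_tent.
  by apply/funext => n; rewrite g1// mul1r.
apply: cvg_near_cst; have /g0 := fun Cy => yC (mem_set Cy).
by apply: filterS => n ->; rewrite mul0r.
Qed.

End tests.

(** * Prediction of the increments of the observation *)

Section increments.
Context (R : realType) (S : completePseudoMetricType R) (p : nat).
Local Notation O := 'rV[R]_p.
Local Notation E := (borel S * borel O)%type.
Local Notation Omega := (canonical_space S O).
Local Notation obs := (@observation R S p).
Local Notation tests := (@test R p : set (borel O -> R)).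
Implicit Type l : seq (R * (borel O -> R)).

Lemma test_prod_bound l (y : R -> O) : admissible tests l ->
  `|\prod_(x <- l) x.2 (y x.1)| <= 1.
Proof.
elim: l => [_|x l IH /= [x0 [_ x01 _] /IH bl]]; first by rewrite big_nil normr1.
rewrite big_cons normrM mulr_ile1//.
by have /andP[? ?] := x01 (y x.1); rewrite ger0_norm.
Qed.

Definition incr_prod l (u : R) (w : Omega) : R :=
  \prod_(x <- l) x.2 (obs (u + x.1) w - obs u w).

Lemma incr_prod_bound l u w : admissible tests l -> `|incr_prod l u w| <= 1.
Proof. exact: (@test_prod_bound l (fun s => obs (u + s) w - obs u w)). Qed.

Lemma bmfun_incr_prod d (T : measurableType d) (phi : T -> Omega) l u : 0 <= u ->
  (forall t, 0 <= t -> measurable_fun setT (obs t \o phi)) ->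
  admissible tests l -> bmfun (incr_prod l u \o phi).
Proof.
move=> u0 mphi al.
pose F (t : R) (g : borel O -> R) (w : T) := g (obs (u + t) (phi w) - obs u (phi w)).
suff bF t g : 0 <= t -> tests g -> bmfun (F t g).
  exact: (bmfun_prod_admissible bF al).
move=> t0 [cg g01 _]; split; last first.
  exists 1 => w; have /andP[? ?] := g01 (obs (u + t) (phi w) - obs u (phi w)).
  by rewrite ger0_norm.
apply: measurable_difference => //; first by apply: mphi; exact: addr_ge0.
exact: mphi.
Qed.

Lemma incr_prod_right_continuous l u w : 0 <= u -> admissible tests l ->
  incr_prod l s w @[s --> u^'+] --> incr_prod l u w.
Proof.
move=> u0; rewrite /incr_prod; elim: l => [_|x l IH /= [x0 [cx _ _] /IH cl]].
  by under eq_fun do rewrite big_nil; rewrite big_nil; exact: cvg_cst.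
under eq_fun do rewrite big_cons; rewrite big_cons; apply: cvgM => //.
apply: continuous_cvg; first exact: cx.
have [wr _] := path_cadlag w.2.
apply: cvgB; last exact: wr.
have -> : (fun s => obs (s + x.1) w) = w.2 \o (fun s => x.1 + s).
  by apply/funext => s /=; rewrite addrC.
rewrite [X in obs X]addrC.
exact: (cvg_comp _ _ (@cvg_at_right_addl _ x.1 u) (wr _ (addr_ge0 x0 u0))).
Qed.

End increments.

Section prediction.
Context (R : realType) (S : completePseudoMetricType R) (p : nat).
Local Notation O := 'rV[R]_p.
Local Notation E := (borel S * borel O)%type.
Local Notation Omega := (canonical_space S O).
Local Notation obs := (@observation R S p).
Local Notation tests := (@test R p : set (borel O -> R)).
Implicit Type l : seq (R * (borel O -> R)).

Definition joint (t : R) (w : Omega) : E := (signal t w, obs t w).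

Definition shift (t : R) (w : Omega) : Omega := (shift_path t w.1, shift_path t w.2).

Lemma measurable_joint t : 0 <= t -> measurable_fun setT (joint t).
Proof.
by move=> t0; apply: measurable_fun_pair;
  [exact: measurable_signal|exact: measurable_observation].
Qed.

Lemma joint_shift s t w : 0 <= s -> 0 <= t -> joint s (shift t w) = joint (t + s) w.
Proof.
by move=> s0 t0; rewrite /joint /signal /observation /=; rewrite !(max_idPl _).
Qed.

Lemma incr_prod_shift l t w : 0 <= t -> admissible tests l ->
  incr_prod l 0 (shift t w) = incr_prod l t w.
Proof.
move=> t0; rewrite /incr_prod; elim: l => [_|x l IH /= [x0 _ /IH lE]].
  by rewrite !big_nil.
rewrite !big_cons lE; congr (_ * _); rewrite add0r.
have obsE s : 0 <= s -> obs s (shift t w) = obs (t + s) w.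
  by move=> s0; have /(congr1 snd) := joint_shift w s0 t0.
by rewrite !obsE// addr0.
Qed.

Lemma measurable_joint_observation (G : set (set Omega)) :
  (forall t, 0 <= t -> measurable_fun setT (joint t : g_sigma_algebraType G -> E)) ->
  forall t, 0 <= t -> measurable_fun setT (obs t : g_sigma_algebraType G -> borel O).
Proof. by move=> mj t /mj mjt; exact: (measurableT_comp measurable_snd mjt). Qed.

Definition snd_tests : set (E -> R) := [set phi | exists2 g, tests g & phi = g \o snd].

Lemma bmfun_snd_tests : snd_tests `<=` @bmfun R _ E.
Proof.
by move=> _ [g tg ->]; apply: (bmfun_comp measurable_snd); exact: bmfun_test.
Qed.

(** The product of a test function with a continuous function vanishes at
    infinity, so the Feller property applies at each step. *)
Lemma nest_continuous (Q : R -> R.-pker E ~> E) : compact [set: S] ->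
  (forall t g, 0 <= t -> @C0 R (S * O)%type g ->
    @C0 R (S * O)%type (fun x => \int[Q t x]_y g y)) ->
  forall ll, admissible snd_tests ll -> continuous (nest Q ll : S * O -> R).
Proof.
move=> Sc QC; elim=> [_|x l' IH /= [x0 [g [cg g01 [K cK gK]] ->] al]].
  by move=> z; exact: cvg_cst.
apply: (QC _ _ x0 _).1; split.
  move=> z; apply: (@cvgM _ _ _ (nbhs_filter z)); last exact: IH.
  by apply: continuous_cvg; [exact: cg|exact: cvg_snd].
move=> e e0; exists (setT `*` K); first exact: compact_setX.
move=> z nK; rewrite /= gK ?mul0r ?normr0// => Kz; exact: nK.
Qed.

Definition snd_list l : seq (R * (E -> R)) :=
  [seq (x.1, x.2 \o (snd : E -> borel O)) | x : R * (borel O -> R) <- l].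

Lemma admissible_snd_list l : admissible tests l -> admissible snd_tests (snd_list l).
Proof. by elim: l => [//|x l IH] /= [x0 tx /IH]; split => //; exists x.2. Qed.

Lemma snd_list_path_prod l w :
  path_prod joint (chain (snd_list l)) 0 w = \prod_(x <- l) x.2 (obs x.1 w).
Proof.
rewrite path_prod_chain big_map; apply: eq_bigr => x _ /=.
by rewrite add0r.
Qed.

Variable P : R.-pker E ~> Omega.
Hypotheses (Sc : compact [set: S]) (CI : cond_indep_increments P)
  (FM : feller_markov (E := E) (@C0 R (S * O)%type) P id joint).

Let P1 z : P z setT = 1%E. Proof. exact: prob_kernel. Qed.

(** Given the past up to [t], the conditional expectation of [incr_prod l t] is
    [predictor l (signal t)]. *)
Definition predictor l (x : borel S) : R := \int[P (x, 0)]_w incr_prod l 0 w.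

Lemma bmfun_incr_prod_observation l t : 0 <= t -> admissible tests l ->
  bmfun (incr_prod l t :
    g_sigma_algebraType (sigma_gen [set t | 0 <= t] obs) -> R).
Proof.
move=> t0 al; apply: (@bmfun_incr_prod _ _ _ _
  (g_sigma_algebraType (sigma_gen [set t | 0 <= t] obs)) id) => //.
by move=> s s0; exact: sigma_gen_coordinate.
Qed.

Lemma bmfun_predictor l : admissible tests l -> bmfun (predictor l).
Proof.
move=> al; apply: (bmfun_comp (@measurable_at_origin R S p)
  (f := fun z => \int[P z]_w incr_prod l 0 w)).
apply: bmfun_kernel; apply: (@bmfun_incr_prod _ _ _ _ Omega id) => //.
by move=> t; exact: measurable_observation.
Qed.

Lemma obs0 x : {ae P (x, 0), forall w, obs 0 w = 0}.
Proof.
case: FM => Q [_ Z0 _]; have := Z0 (x, 0).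
by apply: filterS => w /(congr1 snd).
Qed.

Lemma predictor_path l x : admissible tests l ->
  predictor l x = \int[P (x, 0)]_w \prod_(y <- l) y.2 (obs y.1 w).
Proof.
move=> al; apply: expect_ae => //.
- apply: (@bmfun_incr_prod _ _ _ _ Omega id) => //.
  by move=> t; exact: measurable_observation.
- apply: (bmfun_prod_admissible (F := fun t g w => g (obs t w)) _ al).
  move=> t g t0 /bmfun_test bg.
  exact: (bmfun_comp (measurable_observation t0) bg).
- have := obs0 x; apply: filterS => w w0.
  by apply: eq_bigr => y _; rewrite w0 subr0 add0r.
Qed.

Lemma predictor_continuous l : admissible tests l -> continuous (predictor l : S -> R).
Proof.
move=> al; case: FM => Q [QC Z0 step].
have al' := admissible_chain (admissible_snd_list al).
have -> : predictor l = (fun x => nest Q (chain (snd_list l)) (x, 0)).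
  apply/funext => x; rewrite predictor_path//.
  rewrite -(nest_law measurable_joint Z0 step); last first.
    exact: (admissible_sub bmfun_snd_tests).
  by apply: eq_Rintegral => w _; rewrite snd_list_path_prod.
have c0 : continuous (fun x : S => (x, 0) : S * O).
  move=> x A [[B C] [/= Bx C0] BC]; rewrite /nbhs /=; apply: filterS Bx => s Bs.
  by apply: BC; split => //=; exact: nbhs_singleton.
have cn := nest_continuous Sc QC al'.
by move=> x A /cn nA; exact: (c0 x _ nA).
Qed.

(** The conditional independence of the increments enters here: the observation
    may start anywhere. *)
Lemma predictor_indep l x y : admissible tests l ->
  \int[P (x, y)]_w incr_prod l 0 w = predictor l x.
Proof.
move=> al.
have bi : bmfun (incr_prod l 0 : Omega -> R).
  apply: (@bmfun_incr_prod _ _ _ _ Omega id) => //.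
  by move=> t; exact: measurable_observation.
have -> : predictor l x = \int[P (x, 0)]_w incr_prod l 0 w by [].
apply: EFin_inj; rewrite -!expect_completed//; apply: CI.
  exists 1; split; first exact: num_real.
  by move=> M M1 w _; exact: le_trans (incr_prod_bound 0 w al) (ltW M1).
have GYE : sigma_gen [set t | 0 <= t] (@increment R S p) `<=` <<s FX P `|` GY P >>.
  move=> A GA; apply: sub_sigma_algebra; right=> mu.
  by apply: sub_sigma_algebra; left.
apply: bmfun_measurable; apply: (bmfun_gsub GYE).
have -> : incr_prod l 0 = (fun w : Omega => \prod_(x <- l) x.2 (increment x.1 w)).
  by apply: funext => w; apply: eq_bigr => z _; rewrite add0r.
pose GYT := g_sigma_algebraType (sigma_gen [set t | 0 <= t] (@increment R S p)).
suff bF t (g : borel O -> R) : 0 <= t -> tests g ->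
    bmfun ((fun w => g (increment t w)) : GYT -> R).
  exact: (bmfun_prod_admissible bF al).
move=> t0 /bmfun_test bg; apply: (bmfun_comp _ bg).
exact: (@sigma_gen_coordinate _ _ _ _ _ (@increment R S p) [set t | 0 <= t] t t0).
Qed.

(** Markov property at time [t], then independence of the increments from the
    current position of the observation. *)
Lemma predictor_past l z t A : admissible tests l -> 0 <= t ->
  past joint t A ->
  \int[P z]_w (\1_A w * predictor l (signal t w)) =
  \int[P z]_w (\1_A w * incr_prod l t w).
Proof.
move=> al t0 pA; case: FM => Q [QC Z0 step].
have bA : bmfun (\1_A : g_sigma_algebraType (past joint t) -> R).
  by apply: bmfun_indic; apply: sub_sigma_algebra.
have bl : bmfun (incr_prod l 0 : g_sigma_algebraType (whole joint) -> R).
  apply: (@bmfun_incr_prod _ _ _ _ (g_sigma_algebraType (whole joint)) id) => //.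
  apply: measurable_joint_observation => s s0; exact: sigma_gen_coordinate.
transitivity (\int[P z]_w (\1_A w * incr_prod l 0 (shift t w))); last first.
  by apply: eq_Rintegral => w _; rewrite incr_prod_shift.
rewrite (markov_shift measurable_joint Z0 step joint_shift z t0 bA bl).
by apply: eq_Rintegral => w _; rewrite predictor_indep.
Qed.

Lemma past_observation t : sigma_gen [set s | 0 <= s <= t] obs `<=` past joint t.
Proof.
apply: smallest_sub; first exact: smallest_sigma_algebra.
apply: bigcup_sub => s st _ [B mB <-]; rewrite setTI.
have -> : obs s @^-1` B = joint s @^-1` (snd @^-1` B) by [].
apply: sub_sigma_algebra; exists s => //; exists (snd @^-1` B); last by rewrite setTI.
by rewrite -[X in measurable X]setTI; exact: measurable_snd.
Qed.

Lemma predictor_law0 l kappa t A : admissible tests l -> 0 <= t ->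
  sigma_gen [set s | 0 <= s <= t] obs A ->
  \int[law0 P kappa]_w (\1_A w * predictor l (signal t w)) =
  \int[law0 P kappa]_w (\1_A w * incr_prod l t w).
Proof.
move=> al t0 /past_observation pA.
have mA : measurable A by exact: past_measurable measurable_joint _ _ pA.
have bp : bmfun (fun w : Omega => predictor l (signal t w)).
  exact: (bmfun_comp (@measurable_signal R S p t t0) (bmfun_predictor al)).
have bi : bmfun (incr_prod l t : Omega -> R).
  apply: (@bmfun_incr_prod _ _ _ _ Omega id) => //.
  by move=> s; exact: measurable_observation.
have bA : bmfun (\1_A : Omega -> R) by exact: bmfun_indic.
rewrite (expect_law0 P kappa (bmfunM bA bp)) (expect_law0 P kappa (bmfunM bA bi)).
by apply: eq_Rintegral => x _; exact: predictor_past.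
Qed.

End prediction.

(** * Observable functions are limits of predictors *)

Lemma integral_normal_linear (R : realType) d (T : measurableType d)
    (m : {measure set T -> \bar R}) : m setT = 1%E ->
  normal_linear (fun f : T -> R => \int[m]_x f x).
Proof.
move=> m1; split=> [f g bf bg|c f bf|g f M bg bf gM gf].
- exact: expectD.
- exact: expectZ.
- exact: (expect_bounded_cvg m1 bg bf gM gf).
Qed.

Lemma mean_image (R : realType) (T U : Type) (phi : T -> U) (L : (T -> R) -> R) :
  mean L -> mean (fun g : U -> R => L (g \o phi)).
Proof.
move=> [[LD LZ] L0 L1].
have bphi (g : U -> R) : bounded_funs g -> bounded_funs (g \o phi).
  by move=> [M gM]; exists M => z /=.
split=> [|g bg g0|//]; last by apply: L0 => [|z /=]; [exact: bphi|exact: g0].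
by split=> [g h bg bh|a g bg]; [apply: LD; exact: bphi|apply: LZ; exact: bphi].
Qed.

Lemma exists_dominating (R : realType) d (T : measurableType d)
    (k1 k2 : probability T R) :
  exists k : probability T R, k1 `<< k /\ k2 `<< k.
Proof.
have half0 : 0 <= 2^-1 :> R by [].
pose m : {measure set T -> \bar R} := mscale (NngNum half0) (measure_add k1 k2).
have mE A : m A = ((2^-1)%:E * (k1 A + k2 A))%E.
  by rewrite -measure_addE.
have m1 : m setT = 1%E.
  rewrite mE !probability_setT -EFinD -EFinM; congr _%:E.
  by rewrite mulVf.
have [k kE] := exists_probability m1; exists k.
have k0 A : k A = 0%E -> (k1 A = 0 /\ k2 A = 0)%E.
  rewrite [k A]kE mE => /eqP; rewrite mule_eq0 eqe invr_eq0 pnatr_eq0 /=.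
  by rewrite padde_eq0// => /andP[/eqP ? /eqP ?].
by split; apply/null_content_dominatesP => A mA /k0[].
Qed.

Section observability.
Context (R : realType) (S : completePseudoMetricType R) (p : nat).
Local Notation O := 'rV[R]_p.
Local Notation E := (borel S * borel O)%type.
Local Notation Omega := (canonical_space S O).
Local Notation obs := (@observation R S p).
Local Notation tests := (@test R p : set (borel O -> R)).
Local Notation GO := (sigma_gen [set t | 0 <= t] obs).
Implicit Type l : seq (R * (borel O -> R)).

Definition closed_indic : set (borel O -> R) :=
  [set phi | exists2 C : set O, closed C & phi = \1_C].

Lemma bmfun_closed_indic : closed_indic `<=` @bmfun R _ (borel O).
Proof.
move=> _ [C cC ->]; apply: bmfun_indic; rewrite -[C]setCK; apply: measurableC.
by apply: sub_sigma_algebra; exact: closed_openC.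
Qed.

Lemma observation_cylinders : GO = <<s cylinders obs closed_indic >>.
Proof.
apply: (@sigma_cylinders R _ (borel O) _ Omega obs closed_indic (@closed O)) => [||A cA].
- exact: bmfun_closed_indic.
- rewrite eqEsubset; split; apply: smallest_sub; try exact: smallest_sigma_algebra.
    move=> A oA; rewrite -[A]setCK; apply: (@measurableC _ (g_sigma_algebraType (@closed O))).
    by apply: sub_sigma_algebra; exact: open_closedC.
  move=> A cA; rewrite -[A]setCK; apply: (@measurableC _ (borel O)).
  by apply: sub_sigma_algebra; exact: closed_openC.
- by exists A.
Qed.

Lemma cylinder_approx l : admissible closed_indic l ->
  exists L : nat -> seq (R * (borel O -> R)), (forall n, admissible tests (L n)) /\
    forall w : Omega, \prod_(x <- L n) x.2 (obs x.1 w) @[n --> \oo] -->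
      \prod_(x <- l) x.2 (obs x.1 w).
Proof.
elim: l => [_|[t phi] l IH /= [t0 [C cC ->] /IH[L [aL Ll]]]].
  by exists (fun=> [::]); split => // w; exact: cvg_cst.
have [g [tg gC]] := test_approx cC; exists (fun n => (t, g n) :: L n); split => [n|w].
  by split; [exact: t0|exact: tg|exact: aL].
 rewrite big_cons; under eq_fun do rewrite big_cons.
by apply: cvgM => /=; [exact: gC|exact: Ll].
Qed.

Variable P : R.-pker E ~> Omega.
Hypotheses (Sc : compact [set: S]) (CI : cond_indep_increments P)
  (FM : feller_markov (E := E) (@C0 R (S * O)%type) P id (@joint R S p)).
Variables k1 k2 : probability (borel S) R.
Hypothesis k12 : forall l, admissible tests l ->
  \int[k1]_x predictor P l x = \int[k2]_x predictor P l x.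

Lemma observation_measurable : GO `<=` @measurable _ Omega.
Proof. by apply: sigma_gen_measurable => t; exact: measurable_observation. Qed.

Lemma expect_prod_law0 (k : probability (borel S) R) l : admissible tests l ->
  \int[law0 P k]_w \prod_(x <- l) x.2 (obs x.1 w) = \int[k]_x predictor P l x.
Proof.
move=> al; rewrite expect_law0; last first.
  exact: (bmfun_path_prod (Y := obs) (@bmfun_test R p) (@measurable_observation R S p) al).
by apply: eq_Rintegral => x _; rewrite (predictor_path FM).
Qed.

(** Integrals of predictors are expectations of products of test functions of the
    observations, and the indicators of cylinders with closed sides are limits of
    such products. *)
Lemma law0_observation A : GO A -> law0 P k1 A = law0 P k2 A.
Proof.
move=> GA; have mA := observation_measurable GA.
have nl (k : probability (borel S) R) : normal_linear
    ((fun f => \int[law0 P k]_w f w) : (g_sigma_algebraType GO -> R) -> R).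
  apply: (normal_linear_sub observation_measurable); apply: integral_normal_linear.
  exact: probability_setT.
have bA : bmfun (\1_A : g_sigma_algebraType GO -> R).
  by apply: bmfun_indic; exact: sub_sigma_algebra.
have GE : @measurable _ (g_sigma_algebraType GO) = <<s cylinders obs closed_indic >>.
  by rewrite -observation_cylinders [LHS]sigma_algebra_id//; exact: smallest_sigma_algebra.
suff : \int[law0 P k1]_w \1_A w = \int[law0 P k2]_w \1_A w :> R.
  rewrite !expect_indic// => k12A.
  by rewrite -[LHS]fineK ?fin_num_measure// -[RHS]fineK ?fin_num_measure// k12A.
refine (normal_linear_ext_pi (nl k1) (nl k2) GE
  (@cylinders_setI _ _ _ _ _ obs _) (@cylinders_setT _ _ _ _ _ obs _) _ bA).
move=> {GA mA bA} {}A [l al Al].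
have [L [aL Ll]] := cylinder_approx al.
have lim (k : probability (borel S) R) :
    \int[k]_x predictor P (L n) x @[n --> \oo] --> \int[law0 P k]_w \1_A w.
  under eq_fun do rewrite -expect_prod_law0//.
  apply: (@expect_bounded_cvg _ _ _ (law0 P k) _ _ _ 1).
  - exact: probability_setT.
  - by move=> n; exact: (bmfun_path_prod (Y := obs) (@bmfun_test R p) (@measurable_observation R S p) (aL n)).
  - rewrite (_ : \1_A = fun w => \prod_(x <- l) x.2 (obs x.1 w)); last exact/funext.
    exact: (bmfun_path_prod (Y := obs) bmfun_closed_indic (@measurable_observation R S p) al).
  - by move=> n w; exact: (test_prod_bound (obs^~ w)).
  - by move=> w; rewrite Al; exact: Ll.
apply: cvg_unique (lim k1) _ => //.
rewrite (_ : (fun n => _) = (fun n => \int[k2]_x predictor P (L n) x)); first exact: lim.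
by apply/funext => n; exact: k12.
Qed.

(** Both completions see an augmented event as the same event of the uncompleted
    filtration: it is chosen for a law that dominates both. *)
Lemma predictors_obs_equiv : obs_equiv P k1 k2.
Proof.
move=> A FA; have [k [k1k k2k]] := exists_dominating k1 k2.
have [A' [GA' nA]] := augmentation_approx (P := law0 P k)
  (smallest_sigma_algebra _ _) (@subset_refl _ _) (FA (k \x dirac (0%R : borel O))%E).
have mA' := observation_measurable GA'.
have neg (k' : probability (borel S) R) : k' `<< k ->
    completed (law0 P k') A = law0 P k' A'.
  move=> k'k; apply: completed_symdiff => //.
  have [B [mB B0 AB]] := nA; exists B; split => //.
  by have /null_content_dominatesP := @law0_dominates _ _ _ P _ _ k'k; exact.
by rewrite !neg// law0_observation.
Qed.

End observability.

Section approximation.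
Context (R : realType) (S : completePseudoMetricType R) (p : nat).
Local Notation O := 'rV[R]_p.
Local Notation E := (borel S * borel O)%type.
Local Notation Omega := (canonical_space S O).
Local Notation obs := (@observation R S p).
Local Notation tests := (@test R p : set (borel O -> R)).
Local Notation GO := (sigma_gen [set t | 0 <= t] obs).
Variable P : R.-pker E ~> Omega.
Hypotheses (Sc : compact [set: S]) (CI : cond_indep_increments P)
  (FM : feller_markov (E := E) (@C0 R (S * O)%type) P id (@joint R S p)).

(** [zeta t] is an observable quantity with the same conditional expectation as
    [v] of the signal at time [t], given the observations up to [t]; it does not
    depend on the initial law. *)
Definition predicts (v : S -> R) (zeta : R -> Omega -> R) : Prop :=
  [/\ continuous v, exists C, forall t w, `|zeta t w| <= C,
      forall t, 0 <= t -> bmfun (zeta t : g_sigma_algebraType GO -> R),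
      forall t w, 0 <= t -> zeta s w @[s --> t^'+] --> zeta t w &
      forall kappa t A, 0 <= t -> sigma_gen [set s | 0 <= s <= t] obs A ->
        \int[law0 P kappa]_w (\1_A w * v (signal t w)) =
        \int[law0 P kappa]_w (\1_A w * zeta t w)].

Definition predicted : set (S -> R) := [set v | exists zeta, predicts v zeta].

Lemma predicted_predictor l : admissible tests l -> predicted (predictor P l).
Proof.
move=> al; exists (incr_prod l); split.
- exact: predictor_continuous.
- by exists 1 => t w; exact: incr_prod_bound.
- by move=> t t0; exact: bmfun_incr_prod_observation.
- by move=> t w t0; exact: incr_prod_right_continuous.
- by move=> kappa t A t0 GA; exact: predictor_law0.
Qed.

Lemma predicted_cst c : predicted (cst c).
Proof.
exists (fun _ _ => c); split => //.
- by move=> x; exact: cvg_cst.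
- by exists `|c|.
- by move=> t _; exact: bmfun_cst.
- by move=> t w _; exact: cvg_cst.
Qed.

Let past_bmfun t A : sigma_gen [set s | 0 <= s <= t] obs A -> bmfun (\1_A : Omega -> R).
Proof.
move=> GA; apply: bmfun_indic; apply: observation_measurable.
by move: GA; apply: sigma_gen_sub => s /= /andP[].
Qed.

Lemma predicted_comb (a : R) v v' : predicted v -> predicted v' ->
  predicted (fun x => a * v x + v' x).
Proof.
move=> [z [cv [C zC] bz rz vz]] [z' [cv' [C' zC'] bz' rz' vz']].
exists (fun t w => a * z t w + z' t w); split.
- move=> x; apply: cvgD; last exact: cv'.
  by apply: cvgM; [exact: cvg_cst|exact: cv].
- exists (`|a| * C + C') => t w; rewrite (le_trans (ler_normD _ _))// lerD//.
  by rewrite normrM ler_wpM2l.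
- by move=> t t0; apply: bmfunD; [apply: bmfunZ; exact: bz|exact: bz'].
- move=> t w t0; apply: cvgD; last exact: rz'.
  by apply: cvgM; [exact: cvg_cst|exact: rz].
- move=> kappa t A t0 GA; have bA := past_bmfun GA.
  have P1 : law0 P kappa setT = 1%E by exact: probability_setT.
  have lin (g g' : Omega -> R) : bmfun g -> bmfun g' ->
      \int[law0 P kappa]_w (\1_A w * (a * g w + g' w)) =
      a * \int[law0 P kappa]_w (\1_A w * g w) + \int[law0 P kappa]_w (\1_A w * g' w).
    move=> bg bg'; under eq_Rintegral do rewrite mulrDr mulrCA.
    have bAg := bmfunM bA bg; have bAg' := bmfunM bA bg'.
    by rewrite (expectD P1 (bmfunZ a bAg) bAg') (expectZ P1 a bAg).
  rewrite lin; [|exact: bmfun_signal..].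
  rewrite lin; [|exact: (bmfun_sub (@observation_measurable R S p)) (bz t t0)
                |exact: (bmfun_sub (@observation_measurable R S p)) (bz' t t0)].
  by rewrite vz// vz'.
Qed.

(** If no predicted function were close to [f], the Hahn-Banach theorem would give
    two initial laws that agree on all predictors, so that the observations do not
    distinguish them, but not on [f]. *)
Lemma observable_approx f (e : R) : observable P f -> 0 < e ->
  exists2 v, predicted v & forall x, `|f x - v x| <= e.
Proof.
move=> [cf _ fE] e0; pose G (z : S * S) := f z.1 - f z.2.
pose W := [set w : S * S -> R | exists2 v, predicted v & w = fun z => v z.1 - v z.2].
have [[_ [v Vv ->] H]|H] := pselect (exists2 w, W w & forall z, G z + w z < e).
  pose c := f point + v point; exists (fun x => - 1 * v x + c).
    by apply: predicted_comb => //; exact: predicted_cst.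
  move=> x; have := H (x, point); have := H (point, x).
  by rewrite /G /c /= ler_norml => *; apply/andP; split; lra.
have bW (v : S -> R) : continuous v -> bounded_funs (fun z : S * S => v z.1 - v z.2).
  move=> /(compact_continuous_bounded Sc)[M vM]; exists (M + M) => z.
  by rewrite (le_trans (ler_normB _ _))// lerD.
have pc v : predicted v -> continuous v by move=> [z []].
have [L [mL LW LG]] : exists L, [/\ mean L, forall w, W w -> L w = 0 & e <= L G].
  apply: (mean_annihilator (W := W) (z0 := (point, point))).
  - by move=> _ [v Vv ->]; exact: bW (pc _ Vv).
  - by exists (cst 0); [exact: predicted_cst|apply/funext => z; rewrite /cst subrr].
  - move=> _ _ [v Vv ->] [v' Vv' ->].
    exists (fun x => 1 * v x + v' x); first exact: predicted_comb.
    by apply/funext => z; rewrite fctE; lra.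
  - move=> a _ [v Vv ->]; exists (fun x => a * v x + cst 0 x).
      by apply: predicted_comb => //; exact: predicted_cst.
    by apply/funext => z; rewrite fctE /= addr0 addr0 -mulrBr.
  - by move=> _ [v _ ->]; rewrite subrr.
  - exact: bW cf.
  - move=> w Ww; apply: contrapT => nz; apply: H; exists w => // z.
    by rewrite ltNge; apply/negP => ez; apply: nz; exists z.
have [m1 m1L] := mean_represented (mean_image fst mL) Sc.
have [m2 m2L] := mean_represented (mean_image snd mL) Sc.
have m12 (v : S -> R) : continuous v ->
    \int[m1]_x v x - \int[m2]_x v x = L (fun z => v z.1 - v z.2).
  move=> cv; rewrite m1L// m2L//; have [[LD LZ] _ _] := mL.
  have [M vM] := compact_continuous_bounded Sc cv.
  have b1 : bounded_funs (v \o fst : S * S -> R) by exists M => z /=.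
  have b2 : bounded_funs (v \o snd : S * S -> R) by exists M => z /=.
  rewrite -mulN1r -LZ// -LD//; last exact: bounded_funsZ.
  by congr L; apply/funext => z; rewrite scaleN1r.
have : obs_equiv P m1 m2.
  apply: predictors_obs_equiv => // l al; apply/eqP; rewrite -subr_eq0.
  rewrite m12; last exact: predictor_continuous.
  by apply/eqP/LW; exists (predictor P l) => //; exact: predicted_predictor.
move=> /fE/eqP; rewrite -subr_eq0 m12// => /eqP LG0.
by move: LG; rewrite /G LG0 leNgt e0.
Qed.

End approximation.

(** * Comparison of the filters *)

(** Over the event [Z > M + 1 / n.+1], the integrals of [Z] and [g] can only agree
    if this event is null. *)
Lemma condexp_le (R : realType) d (T : measurableType d) (m : {measure set T -> \bar R})
    (G : set (set T)) (g Z : T -> R) (M : R) : m setT = 1%E ->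
  sigma_algebra setT G -> G `<=` @measurable _ T -> 0 <= M -> bmfun g ->
  (forall x, g x <= M) -> measurable_fun setT (Z : g_sigma_algebraType G -> R) ->
  (forall A, G A -> \int[m]_(x in A) (Z x)%:E = \int[m]_(x in A) (g x)%:E)%E ->
  {ae m, forall x, Z x <= M}.
Proof.
move=> m1 sG Gm M0 bg gM mZ ZE.
pose A n := [set x | M + n.+1%:R^-1 < Z x].
have GA n : G (A n).
  have := measurable_superlevel (M + n.+1%:R^-1) mZ.
  by rewrite /measurable /= sigma_algebra_id.
have mA n := Gm _ (GA n).
have mZ' : measurable_fun setT Z.
  by have := measurableT_comp mZ (measurable_id_sub Gm).
suff A0 n : m (A n) = 0%E.
  apply: (@negligibleS _ _ _ _ (\bigcup_n A n)); last first.
    by apply: negligible_bigcup => n; exists (A n); split.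
  move=> x /= /negP; rewrite -ltNge => MZ.
  have [n nZ] : exists n : nat, n.+1%:R^-1 < Z x - M.
    have ZM : 0 < Z x - M by rewrite subr_gt0.
    exact: filter_ex (near_infty_natSinv_lt (PosNum ZM)).
  by exists n => //; rewrite /A /= -ltrBrDl.
have n0 : 0 < n.+1%:R^-1 :> R by [].
have mfin : m (A n) \is a fin_num.
  by rewrite ge0_fin_numE//; exact: prob_lty.
have : ((M + n.+1%:R^-1)%:E * m (A n) <= M%:E * m (A n))%E.
  rewrite -!integral_cst//; apply: (@le_trans _ _ (\int[m]_(x in A n) (Z x)%:E)%E).
    apply: ge0_le_integral => //.
    - by move=> x _; rewrite lee_fin addr_ge0// ltW.
    - by apply/measurable_EFinP; exact: measurable_funTS.
    - by move=> x Ax; rewrite lee_fin ltW.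
  rewrite ZE//; apply: le_integral => //.
  - exact: (bmfun_integrable m1 (mA n) bg).
  - exact: (bmfun_integrable m1 (mA n) (bmfun_cst _ M)).
  - by move=> x _; rewrite lee_fin.
rewrite -(fineK mfin) -!EFinM lee_fin => le; congr _%:E; apply/eqP.
rewrite eq_le fine_ge0 ?andbT//.
by move: le; rewrite mulrDl gerDl pmulr_rle0.
Qed.

Section augmented_filtration.
Context (R : realType) (S : completePseudoMetricType R) (p : nat).
Local Notation O := 'rV[R]_p.
Local Notation E := (borel S * borel O)%type.
Local Notation Omega := (canonical_space S O).
Local Notation obs := (@observation R S p).
Local Notation GO := (sigma_gen [set t | 0 <= t] obs).
Local Notation Gt t := (sigma_gen [set s | 0 <= s <= t] obs).
Variable P : R.-pker E ~> Omega.

Lemma FYt_sigma_algebra t : sigma_algebra setT (FYt P t).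
Proof.
pose G u (mu : probability (borel S * borel O)%type R) := Gt u `|` (law P mu).-negligible.
have sG u mu : sigma_algebra setT <<s G u mu >> by exact: smallest_sigma_algebra.
split.
- by move=> u tu mu; have [] := sG u mu.
- by move=> A FA u tu mu; have [_ GC _] := sG u mu; apply: GC; exact: FA.
- by move=> A FA u tu mu; have [_ _ GU] := sG u mu; apply: GU => n; exact: FA.
Qed.

Lemma FYt_mono s t : s <= t -> FYt P s `<=` FYt P t.
Proof. by move=> st A FA u tu; apply: FA; exact: le_lt_trans tu. Qed.

Lemma past_FYt t : Gt t `<=` FYt P t.
Proof.
move=> A GA u tu mu; apply: sub_sigma_algebra; left.
apply: sigma_gen_sub GA => s /= /andP[-> /=] /le_trans; apply; exact: ltW.
Qed.

Lemma observation_terminal : GO `<=` <<s terminal (FYt P) >>.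
Proof.
apply: smallest_sub; first exact: smallest_sigma_algebra.
apply: bigcup_sub => t /= t0 B [C mC <-]; apply: sub_sigma_algebra; exists t => //.
apply: past_FYt; apply: sub_sigma_algebra; exists t; first by rewrite /= t0 lexx.
by exists C.
Qed.

Lemma FYt_approx (kappa : probability (borel S) R) t u A : t < u -> FYt P t A ->
  exists A', Gt u A' /\ (law0 P kappa).-negligible (symdiff A A').
Proof.
move=> tu FA; apply: (augmentation_approx (N := (law0 P kappa).-negligible)) => //.
  exact: smallest_sigma_algebra.
exact: (FA u tu (kappa \x dirac (0%R : borel O))%E).
Qed.

Lemma FYt_enlarged (kappa : probability (borel S) R) t :
  FYt P t `<=` @measurable _ (enlargedT (law0 P kappa).-negligible).
Proof.
move=> A FA; have := FA (t + 1) _ (kappa \x dirac (0%R : borel O))%E.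
rewrite ltrDl ltr01 => /(_ isT); apply: sub_sigma_algebra2 => B [GB|NB]; last by right.
left; apply: observation_measurable; move: GB; apply: sigma_gen_sub => s /= /andP[].
by [].
Qed.

End augmented_filtration.

Section truncation.
Context (R : realType).

(** Chosen so that a bounded version of a filter is measurable for the same
    sigma-algebra. *)
Definition truncated (M r : R) : R := r * \1_[set r | `|r| <= M] r.

Lemma truncated_bound M r : 0 <= M -> `|truncated M r| <= M.
Proof.
move=> M0; rewrite /truncated indicE; case: (boolP (r \in _)) => [/set_mem/=|_].
  by rewrite mulr1.
by rewrite mulr0 normr0.
Qed.

Lemma truncated_id M r : `|r| <= M -> truncated M r = r.
Proof. by move=> rM; rewrite /truncated indicE mem_set ?mulr1. Qed.

Lemma measurable_truncated M : measurable_fun setT (truncated M).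
Proof.
apply: measurable_funM => //; apply: measurable_indic.
have := measurable_superlevel M (@normr_measurable R setT).
move=> /measurableC; congr measurable.
by apply/seteqP; split => r /= Mr; [move/negP: Mr|apply/negP]; rewrite -leNgt.
Qed.

End truncation.

Lemma cvg_at_right_seq (R : realType) (g : R -> R) (t l : R) :
  g s @[s --> t^'+] --> l -> g (t + n.+1%:R^-1) @[n --> \oo] --> l.
Proof.
move=> gl; apply: (cvg_comp (fun n : nat => t + n.+1%:R^-1) g _ gl).
move=> A [e /= e0 H]; have := near_infty_natSinv_lt (PosNum e0).
apply: filterS => n /= ne; apply: H => /=; last by rewrite ltrDl.
by rewrite opprD addNKr normrN ger0_norm.
Qed.

Section filters.
Context (R : realType) (S : completePseudoMetricType R) (p : nat).
Local Notation O := 'rV[R]_p.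
Local Notation E := (borel S * borel O)%type.
Local Notation Omega := (canonical_space S O).
Local Notation obs := (@observation R S p).
Local Notation GO := (sigma_gen [set t | 0 <= t] obs).
Variables (P : R.-pker E ~> Omega) (Sc : compact [set: S]).
Variables nu kappa : probability (borel S) R.
Local Notation N := (law0 P nu).-negligible.
Hypothesis NK : N `<=` (law0 P kappa).-negligible.

Let K1 : law0 P kappa setT = 1%E. Proof. exact: probability_setT. Qed.

Local Notation PK := (enlarged NK).

(** Each event of [FYt t] is almost surely an event of the past up to [u], for all
    [u > t]; then [u] decreases to [t]. *)
Lemma predicts_FYt v zeta t A : predicts P v zeta -> 0 <= t -> FYt P t A ->
  \int[PK]_w (\1_A w * v (signal t w)) = \int[PK]_w (\1_A w * zeta t w).
Proof.
move=> [cv [C zC] bz rz vz] t0 FA.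
have mA : measurable (A : set (enlargedT N)) by exact: FYt_enlarged FA.
have bA : bmfun (\1_A : enlargedT N -> R) by exact: bmfun_indic.
have bs u : 0 <= u -> bmfun ((fun w => v (signal u w)) : enlargedT N -> R).
  by move=> u0; apply: bmfun_enlarged; exact: bmfun_signal.
have bz' u : 0 <= u -> bmfun (zeta u : Omega -> R).
  by move=> u0; apply: bmfun_sub (bz u u0); exact: observation_measurable.
have bzh u : 0 <= u -> bmfun (zeta u : enlargedT N -> R).
  by move=> u0; apply: bmfun_enlarged; exact: bz'.
have later u : t < u -> \int[PK]_w (\1_A w * v (signal u w)) =
    \int[PK]_w (\1_A w * zeta u w).
  move=> tu; have u0 : 0 <= u by rewrite (le_trans t0)// ltW.
  have [A' [GA' nA]] := FYt_approx kappa tu FA.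
  have mA' : measurable A'.
    apply: observation_measurable; move: GA'.
    by apply: sigma_gen_sub => s /= /andP[].
  have bA' : bmfun (\1_A' : Omega -> R) by exact: bmfun_indic.
  have AA' (g : Omega -> R) : bmfun g ->
      \int[PK]_w (\1_A w * g w) = \int[law0 P kappa]_w (\1_A' w * g w).
    move=> bg; rewrite -(expect_enlarged K1 NK (bmfunM bA' bg)).
    apply: expect_ae.
    - by apply: bmfunM => //; exact: bmfun_enlarged.
    - by apply: bmfun_enlarged; exact: bmfunM.
    - apply: enlarged_ae; have := negligible_symdiff nA.
      by apply: filterS => w ->.
  by rewrite AA'; [rewrite AA'; [exact: vz|exact: bz']|exact: bmfun_signal].
have lim (g : R -> Omega -> R) M : (forall u, 0 <= u -> bmfun (g u : enlargedT N -> R)) ->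
    (forall u w, `|g u w| <= M) -> (forall w, g s w @[s --> t^'+] --> g t w) ->
    \int[PK]_w (\1_A w * g (t + n.+1%:R^-1) w) @[n --> \oo] -->
    \int[PK]_w (\1_A w * g t w).
  move=> bg gM rg; apply: (@expect_bounded_cvg _ _ _ PK _ _ _ M).
  - exact: enlarged_setT.
  - by move=> n; apply: bmfunM => //; apply: bg; rewrite addr_ge0.
  - by apply: bmfunM => //; exact: bg.
  - move=> n w; rewrite normrM -[leRHS]mul1r ler_pM// indicE.
    by case: (_ \in _); rewrite ?normr1 ?normr0.
  - move=> w; apply: cvgM; first exact: cvg_cst.
    exact: (@cvg_at_right_seq _ (g^~ w) _ _ (rg w)).
have [M vM] := compact_continuous_bounded Sc cv.
have lim1 := lim _ M bs (fun u w => vM _) _.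
have lim2 := lim _ C bzh zC (fun w => rz t w t0).
apply: cvg_unique (lim1 _) _ => //.
  move=> w; apply: continuous_cvg; first exact: cv.
  by have [wr _] := path_cadlag w.1; exact: wr.
rewrite (_ : (fun n => _) = (fun n => \int[PK]_w (\1_A w * zeta (t + n.+1%:R^-1) w))).
  exact: lim2.
by apply/funext => n; apply: later; rewrite ltrDl.
Qed.

Let FYt_completed t A : FYt P t A ->
  measurable (A : set (caratheodory_type ((law0 P kappa)^*)%mu)).
Proof.
move=> /FYt_enlarged mA; have := measurable_to_enlarged NK measurableT (mA nu).
by rewrite setTI preimage_id.
Qed.

Let completed_integrable t (f : S -> R) : 0 <= t -> continuous f ->
  (completed (law0 P kappa)).-integrable setT (fun w => (f (signal t w))%:E).
Proof.
move=> t0 cf.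
have mid : measurable_fun setT
    (id : caratheodory_type ((law0 P kappa)^*)%mu -> Omega).
  by move=> _ A mA; rewrite setTI preimage_id; exact: caratheodory_measurable_mu_ext.
have c1 : completed (law0 P kappa) setT = 1%E.
  by rewrite -K1; exact: measurable_mu_extE.
exact: (bmfun_integrable c1 measurableT (bmfun_comp mid (@bmfun_signal R S p t f Sc t0 cf))).
Qed.

Lemma is_filter_opp f pi : continuous f -> is_filter P kappa f pi ->
  is_filter P kappa (fun x => - f x) (fun t w => - pi t w).
Proof.
move=> cf [ce cl]; split; last first.
  move: cl; apply: filterS => w [wr wl]; split=> t t0; first by apply: cvgN; exact: wr.
  by have [l tl] := wl t t0; exists (- l); exact: cvgN.
move=> t t0; have [mp ip piE] := ce t t0; split.
- exact: measurable_funN.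
- by have := integrableN ip.
- move=> A FA; have mA := FYt_completed FA.
  have opp (g : Omega -> R) : (completed (law0 P kappa)).-integrable setT (EFin \o g) ->
      (\int[completed (law0 P kappa)]_(w in A) (- g w)%:E =
       (-1)%:E * \int[completed (law0 P kappa)]_(w in A) (g w)%:E)%E.
    move=> ig; rewrite -integralZl//; last exact: integrableS ig.
    by apply: eq_integral => w _; rewrite -EFinM mulN1r.
  by rewrite opp// piE// opp//; exact: completed_integrable.
Qed.

Let measurable_filter t (Z : Omega -> R) :
  measurable_fun setT (Z : g_sigma_algebraType (FYt P t) -> R) ->
  measurable_fun setT (Z : enlargedT N -> R).
Proof.
move=> mZ _ B mB; have := mZ measurableT B mB; rewrite setTI.
by rewrite {1}/measurable /= (sigma_algebra_id (FYt_sigma_algebra P t)) => /(@FYt_enlarged _ _ _ P nu t).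
Qed.

Lemma filter_integral f pi t A : continuous f -> is_filter P kappa f pi -> 0 <= t ->
  FYt P t A ->
  (\int[PK]_(w in A) (pi t w)%:E = \int[PK]_(w in A) (f (signal t w))%:E)%E.
Proof.
move=> cf [ce _] t0 FA; have [mp ip piE] := ce t t0.
rewrite -(integral_enlarged NK (@FYt_enlarged _ _ _ P nu t _ FA) (measurable_filter mp) ip).
rewrite -(integral_enlarged NK (@FYt_enlarged _ _ _ P nu t _ FA)) ?piE//.
- by apply: bmfun_measurable; apply: bmfun_enlarged; exact: bmfun_signal.
- exact: completed_integrable.
Qed.

(** Almost surely the bound holds at all dyadic times, hence at all times by
    right-continuity. *)
Lemma filter_le (f : S -> R) pi M : 0 <= M -> continuous f -> (forall x, f x <= M) ->
  is_filter P kappa f pi ->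
  {ae PK, forall w, forall t, 0 <= t -> pi t w <= M}.
Proof.
move=> M0 cf fM fpi; have [ce cl] := fpi.
have one t : 0 <= t -> {ae PK, forall w, pi t w <= M}.
  move=> t0; have [mp _ _] := ce t t0.
  apply: (condexp_le (enlarged_setT K1 NK) (FYt_sigma_algebra P t) (@FYt_enlarged _ _ _ P nu t) M0
    (bmfun_enlarged N (@bmfun_signal R S p t f Sc t0 cf)) (fun w => fM _) mp).
  by move=> A FA; exact: filter_integral.
have all : {ae PK, forall w, forall i n : nat, pi (0 + i%:R / 2 ^+ n) w <= M}.
  apply: ae_foralln => i; apply: ae_foralln => n; apply: one.
  by rewrite add0r divr_ge0// exprn_ge0.
have rc := enlarged_ae NK cl.
have aeF := ae_filter_ringOfSetsType PK.
apply: filterS2 all rc => w wM [wr _] t t0.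
exact: (right_continuous_le (lexx 0) wr wM).
Qed.

Lemma filter_truncated (f : S -> R) pi M : 0 <= M -> continuous f ->
  (forall x, `|f x| <= M) -> is_filter P kappa f pi ->
  {ae PK, forall w, forall t, 0 <= t -> truncated M (pi t w) = pi t w}.
Proof.
move=> M0 cf fM fpi.
have up := filter_le M0 cf (fun x => le_trans (ler_norm _) (fM x)) fpi.
have lo : {ae PK, forall w, forall t, 0 <= t -> - pi t w <= M}.
  apply: (filter_le M0 _ _ (is_filter_opp cf fpi)).
    by move=> x; apply: cvgN; exact: cf.
  by move=> x; rewrite (le_trans (ler_norm _))// normrN.
have aeF := ae_filter_ringOfSetsType PK.
apply: filterS2 up lo => w uw lw t t0; apply: truncated_id.
by rewrite ler_norml uw// andbT lerNl lw.
Qed.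

Lemma bmfun_truncated (f : S -> R) pi M t : 0 <= M -> is_filter P kappa f pi -> 0 <= t ->
  bmfun ((fun w => truncated M (pi t w)) : g_sigma_algebraType (FYt P t) -> R).
Proof.
move=> M0 [ce _] t0; have [mp _ _] := ce t t0; split; last first.
  by exists M => w; exact: truncated_bound.
exact: (measurableT_comp (measurable_truncated M) mp).
Qed.

Lemma expect_truncated (f : S -> R) pi M t A : 0 <= M -> continuous f ->
  (forall x, `|f x| <= M) -> is_filter P kappa f pi -> 0 <= t -> FYt P t A ->
  \int[PK]_w (\1_A w * truncated M (pi t w)) =
  \int[PK]_w (\1_A w * f (signal t w)).
Proof.
move=> M0 cf fM fpi t0 FA; have mA := @FYt_enlarged _ _ _ P nu t _ FA.
have [ce _] := fpi; have [mp _ _] := ce t t0.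
rewrite -!expect_in//; congr fine; rewrite -(filter_integral cf fpi t0 FA).
apply: ae_eq_integral => //.
- apply/measurable_EFinP/measurable_funTS.
  exact: measurable_filter (bmfun_measurable (bmfun_truncated M0 fpi t0)).
- by apply/measurable_EFinP/measurable_funTS; exact: measurable_filter mp.
- have := filter_truncated M0 cf fM fpi; have aeF := ae_filter_ringOfSetsType PK.
  by apply: filterS => w -> .
Qed.

End filters.

Lemma dominates_negligible (R : realType) d (T : measurableType d)
    (m1 m2 : {measure set T -> \bar R}) : m1 `<< m2 ->
  m2.-negligible `<=` m1.-negligible.
Proof.
move=> /null_content_dominatesP m12 A [B [mB B0 AB]].
by exists B; split => //; exact: m12.
Qed.

Section comparison.
Context (R : realType) (S : completePseudoMetricType R) (p : nat).
Local Notation O := 'rV[R]_p.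
Local Notation E := (borel S * borel O)%type.
Local Notation Omega := (canonical_space S O).
Variables (P : R.-pker E ~> Omega) (Sc : compact [set: S]).
Variables (mu nu : probability (borel S) R) (munu : mu `<< nu).
Local Notation N := (law0 P nu).-negligible.

Let NM : N `<=` (law0 P mu).-negligible.
Proof. exact: dominates_negligible (@law0_dominates _ _ _ P _ _ munu). Qed.

Let NN : N `<=` N. Proof. exact: subset_refl. Qed.

Let M1 : law0 P mu setT = 1%E. Proof. exact: probability_setT. Qed.
Let N1 : law0 P nu setT = 1%E. Proof. exact: probability_setT. Qed.

Let enlarged_dominates : enlarged NM `<< enlarged NN.
Proof.
apply/null_content_dominatesP => A mA A0.
have : {ae enlarged NN, forall w, ~ A w} by exists A; split => // w /= /contrapT.
move=> /ae_of_enlarged/NM/(enlarged_ae NM)[B [mB B0 AB]].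
apply/eqP; rewrite -measure_le0 -[X in (_ <= X)%E]B0.
by apply: le_measure; rewrite ?inE// => w Aw; apply: AB; exact.
Qed.

(** Extended to the sigma-algebra enlarged by the null sets of [law0 P nu], both
    laws and the filters truncated at a bound of [f] fall under [merging_as]. *)
Lemma one_sided_merging (f : S -> R) pi_mu pi_nu (e : R) : continuous f ->
  (exists2 v, predicted P v & forall x, `|f x - v x| <= e) ->
  is_filter P mu f pi_mu -> is_filter P nu f pi_nu -> 0 < e ->
  {ae law0 P mu, forall w, exists2 u, 0 <= u &
    forall t, u <= t -> pi_mu t w - pi_nu t w <= 4 * e}.
Proof.
move=> cf [v [zeta vz] fv] fmu fnu e0; have [cv [C zC] bz rz _] := vz.
have [M fM] := compact_continuous_bounded Sc cf.
have M0 : 0 <= M by exact: le_trans (normr_ge0 _) (fM point).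
have tmu := filter_truncated Sc NM M0 cf fM fmu.
have tnu : {ae enlarged NM, forall w, forall t, 0 <= t ->
    truncated M (pi_nu t w) = pi_nu t w}.
  exact: (dominates_negligible enlarged_dominates (filter_truncated Sc NN M0 cf fM fnu)).
have rmu := enlarged_ae NM fmu.2.
have rnu : {ae enlarged NM, forall w, cadlag (pi_nu^~ w)}.
  exact: (dominates_negligible enlarged_dominates (enlarged_ae NN fnu.2)).
have bs (g : S -> R) : continuous g -> forall t, 0 <= t ->
    bmfun ((fun w => g (signal t w)) : enlargedT N -> R).
  by move=> cg t t0; apply: bmfun_enlarged; exact: bmfun_signal.
have aeF := ae_filter_ringOfSetsType (enlarged NM).
have H := @merging_as R _ (enlargedT N) (FYt P) _ _ _ (enlarged NM) (enlarged NN) (enlarged_setT M1 NM)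
  (enlarged_setT N1 NN) enlarged_dominates e (Num.max M C) (fun t w => f (signal t w))
  (fun t w => v (signal t w)) zeta (fun t w => truncated M (pi_mu t w))
  (fun t w => truncated M (pi_nu t w)) e0 (bs f cf) (bs v cv).
have {H} : {ae enlarged NM, forall w, exists2 u, 0 <= u & forall t, u <= t ->
    truncated M (pi_mu t w) - truncated M (pi_nu t w) <= 4 * e}.
  apply: H => //.
  - by move=> t _; exact: FYt_enlarged.
  - by move=> t _; exact: FYt_sigma_algebra.
  - by move=> s t _; exact: FYt_mono.
  - move=> t t0; apply: (bmfun_gsub (@observation_terminal R S p P)); exact: bz.
  - by move=> t w _; rewrite (le_trans (zC t w))// le_max lexx orbT.
  - by move=> t t0; exact: (bmfun_truncated M0 fmu t0).
  - by move=> t t0; exact: (bmfun_truncated M0 fnu t0).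
  - by move=> t w _; rewrite (le_trans (truncated_bound _ M0))// le_max lexx.
  - by move=> t A t0 FA; exact: (expect_truncated Sc NM M0 cf fM fmu t0 FA).
  - by move=> t A t0 FA; exact: (expect_truncated Sc NN M0 cf fM fnu t0 FA).
  - by move=> t A t0 FA; exact: (predicts_FYt Sc NM vz t0 FA).
  - by move=> t A t0 FA; exact: (predicts_FYt Sc NN vz t0 FA).
  - have tt : {ae enlarged NM, forall w, forall t, 0 <= t ->
        truncated M (pi_mu t w) - truncated M (pi_nu t w) = pi_mu t w - pi_nu t w}.
      by apply: filterS2 tmu tnu => w tm tn t t0; rewrite tm// tn.
    have rr : {ae enlarged NM, forall w, forall t, 0 <= t ->
        pi_mu s w - pi_nu s w @[s --> t^'+] --> pi_mu t w - pi_nu t w}.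
      by apply: filterS2 rmu rnu => w [rm _] [rn _] t t0; apply: cvgB; [exact: rm|exact: rn].
    apply: filterS2 tt rr => w ttw rrw t t0; rewrite ttw//.
    apply: cvg_trans (rrw t t0); apply: near_eq_cvg.
    have := nbhs_right_gt t; apply: filterS => s ts /=.
    by rewrite ttw// (le_trans t0)// ltW.
have tt : {ae enlarged NM, forall w, forall t, 0 <= t ->
    truncated M (pi_mu t w) - truncated M (pi_nu t w) = pi_mu t w - pi_nu t w}.
  by apply: filterS2 tmu tnu => w tm tn t t0; rewrite tm// tn.
move=> H; apply: (ae_of_enlarged (NP := NM)).
apply: filterS2 tt H => w ttw [u u0 uH]; exists u => // t ut.
by rewrite -ttw ?uH// (le_trans u0).
Qed.

End comparison.

Theorem theorem4p4 (R : realType) (S : completePseudoMetricType R) (p : nat)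
    (P : R.-pker (borel S * borel 'rV[R]_p)%type ~>
           canonical_space S 'rV[R]_p)
    (Spolish : polish S) (Scompact : compact [set: S])
    (model : filtering_model P)
    (mu nu : probability (borel S) R) (munu : mu `<< nu)
    (f : S -> R) (fO : observable P f)
    (pi_mu pi_nu : R -> canonical_space S 'rV[R]_p -> R)
    (pi_muE : is_filter P mu f pi_mu) (pi_nuE : is_filter P nu f pi_nu) :
  {ae law0 P mu, forall w,
     `|pi_mu t w - pi_nu t w| @[t --> +oo%R] --> (0 : R)}.
Proof.
have [FM _ CI] := model; have [cf _ _] := fO.
have e0 (n : nat) : 0 < n.+1%:R^-1 :> R by [].
have cN (g : S -> R) : continuous g -> continuous (fun x => - g x).
  by move=> cg x; apply: cvgN; exact: cg.
have up : {ae law0 P mu, forall w, forall n : nat, exists2 u, 0 <= u &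
    forall t, u <= t -> pi_mu t w - pi_nu t w <= 4 * n.+1%:R^-1}.
  apply: ae_foralln => n; apply: (one_sided_merging Scompact munu cf) => //.
  exact: (observable_approx Scompact CI FM fO (e0 n)).
have lo : {ae law0 P mu, forall w, forall n : nat, exists2 u, 0 <= u &
    forall t, u <= t -> - pi_mu t w - - pi_nu t w <= 4 * n.+1%:R^-1}.
  apply: ae_foralln => n; apply: (one_sided_merging Scompact munu (cN f cf)) => //.
  - have [v Vv fv] := observable_approx Scompact CI FM fO (e0 n).
    exists (fun x => -1 * v x + cst 0 x).
      by apply: predicted_comb => //; exact: predicted_cst.
    by move=> x; rewrite addr0 mulN1r -opprD normrN.
  - exact: (is_filter_opp Scompact (@subset_refl _ _) cf pi_muE).
  - exact: (is_filter_opp Scompact (@subset_refl _ _) cf pi_nuE).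
apply: filterS2 up lo => w up lo; apply/cvgrPdist_lt => eps eps0.
have [n ne] : exists n : nat, n.+1%:R^-1 < eps / 4.
  exact: filter_ex (near_infty_natSinv_lt (PosNum (divr_gt0 eps0 (ltr0Sn R 3)))).
have [u u0 uH] := up n; have [u' u'0 u'H] := lo n.
exists (Num.max u u'); split; first exact: num_real.
move=> t; rewrite gt_max => /andP[/ltW/uH tu /ltW/u'H tu'].
rewrite sub0r normrN normr_id.
have : `|pi_mu t w - pi_nu t w| <= 4 * n.+1%:R^-1.
  by rewrite ler_norml tu andbT lerNl opprB; move: tu'; rewrite opprK addrC.
by move=> /le_lt_trans; apply; rewrite mulrC -ltr_pdivlMr.
Qed.
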